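(* Suppose that $\mathcal M\models\mathsf{PA}$, that $\mathcal M$ is countably generated over the exponentially closed cut $I$ of $\mathcal M$, and that $\operatorname{Cod}(\mathcal M/I)\subseteq\mathfrak X\subseteq\mathcal P(I)$. The following are equivalent: (1) $(\mathcal M|I,\mathfrak X)\models\mathsf{WKL}_0^*$ and $\mathfrak X$ is countably generated. (2) There is a countably generated extension $\mathcal N\succ_{\sf cf}\mathcal M$ such that $\operatorname{Cod}(\mathcal N/I)=\mathfrak X$. (3) There is a finitely generated extension $\mathcal N\succ_{\sf cf}\mathcal M$ such that $\operatorname{Cod}(\mathcal N/I)=\mathfrak X$.
   Context: $\mathsf{PA}$ is Peano Arithmetic in the language $\{+,\times,0,1,\le\}$; structures $\mathcal M,\mathcal N,\dots$ have universes $M,N,\dots$. $\mathcal N\succ\mathcal M$ means $\mathcal N$ is a proper elementary extension of $\mathcal M$; $\mathcal N\succ_{\sf cf}\mathcal M$ means in addition that $M$ is cofinal in $\mathcal N$. $\operatorname{Def}(\mathcal M)$ is the set of subsets of $M$ definable in $\mathcal M$ with parameters; for $X\subseteq M$, $\operatorname{Cod}(\mathcal M/X)=\{X\cap D: D\in\operatorname{Def}(\mathcal M)\}$. A cut $I$ of $\mathcal M$ is a nonempty proper subset of $M$ such that $a\in I$ whenever $b\in I$ and $a\le b+1$; it is exponentially closed if $2^a\in I$ whenever $a\in I$. $\mathcal M|I$ is the substructure of $\mathcal M$ with universe $I$. A set $X\subseteq M$ generates $\mathcal M$ if there is no $\mathcal K\prec\mathcal M$ with $X\subseteq K$. $\mathcal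 M$ is $\kappa$-generated over $I\subseteq M$ if there is $X\subseteq M$ with $|X|\le\kappa$ such that $X\cup I$ generates $\mathcal M$. An extension $\mathcal N\succ\mathcal M$ is $\kappa$-generated if $\mathcal N$ is $\kappa$-generated over $M$. ''Countably generated'' means $\aleph_0$-generated and ''finitely generated'' means $1$-generated. For a second-order structure $(\mathcal M,\mathfrak X)$ with $\mathfrak X\subseteq\mathcal P(M)$, $\Sigma^0_n$ and $\Pi^0_n$ formulas have no second-order quantifiers and may have parameters from $M$ and $\mathfrak X$ ($\Sigma^0_0=\Delta^0_0=\Pi^0_0$ being the bounded ones); $\Delta^0_n\text{-}\operatorname{Def}(\mathcal M,\mathfrak X)$ is the set of subsets of $M$ definable in $(\mathcal M,\mathfrak X)$ both by a $\Sigma^0_n$ and by a $\Pi^0_n$ formula. $\mathfrak X_0\subseteq\mathfrak X$ generates $\mathfrak X$ if $\Delta^0_1\text{-}\operatorname{Def}(\mathcal M,\mathfrak X_0)\supseteq\mathfrak X$; $\mathfrak X$ is $\kappa$-generated if it is generated by some $\mathfrak X_0\subseteq\mathfrak X$ with $|\mathfrak X_0|\le\kappa$, and countably generated if it is $\aleph_0$-generated. (Here these notions are applied to $(\mathcal M|I,\mathfrak X)$.) $\mathsf{RCA}_0^*$ is $\mathrm I\Sigma^0_0+\mathsf{exp}+\Delta^0_1\text{-}\mathsf{CA}$ (where $\mathsf{exp}$ says exponentiation is total), and $\mathsf{WKL}_0^*$ is $\mathsf{RCA}_0^*$ together with weak König's lemma $\mathsf{WKL}$ (every unbounded tree of finite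 $0,1$-sequences has an unbounded path).
   Formalization: Clauses (2) and (3) also require that I be a cut of N (N adds no element below an element of I); without this (2)⇒(1) and (3)⇒(1) fail: if N adds y below some i in I, then {x in I : x<y} is in Cod(N/I) and violates bounded induction. *)

(* Defs.v *)
From Stdlib Require Import Ring.
From mathcomp Require Import all_boot.
From mathcomp Require Import boolp classical_sets functions cardinality.

Set Implicit Arguments.
Unset Strict Implicit.
Unset Printing Implicit Defensive.

Local Open Scope classical_set_scope.
Local Open Scope card_scope.

Record structure := Structure {
  carrier :> Type;
  szero : carrier;
  sone : carrier;
  sadd : carrier -> carrier -> carrier;
  smul : carrier -> carrier -> carrier;
  sle : carrier -> carrier -> Prop }.

Arguments szero {s}.
Arguments sone {s}.
Arguments sadd {s}.
Arguments smul {s}.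
Arguments sle {s}.

Declare Scope arith_scope.
Delimit Scope arith_scope with A.
Notation "0" := szero : arith_scope.
Notation "1" := sone : arith_scope.
Notation "x + y" := (sadd x y) : arith_scope.
Notation "x * y" := (smul x y) : arith_scope.
Notation "x <= y" := (sle x y) : arith_scope.

Definition slt (M : structure) (x y : M) : Prop := sle x y /\ x <> y.
Notation "x < y" := (slt x y) : arith_scope.

Definition closed_sub (M : structure) (U : set M) : Prop :=
  [/\ U 0%A, U 1%A,
      forall x y, U x -> U y -> U (x + y)%A
    & forall x y, U x -> U y -> U (x * y)%A].

Section Substructure.
Variables (M : structure) (U : set M) (cU : closed_sub U).

Definition sub_zero : U := exist _ 0%A (mem_set (let: And4 h _ _ _ := cU in h)).
Definition sub_one : U := exist _ 1%A (mem_set (let: And4 _ h _ _ := cU in h)).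
Definition sub_add (x y : U) : U :=
  exist _ (val x + val y)%A
    (mem_set (let: And4 _ _ h _ := cU in
              h _ _ (set_mem (proj2_sig x)) (set_mem (proj2_sig y)))).
Definition sub_mul (x y : U) : U :=
  exist _ (val x * val y)%A
    (mem_set (let: And4 _ _ _ h := cU in
              h _ _ (set_mem (proj2_sig x)) (set_mem (proj2_sig y)))).

Definition substructure : structure :=
  @Structure U sub_zero sub_one sub_add sub_mul (fun x y => (val x <= val y)%A).

End Substructure.

Inductive term :=
  | tvar of nat
  | tzero
  | tone
  | tadd of term & term
  | tmul of term & term.

(* de Bruijn indices; P is the type of unary predicate symbols (set parameters).
   Bounded quantifiers are primitive; the bounding term lives outside the
   binder, so it does not contain the bound variable. *)
Inductive formula (P : Type) :=
  | feq of term & term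
  | fle of term & term
  | fmem of term & P
  | fnot of formula P
  | fand of formula P & formula P
  | for_ of formula P & formula P
  | fbex of term & formula P
  | fball of term & formula P
  | fex of formula P
  | fall of formula P.

Arguments feq {P}.
Arguments fle {P}.

Definition scons (T : Type) (x : T) (v : nat -> T) : nat -> T :=
  fun n => if n is k.+1 then v k else x.

Fixpoint teval (M : structure) (v : nat -> M) (t : term) : M :=
  match t with
  | tvar n => v n
  | tzero => 0%A
  | tone => 1%A
  | tadd s t => (teval v s + teval v t)%A
  | tmul s t => (teval v s * teval v t)%A
  end.

Fixpoint sat (M : structure) (P : Type) (pi : P -> set M) (v : nat -> M)
    (phi : formula P) : Prop :=
  match phi with
  | feq s t => teval v s = teval v t
  | fle s t => (teval v s <= teval v t)%A
  | fmem t p => pi p (teval v t)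
  | fnot f => ~ sat pi v f
  | fand f g => sat pi v f /\ sat pi v g
  | for_ f g => sat pi v f \/ sat pi v g
  | fbex t f => exists x, (x <= teval v t)%A /\ sat pi (scons x v) f
  | fball t f => forall x, (x <= teval v t)%A -> sat pi (scons x v) f
  | fex f => exists x, sat pi (scons x v) f
  | fall f => forall x, sat pi (scons x v) f
  end.

Definition fo_formula := formula void.

Definition fo_sat (M : structure) (v : nat -> M) (phi : fo_formula) : Prop :=
  sat (fun p : void => match p return set M with end) v phi.

(* Second-order formulas without set quantifiers, with set parameters from X. *)
Definition so_formula (M : structure) (X : set (set M)) := formula X.

Definition so_sat (M : structure) (X : set (set M)) (v : nat -> M)
    (phi : so_formula X) : Prop :=
  sat (fun A : X => val A) v phi.

Fixpoint bounded (P : Type) (phi : formula P) : Prop :=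
  match phi with
  | feq _ _ | fle _ _ | fmem _ _ => True
  | fnot f => bounded f
  | fand f g | for_ f g => bounded f /\ bounded g
  | fbex _ f | fball _ f => bounded f
  | fex _ | fall _ => False
  end.

Inductive is_Sigma (P : Type) : nat -> formula P -> Prop :=
  | Sigma_bounded phi : bounded phi -> is_Sigma 0 phi
  | Sigma_Pi n phi : is_Pi n phi -> is_Sigma n.+1 phi
  | Sigma_ex n phi : is_Sigma n.+1 phi -> is_Sigma n.+1 (fex phi)
with is_Pi (P : Type) : nat -> formula P -> Prop :=
  | Pi_bounded phi : bounded phi -> is_Pi 0 phi
  | Pi_Sigma n phi : is_Sigma n phi -> is_Pi n.+1 phi
  | Pi_all n phi : is_Pi n.+1 phi -> is_Pi n.+1 (fall phi).

Record PA_minus (M : structure) : Prop := {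
  pa_addA : forall x y z : M, (x + (y + z) = (x + y) + z)%A;
  pa_addC : forall x y : M, (x + y = y + x)%A;
  pa_mulA : forall x y z : M, (x * (y * z) = (x * y) * z)%A;
  pa_mulC : forall x y : M, (x * y = y * x)%A;
  pa_mulDr : forall x y z : M, (x * (y + z) = x * y + x * z)%A;
  pa_addx0 : forall x : M, (x + 0 = x)%A;
  pa_mulx0 : forall x : M, (x * 0 = 0)%A;
  pa_mulx1 : forall x : M, (x * 1 = x)%A;
  pa_lexx : forall x : M, (x <= x)%A;
  pa_le_anti : forall x y : M, (x <= y)%A -> (y <= x)%A -> x = y;
  pa_le_trans : forall x y z : M, (x <= y)%A -> (y <= z)%A -> (x <= z)%A;
  pa_le_total : forall x y : M, (x <= y)%A \/ (y <= x)%A;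
  pa_ltD : forall x y z : M, (x < y)%A -> (x + z < y + z)%A;
  pa_ltM : forall x y z : M, (0 < z)%A -> (x < y)%A -> (x * z < y * z)%A;
  pa_lt_sub : forall x y : M, (x < y)%A -> exists z, (x + z = y)%A;
  pa_lt01 : ((0 : M) < 1)%A;
  pa_discrete : forall x : M, (0 < x)%A -> (1 <= x)%A;
  pa_le0x : forall x : M, (0 <= x)%A }.

Definition PA (M : structure) : Prop :=
  PA_minus M /\
  forall (phi : fo_formula) (v : nat -> M),
    fo_sat (scons 0%A v) phi ->
    (forall x, fo_sat (scons x v) phi -> fo_sat (scons (x + 1)%A v) phi) ->
    forall x, fo_sat (scons x v) phi.

(* u is the remainder of c modulo 1 + (i+1)d (Goedel's beta function). *)
Definition beta (M : structure) (c d i u : M) : Prop :=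
  (u < 1 + (i + 1) * d)%A /\ exists q, (c = q * (1 + (i + 1) * d) + u)%A.

(* 2^a = b: some beta-coded sequence starts with 1, doubles at each of the
   steps below a, and has b as its a-th entry. *)
Definition pow2 (M : structure) (a b : M) : Prop :=
  exists c d : M,
    [/\ beta c d 0%A 1%A,
        forall i, (i < a)%A ->
          exists u, beta c d i u /\ beta c d (i + 1)%A (u + u)%A
      & beta c d a b].

Definition elementary (M N : structure) (f : M -> N) : Prop :=
  forall (phi : fo_formula) (v : nat -> M),
    fo_sat v phi <-> fo_sat (f \o v) phi.

(* N is a proper elementary extension of M, M being identified with range f. *)
Definition proper_ext (M N : structure) (f : M -> N) : Prop :=
  elementary f /\ range f <> setT.

Definition cofinal_ext (M N : structure) (f : M -> N) : Prop :=
  proper_ext f /\ forall y : N, exists x : M, (y <= f x)%A.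

Definition Def (M : structure) : set (set M) :=
  [set D | exists (phi : fo_formula) (v : nat -> M),
             D = [set x | fo_sat (scons x v) phi]].

Definition Cod (M : structure) (X : set M) : set (set M) :=
  [set X `&` D | D in @Def M].

Definition cut (M : structure) (I : set M) : Prop :=
  [/\ I !=set0, I <> setT & forall a b, I b -> (a <= b + 1)%A -> I a].

Definition exp_closed (M : structure) (I : set M) : Prop :=
  forall a, I a -> exists2 b, pow2 a b & I b.

(* No proper elementary substructure of M includes X. *)
Definition generates (M : structure) (X : set M) : Prop :=
  ~ exists (K : structure) (e : K -> M), proper_ext e /\ X `<=` range e.

(* The cardinal kappa is given by a type K. *)
Definition generated_over (K : Type) (M : structure) (I : set M) : Prop :=
  exists X : set M, X #<= [set: K] /\ generates (X `|` I).

Definition generated_ext (K : Type) (M N : structure) (f : M -> N) : Prop :=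
  generated_over K (range f).

Definition Delta1_Def (M : structure) (X : set (set M)) : set (set M) :=
  [set A | exists (phi psi : so_formula X) (v : nat -> M),
     [/\ is_Sigma 1 phi, is_Pi 1 psi,
         A = [set x | so_sat (scons x v) phi]
       & A = [set x | so_sat (scons x v) psi]]].

Definition so_generated (K : Type) (M : structure) (X : set (set M)) : Prop :=
  exists X0 : set (set M),
    [/\ X0 `<=` X, X0 #<= [set: K] & X `<=` Delta1_Def X0].

Definition ISigma00 (M : structure) (X : set (set M)) : Prop :=
  PA_minus M /\
  forall (phi : so_formula X) (v : nat -> M), is_Sigma 0 phi ->
    so_sat (scons 0%A v) phi ->
    (forall x, so_sat (scons x v) phi -> so_sat (scons (x + 1)%A v) phi) ->
    forall x, so_sat (scons x v) phi.

Definition exp_total (M : structure) : Prop :=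
  forall a : M, exists b : M, pow2 a b.

Definition Delta1_CA (M : structure) (X : set (set M)) : Prop :=
  Delta1_Def X `<=` X.

Definition RCA0s (M : structure) (X : set (set M)) : Prop :=
  [/\ ISigma00 X, exp_total M & Delta1_CA X].

(* The finite 0,1-sequence (e_0, ..., e_{n-1}) is coded by the number with
   binary expansion 1 e_0 ... e_{n-1}; every s <> 0 codes a unique sequence. *)
Definition is_seq (M : structure) (s : M) : Prop := s <> 0%A.

(* t is an initial segment of s: deleting the last k binary digits of s
   leaves t. *)
Definition initial_seg (M : structure) (t s : M) : Prop :=
  is_seq t /\
  exists k p r : M, [/\ pow2 k p, (r < p)%A & s = (t * p + r)%A].

Definition tree (M : structure) (T : set M) : Prop :=
  (forall s, T s -> is_seq s) /\
  (forall s t, T s -> initial_seg t s -> T t).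

Definition path_through (M : structure) (T B : set M) : Prop :=
  [/\ tree B, B `<=` T
    & forall s t, B s -> B t -> initial_seg s t \/ initial_seg t s].

Definition unbounded (M : structure) (A : set M) : Prop :=
  forall a : M, exists2 s, A s & (a <= s)%A.

Definition WKL (M : structure) (X : set (set M)) : Prop :=
  forall T, X T -> tree T -> unbounded T ->
    exists B, [/\ X B, path_through T B & unbounded B].

Definition WKL0s (M : structure) (X : set (set M)) : Prop :=
  RCA0s X /\ WKL X.

Section ClosedCut.
Variables (M : structure) (MPA : PA M).
Let H : PA_minus M := proj1 MPA.

Local Open Scope arith_scope.

Local Lemma pa_semiring :
  semi_ring_theory (@szero M) (@sone M) (@sadd M) (@smul M) (@eq M).
Proof.
case: H => aA aC mA mC mD a0 m0 m1 *; split => [x|x y|x y z|x|x|x y|x y z|x y z].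
- by rewrite aC a0.
- exact: aC.
- exact: aA.
- by rewrite mC m1.
- by rewrite mC m0.
- exact: mC.
- exact: mA.
- by rewrite ![_ * z]mC mD.
Qed.

Add Ring pa_ring : pa_semiring.

Local Lemma pa_leD (x z : M) : x <= x + z.
Proof.
have [<-|z0] := pselect (0 = z); first by rewrite (pa_addx0 H); exact: pa_lexx.
have [+ _] := pa_ltD H x (conj (pa_le0x H z) z0).
by rewrite (pa_addC H 0) (pa_addx0 H) (pa_addC H z).
Qed.

Local Lemma pa_le_sub (x y : M) : x <= y -> exists z, x + z = y.
Proof.
move=> xy; have [->|nxy] := pselect (x = y).
  by exists 0; rewrite (pa_addx0 H).
exact: (pa_lt_sub H (conj xy nxy)).
Qed.

Local Lemma pa_lt_irr (x : M) : ~ x < x.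
Proof. by case. Qed.

Local Lemma pa_lt_le_trans (x y z : M) : x < y -> y <= z -> x < z.
Proof.
move=> [xy nxy] yz; split; first exact: (pa_le_trans H xy yz).
by move=> xz; apply: nxy; apply: (pa_le_anti H xy); rewrite xz.
Qed.

Local Lemma pa_ltS (x y : M) : x < y -> x + 1 <= y.
Proof.
move=> xy; have [z xzy] := pa_lt_sub H xy.
have z0 : 0 < z.
  split; first exact: (pa_le0x H).
  by move=> z0; case: xy => _; apply; rewrite -xzy -z0 (pa_addx0 H).
have [w ew] := pa_le_sub (pa_discrete H z0).
rewrite -xzy -ew (pa_addA H); exact: pa_leD.
Qed.

Local Lemma pa_S_lt (x : M) : x < x + 1.
Proof.
have := pa_ltD H x (pa_lt01 H).
by rewrite (pa_addC H 0) (pa_addx0 H) (pa_addC H 1).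
Qed.

Local Lemma beta_fun (c d i u u' : M) : beta c d i u -> beta c d i u' -> u = u'.
Proof.
set m := 1 + (i + 1) * d.
have key : forall q q' v v' : M, v < m ->
    q * m + v = q' * m + v' -> ~ q < q'.
  move=> q q' v v' vm e qq'; have [w ew] := pa_le_sub (pa_ltS qq').
  apply: (@pa_lt_irr (q * m + v)).
  rewrite {2}e -ew; apply: (@pa_lt_le_trans _ (m + q * m)).
    by rewrite (pa_addC H (q * m)); exact: (pa_ltD H).
  have -> : (q + 1 + w) * m + v' = (m + q * m) + (w * m + v') by ring.
  exact: pa_leD.
have keyv : forall q v v' : M, q * m + v = q * m + v' -> ~ v < v'.
  move=> q v v' e vv'; apply: (@pa_lt_irr (v + q * m)).
  by rewrite {2}(pa_addC H v) e (pa_addC H _ v'); exact: (pa_ltD H).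
move=> [um [q e]] [um' [q' e']]; rewrite -/m in um e um' e'.
have ee : q * m + u = q' * m + u' by rewrite -e.
have eq : q = q'.
  apply: contrapT => n; case: (pa_le_total H q q') => h.
    exact: (key _ _ _ _ um ee).
  by apply: (key _ _ _ _ um' (esym ee)); split => // /esym.
rewrite -eq in ee; apply: contrapT => n.
case: (pa_le_total H u u') => h; first exact: (keyv _ _ _ ee).
by apply: (keyv _ _ _ (esym ee)); split => // /esym.
Qed.

(* i^2 + 2i + 3 <= 4 * 2^i *)
Local Lemma pow2_ge (a b : M) : pow2 a b ->
  a * a + (1 + 1) * a + (1 + 1 + 1) <= (1 + 1 + 1 + 1) * b.
Proof.
move=> [c [d [b0 bS ba]]].
pose Q i := ~ i <= a \/ exists u, beta c d i u /\
  i * i + (1 + 1) * i + (1 + 1 + 1) <= (1 + 1 + 1 + 1) * u.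
suff /(_ a) [/(_ (pa_lexx H a))//|[u [bu hu]]] : forall i, Q i.
  by rewrite (beta_fun ba bu).
pose v := scons a (scons c (scons d (fun=> 0))).
pose two := tadd tone tone.
(* under the quantifier on u: u, i, a, c, d *)
pose mm k := tadd tone (tmul (tadd (tvar k.+1) tone) (tvar k.+4)).
pose phi : fo_formula :=
  for_ (fnot (fle (tvar 0) (tvar 1)))
   (fex (fand
     (fand (fand (fle (tvar 0) (mm 0%N)) (fnot (feq (tvar 0) (mm 0%N))))
       (fex (feq (tvar 4) (tadd (tmul (tvar 0) (mm 1%N)) (tvar 1)))))
     (fle (tadd (tadd (tmul (tvar 1) (tvar 1)) (tmul two (tvar 1)))
                (tadd two tone))
          (tmul (tadd (tadd two tone) tone) (tvar 0))))).
have E i : fo_sat (scons i v) phi = Q i by [].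
apply: (proj2 MPA phi v).
  rewrite E; right; exists 1; split=> //.
  have -> : (1 + 1 + 1 + 1) * 1 =
    (0 * 0 + (1 + 1) * 0 + (1 + 1 + 1) : M) + 1 by ring.
  exact: pa_leD.
move=> i; rewrite !E => -[nia|[u [bu hu]]].
  left=> h; apply: nia; apply: (pa_le_trans H _ h); exact: pa_leD.
have [h|h] := pselect (i + 1 <= a); last by left.
have [u' [bu' bu2]] := bS _ (pa_lt_le_trans (pa_S_lt i) h).
rewrite -(beta_fun bu bu') in bu2.
right; exists (u + u); split=> //.
have [z ez] := pa_le_sub hu.
have -> : (1 + 1 + 1 + 1) * (u + u) =
  ((1 + 1 + 1 + 1) * u) + ((1 + 1 + 1 + 1) * u) by ring.
rewrite -ez.
set l := (X in _ <= X); set r := (X in X <= _).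
have -> : l = r + (i * i + z + z) by rewrite /l /r; ring.
exact: pa_leD.
Qed.

Lemma exp_closed_cut_closed_sub (I : set M) :
  cut I -> exp_closed I -> closed_sub I.
Proof.
move=> [[x Ix] _ dn] ex.
have Id y z : I z -> y <= z -> I y.
  move=> Iz yz; apply: dn Iz _; exact: (pa_le_trans H yz (pa_leD _ _)).
have I0 : I 0 by apply: Id Ix _; exact: (pa_le0x H).
have IS y : I y -> I (y + 1) by move=> Iy; apply: dn Iy _; exact: (pa_lexx H).
have I1 : I 1 by rewrite -(pa_addx0 H 1) (pa_addC H); exact: IS.
have Idbl y : I y -> I (y + y).
  move=> Iy; have /ex[b /pow2_ge hb Ib] := IS _ (IS _ (IS _ (IS _ Iy))).
  apply: Id Ib _; apply: contrapT => nyb.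
  have by_ : b < y + y.
    case: (pa_le_total H b (y + y)) => // h; split=> // e.
    by apply: nyb; rewrite e; exact: (pa_lexx H).
  have [w ew] := pa_le_sub (proj1 by_).
  have := pa_le_trans H hb (pa_leD _ ((1 + 1 + 1 + 1) * w)).
  have -> : (1 + 1 + 1 + 1) * b + (1 + 1 + 1 + 1) * w =
    (1 + 1 + 1 + 1) * (b + w) by ring.
  rewrite ew; set l := (X in X <= _); set r := (X in _ <= X) => lr.
  have el : l = r + 1 + ((y * y + (1 + 1) * y) +
    (1 + 1 + 1 + 1) * (1 + 1 + 1 + 1) + (1 + 1) * (1 + 1 + 1 + 1) + 1 + 1).
    by rewrite /l /r; ring.
  apply: (@pa_lt_irr r); apply: (pa_lt_le_trans (pa_S_lt r)).
  by apply: (pa_le_trans H _ lr); rewrite el; exact: pa_leD.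
have Imax y z : I y -> I z -> exists2 m, I m & y <= m /\ z <= m.
  move=> Iy Iz; case: (pa_le_total H y z) => h.
    by exists z => //; split=> //; exact: (pa_lexx H).
  by exists y => //; split=> //; exact: (pa_lexx H).
split=> // y z Iy Iz; have [m Im [ym zm]] := Imax _ _ Iy Iz;
  have [s es] := pa_le_sub ym; have [t et] := pa_le_sub zm.
  apply: Id (Idbl _ Im) _; rewrite -{1}es -et.
  have -> : y + s + (z + t) = y + z + (s + t) by ring.
  exact: pa_leD.
have [b /pow2_ge hb /Idbl/Idbl Ib] := ex _ Im.
apply: Id Ib _.
have -> : b + b + (b + b) = (1 + 1 + 1 + 1) * b by ring.
apply: (pa_le_trans H _ hb).
have -> : m * m + (1 + 1) * m + (1 + 1 + 1) =
   m * m + ((1 + 1) * m + (1 + 1 + 1)) by ring.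
apply: (pa_le_trans H _ (pa_leD _ _)).
rewrite -{1}es -et.
have -> : (y + s) * (z + t) = y * z + (y * t + s * z + s * t) by ring.
exact: pa_leD.
Qed.

End ClosedCut.

Definition cut_structure (M : structure) (MPA : PA M) (I : set M)
    (cI : cut I) (eI : exp_closed I) : structure :=
  substructure (exp_closed_cut_closed_sub MPA cI eI).

(* A family of subsets of I, as a family of subsets of the universe of M|I. *)
Definition cut_family (M : structure) (MPA : PA M) (I : set M)
    (cI : cut I) (eI : exp_closed I) (X : set (set M)) :
    set (set (cut_structure MPA cI eI)) :=
  [set (@set_val M I) @^-1` A | A in X].

Arguments cut_structure {M} MPA {I} cI eI.
Arguments cut_family {M} MPA {I} cI eI X.

(* f is an extension in which I remains a cut and Cod(N/I) = X, subsets of M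
   being identified with their images under f. Here Cod(N/I) is read as
   presupposing that I is a cut of N: if N had a new element y below some
   element of I, then {x in I | x <= y} would be in Cod(N/I), and
   (M|I, Cod(N/I)) would not even satisfy bounded induction. *)
Definition Cod_ext_eq (M N : structure) (f : M -> N) (I : set M)
    (X : set (set M)) : Prop :=
  cut (f @` I) /\ Cod (f @` I) = [set f @` A | A in X].

(* Main.v *)
From HB Require Import structures.
Require Import Defs.
From Stdlib Require Import Ring.
From mathcomp Require Import all_boot all_order all_algebra.
From mathcomp Require Import boolp classical_sets functions cardinality.

(** Write [S] for the cut, as a structure, and call a subset of [S] coded in a
    model that has [S] as a cut if it is the trace of a definable set.

    From an extension to the theory.  The family of all sets coded in a model of
    arithmetic always satisfies WKL0*.  Bounded formulas are absolute between the
    cut and the model, which gives bounded induction; exponentiation is absolute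
    because a code of the sequence 1, 2, ..., 2^a is bounded by a double exponential
    ([small_pow2]); a set that is Delta_1 in coded sets is coded, since inside the
    cut one may compare the least witnesses of membership and of non-membership
    ([Delta1_coded]); and an unbounded coded tree has, by overspill, a node beyond
    the cut whose initial segments form a path ([coded_WKL]).  If moreover the model
    is generated by the cut and countably many elements, its definable sets fall
    into countably many families indexed uniformly by the cut
    ([generated_families]), and one coded set for each family generates all of them
    ([coded_generated]).  An extension that is countably generated over the base
    model is countably generated over the cut ([generated_trans]).

    From the theory to a finitely generated extension.  The extension is the
    ultrapower of the base model by definable functions modulo a type of a bounded
    element, so it is cofinal and generated by one element.  The type is built in
    countably many steps; each step treats one of the countably many families of
    definable relations [Q x i], with [i] in the cut, and one of the countably many
    sets generating [X].  A stage is a partition of an interval into fibres, together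
    with a path, belonging to [X], towards an ideal fibre; near every finite part of
    the path there are fibres of size 2^r, with r above the cut.  To decide all
    [Q x i] at once, split the fibres according to the sequence of truth values of
    [Q x i] for [i] below a number h above the cut with 2 h <= r.  By the pigeonhole
    principle some piece of a fibre of size 2^r has size at least 2^h, so the truth
    value sequences that belong to large pieces form an unbounded tree, and weak
    Koenig's lemma gives a path in [X] ([condition_decide]).  Since the truth values at all
    [i] in the cut form a set in [X], no coded set leaves [X], and since initial parts
    of the path are finite, no new element appears below the cut.  To make a given
    [A] in [X] coded, split the fibres into 2^h consecutive pieces of size 2^h and
    follow the path given by the characteristic function of [A] ([condition_code]).  When
    a generating family is coded, all of [X] is, because the coded sets are closed
    under Delta_1 comprehension.

    Arithmetic in the model is developed semantically: predicates are shown
    definable from their shape, induction applies to definable predicates, and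
    Goedel's beta function gives recursion, hence powers of 2, binary sequences and
    cardinalities of bounded definable sets. *)

Set Implicit Arguments.
Unset Strict Implicit.
Unset Printing Implicit Defensive.

Local Open Scope classical_set_scope.

(** * Renaming and free variables of formulas *)

Fixpoint tren (r : nat -> nat) (t : term) : term :=
  match t with
  | tvar n => tvar (r n)
  | tzero => tzero
  | tone => tone
  | tadd s t => tadd (tren r s) (tren r t)
  | tmul s t => tmul (tren r s) (tren r t)
  end.

Definition rlift (r : nat -> nat) (k : nat) : nat :=
  if k is k'.+1 then (r k').+1 else 0.

Fixpoint fren (P : Type) (r : nat -> nat) (phi : formula P) : formula P :=
  match phi with
  | feq s t => feq (tren r s) (tren r t)
  | fle s t => fle (tren r s) (tren r t)
  | fmem t p => fmem (tren r t) p
  | fnot f => fnot (fren r f)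
  | fand f g => fand (fren r f) (fren r g)
  | for_ f g => for_ (fren r f) (fren r g)
  | fbex t f => fbex (tren r t) (fren (rlift r) f)
  | fball t f => fball (tren r t) (fren (rlift r) f)
  | fex f => fex (fren (rlift r) f)
  | fall f => fall (fren (rlift r) f)
  end.

Section Renaming.
Variables (M : structure) (P : Type) (pi : P -> set M).
Implicit Types (v w : nat -> M) (phi : formula P).

Lemma scons_ren r x v : scons x v \o rlift r = scons x (v \o r).
Proof. by apply/funext => -[]. Qed.

Lemma teval_ren r v t : teval v (tren r t) = teval (v \o r) t.
Proof. by elim: t => //= s -> t ->. Qed.

(** Substitutions are only ever renamings here: instantiating a variable by a
    parameter is left to the environment. *)
Lemma sat_ren phi r v : sat pi v (fren r phi) <-> sat pi (v \o r) phi.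
Proof.
elim: phi r v => //=
  [s t|s t|t p|f IH|f IHf g IHg|f IHf g IHg|t f IH|t f IH|f IH|f IH] r v;
  rewrite ?teval_ren ?IH ?IHf ?IHg //.
- by split=> -[x [xt fx]]; exists x; split=> //; move: fx; rewrite IH scons_ren.
- by split=> fx x /fx; rewrite IH scons_ren.
- by split=> -[x fx]; exists x; move: fx; rewrite IH scons_ren.
- by split=> fx x; move: (fx x); rewrite IH scons_ren.
Qed.

End Renaming.

Fixpoint tfv (t : term) : nat :=
  match t with
  | tvar n => n.+1
  | tzero | tone => 0
  | tadd s t | tmul s t => maxn (tfv s) (tfv t)
  end.

Fixpoint ffv (P : Type) (phi : formula P) : nat :=
  match phi with
  | feq s t | fle s t => maxn (tfv s) (tfv t)
  | fmem t _ => tfv t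
  | fnot f => ffv f
  | fand f g | for_ f g => maxn (ffv f) (ffv g)
  | fbex t f | fball t f => maxn (tfv t) (ffv f).-1
  | fex f | fall f => (ffv f).-1
  end.

Section FreeVariables.
Variables (M : structure) (P : Type) (pi : P -> set M).
Implicit Types (v w : nat -> M) (phi : formula P).

Let agree n v w := forall k, k < n -> v k = w k.

Let agreel m n v w : agree (maxn m n) v w -> agree m v w.
Proof. by move=> a k km; apply: a; rewrite leq_max km. Qed.

Let agreer m n v w : agree (maxn m n) v w -> agree n v w.
Proof. by move=> a k kn; apply: a; rewrite leq_max kn orbT. Qed.

Let agreeS n v w x : agree n.-1 v w -> agree n (scons x v) (scons x w).
Proof. by case: n => [|n] //= a [|k] //=; exact: a. Qed.

Lemma teval_fv t v w : agree (tfv t) v w -> teval v t = teval w t.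
Proof.
elim: t => //= [n|s IHs t IHt|s IHs t IHt]; first by apply.
  by move=> a; rewrite (IHs (agreel a)) (IHt (agreer a)).
by move=> a; rewrite (IHs (agreel a)) (IHt (agreer a)).
Qed.

Lemma sat_fv phi v w : agree (ffv phi) v w -> (sat pi v phi <-> sat pi w phi).
Proof.
elim: phi v w => //=
  [s t|s t|t p|f IH|f IHf g IHg|f IHf g IHg|t f IH|t f IH|f IH|f IH] v w a.
- by rewrite (teval_fv (agreel a)) (teval_fv (agreer a)).
- by rewrite (teval_fv (agreel a)) (teval_fv (agreer a)).
- by rewrite (teval_fv a).
- by rewrite (IH v w a).
- by rewrite (IHf v w (agreel a)) (IHg v w (agreer a)).
- by rewrite (IHf v w (agreel a)) (IHg v w (agreer a)).
- rewrite (teval_fv (agreel a)).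
  by split=> -[x [xt fx]]; exists x; split=> //;
    apply/(IH _ _ (agreeS x (agreer a))).
- rewrite (teval_fv (agreel a)).
  by split=> fx x /fx; move/(IH _ _ (agreeS x (agreer a))).
- by split=> -[x fx]; exists x; apply/(IH _ _ (agreeS x a)).
- by split=> fx x; apply/(IH _ _ (agreeS x a)).
Qed.

End FreeVariables.

Section MapPredicates.
Variables (M : structure) (P Q : Type) (h : P -> Q) (pi : P -> set M)
  (rho : Q -> set M).
Hypothesis h_pi : forall p, pi p = rho (h p).

Fixpoint fmap (phi : formula P) : formula Q :=
  match phi with
  | feq s t => feq s t
  | fle s t => fle s t
  | fmem t p => fmem t (h p)
  | fnot f => fnot (fmap f)
  | fand f g => fand (fmap f) (fmap g)
  | for_ f g => for_ (fmap f) (fmap g)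
  | fbex t f => fbex t (fmap f)
  | fball t f => fball t (fmap f)
  | fex f => fex (fmap f)
  | fall f => fall (fmap f)
  end.

Lemma sat_fmap phi v : sat rho v (fmap phi) <-> sat pi v phi.
Proof.
elim: phi v => //=
  [t p|f IH|f IHf g IHg|f IHf g IHg|t f IH|t f IH|f IH|f IH] v.
- by rewrite h_pi.
- by rewrite IH.
- by rewrite IHf IHg.
- by rewrite IHf IHg.
- by split=> -[x [xt fx]]; exists x; split=> //; apply/IH.
- by split=> fx x /fx /IH.
- by split=> -[x fx]; exists x; apply/IH.
- by split=> fx x; apply/IH.
Qed.

Lemma bounded_fmap phi : bounded phi -> bounded (fmap phi).
Proof. by elim: phi => //= f IHf g IHg [/IHf ? /IHg]. Qed.

Lemma Sigma_Pi_fmap n :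
  (forall phi, is_Sigma n phi -> is_Sigma n (fmap phi)) /\
  (forall phi, is_Pi n phi -> is_Pi n (fmap phi)).
Proof.
elim: n => [|n [IHS IHP]]; split=> phi.
- by move=> h0; inversion h0; constructor; exact: bounded_fmap.
- by move=> h0; inversion h0; constructor; exact: bounded_fmap.
- elim: phi => [s t|s t|t p|f IH|f IHf g IHg|f IHf g IHg|t f IH|t f IH|f IH|f IH] h0;
    inversion h0; subst; try by apply: Sigma_Pi; exact: IHP.
  by apply: Sigma_ex; exact: IH.
- elim: phi => [s t|s t|t p|f IH|f IHf g IHg|f IHf g IHg|t f IH|t f IH|f IH|f IH] h0;
    inversion h0; subst; try by apply: Pi_Sigma; exact: IHS.
  by apply: Pi_all; exact: IH.
Qed.

End MapPredicates.

(** * Countability of the set of formulas *)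

Section Countable.
Import GenTree.

Fixpoint tcode (t : term) : GenTree.tree nat :=
  match t with
  | tvar n => Leaf n
  | tzero => Node 0 [::]
  | tone => Node 1 [::]
  | tadd s t => Node 2 [:: tcode s; tcode t]
  | tmul s t => Node 3 [:: tcode s; tcode t]
  end.

Fixpoint fcode (phi : fo_formula) : GenTree.tree nat :=
  match phi with
  | feq s t => Node 0 [:: tcode s; tcode t]
  | fle s t => Node 1 [:: tcode s; tcode t]
  | fmem t p => match p with end
  | fnot f => Node 2 [:: fcode f]
  | fand f g => Node 3 [:: fcode f; fcode g]
  | for_ f g => Node 4 [:: fcode f; fcode g]
  | fbex t f => Node 5 [:: tcode t; fcode f]
  | fball t f => Node 6 [:: tcode t; fcode f]
  | fex f => Node 7 [:: fcode f]
  | fall f => Node 8 [:: fcode f]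
  end.

Lemma tcode_inj : injective tcode.
Proof.
elim=> [n|||s IHs t IHt|s IHs t IHt] [m|||s' t'|s' t'] //=.
- by case=> ->.
- by case=> /IHs -> /IHt ->.
- by case=> /IHs -> /IHt ->.
Qed.

Lemma fcode_inj : injective fcode.
Proof.
elim=> [s t|s t|t []|f IH|f IHf g IHg|f IHf g IHg|t f IH|t f IH|f IH|f IH]
  [s' t'|s' t'|t' []|f'|f' g'|f' g'|t' f'|t' f'|f'|f'] //=.
- by case=> /tcode_inj -> /tcode_inj ->.
- by case=> /tcode_inj -> /tcode_inj ->.
- by case=> /IH ->.
- by case=> /IHf -> /IHg ->.
- by case=> /IHf -> /IHg ->.
- by case=> /tcode_inj -> /IH ->.
- by case=> /tcode_inj -> /IH ->.
- by case=> /IH ->.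
- by case=> /IH ->.
Qed.

Lemma formula_enum : exists F : nat -> fo_formula, forall phi, exists n, F n = phi.
Proof.
pose c phi := pickle (fcode phi).
have c_inj : injective c by move=> x y /(pcan_inj (@pickleK _)) /fcode_inj.
exists (fun n => if pselect (exists phi, c phi = n) is left h
                 then projT1 (cid h) else feq tzero tzero) => phi.
exists (c phi); case: pselect => [h|[]]; last by exists phi.
by apply: c_inj; case: (cid h).
Qed.

End Countable.

(** * Definable predicates and functions *)

Section Definability.
Variable M : structure.
Notation env := (nat -> M).
Implicit Types (P Q : env -> Prop) (f g : env -> M).

Lemma fo_sat_eq (phi : fo_formula) (v w : env) :
  v =1 w -> fo_sat v phi -> fo_sat w phi.
Proof. by move=> /funext ->. Qed.

Definition look (e : env) (s : nat + M) : M :=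
  match s with inl i => e i | inr a => a end.

(** A predicate on environments is definable when it is given by a formula
    whose variables are instantiated by entries of the environment or by
    parameters; keeping both kinds apart makes every closure property below a
    matter of renaming variables. *)
Definition definable P : Prop :=
  exists (phi : fo_formula) (s : nat -> nat + M),
    forall e, P e <-> fo_sat (fun k => look e (s k)) phi.

Definition fdefinable f : Prop := definable (fun e => e 0 = f (fun k => e k.+1)).

Definition definable1 (P : M -> Prop) := definable (fun e => P (e 0)).
Definition definable2 (P : M -> M -> Prop) := definable (fun e => P (e 0) (e 1)).
Definition definable3 (P : M -> M -> M -> Prop) := definable (fun e => P (e 0) (e 1) (e 2)).
Definition fdefinable1 (f : M -> M) := fdefinable (fun e => f (e 0)).
Definition fdefinable2 (f : M -> M -> M) := fdefinable (fun e => f (e 0) (e 1)).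
Definition fdefinable3 (f : M -> M -> M -> M) := fdefinable (fun e => f (e 0) (e 1) (e 2)).

Lemma definable_iff P Q : (forall e, P e <-> Q e) -> definable Q -> definable P.
Proof. by move=> PQ [phi [s h]]; exists phi, s => e; rewrite PQ. Qed.

Lemma definable_not P : definable P -> definable (fun e => ~ P e).
Proof. by case=> phi [s h]; exists (fnot phi), s => e; rewrite h. Qed.

Lemma definable_and P Q : definable P -> definable Q -> definable (fun e => P e /\ Q e).
Proof.
move=> [phi [s h]] [psi [t k]].
exists (fand (fren double phi) (fren (fun k => k.*2.+1) psi)).
exists (fun k => if odd k then t k./2 else s k./2) => e.
rewrite /fo_sat /= !sat_ren h k /fo_sat /=.
have -> : (fun k => look e (s k)) =
    (fun k => look e (if odd k then t k./2 else s k./2)) \o double.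
  by apply/funext => i /=; rewrite odd_double doubleK.
have -> // : (fun k => look e (t k)) =
    (fun k => look e (if odd k then t k./2 else s k./2)) \o (fun k => k.*2.+1).
by apply/funext => i /=; rewrite odd_double /= uphalf_double.
Qed.

Lemma definable_ex (P : M -> env -> Prop) :
  definable (fun e => P (e 0) (fun k => e k.+1)) -> definable (fun e => exists x, P x e).
Proof.
move=> [phi [s h]].
exists (fex (fren (fun k => if s k is inl 0 then 0 else k.+1) phi)).
exists (fun k => match s k with inl i => inl i.-1 | inr a => inr a end) => e.
rewrite /fo_sat /=; split=> -[x hx]; exists x.
  apply/sat_ren; have := proj1 (h (scons x e)) hx.
  by apply: fo_sat_eq => k /=; case E: (s k) => [[]|] /=; rewrite ?E.
apply: (proj2 (h (scons x e))); move/sat_ren: hx.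
by apply: fo_sat_eq => k /=; case E: (s k) => [[]|] /=; rewrite ?E.
Qed.

Lemma definable_ren (r : nat -> nat) P : definable P -> definable (fun e => P (fun k => e (r k))).
Proof.
move=> [phi [s h]].
exists phi, (fun k => match s k with inl i => inl (r i) | inr a => inr a end) => e.
by rewrite h; split; apply: fo_sat_eq => k /=; case: (s k).
Qed.

Lemma fdefinable_ren (r : nat -> nat) f : fdefinable f -> fdefinable (fun e => f (fun k => e (r k))).
Proof. exact: (@definable_ren (rlift r)). Qed.

Lemma definable_or P Q : definable P -> definable Q -> definable (fun e => P e \/ Q e).
Proof.
move=> dp dq; apply: definable_iff (definable_not (definable_and (definable_not dp) (definable_not dq))) => e.
by rewrite not_andP !notK.
Qed.

Lemma definable_imp P Q : definable P -> definable Q -> definable (fun e => P e -> Q e).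
Proof.
move=> dp dq; apply: definable_iff (definable_or (definable_not dp) dq) => e.
by rewrite implyE.
Qed.

Lemma definable_iffP P Q : definable P -> definable Q -> definable (fun e => P e <-> Q e).
Proof. by move=> dp dq; apply: definable_and; [exact: (definable_imp dp dq)|exact: (definable_imp dq dp)]. Qed.

Lemma definable_all (P : M -> env -> Prop) :
  definable (fun e => P (e 0) (fun k => e k.+1)) -> definable (fun e => forall x, P x e).
Proof.
move=> dp; apply: definable_iff (definable_not (@definable_ex (fun x e => ~ P x e) (definable_not dp))) => e.
by split=> [h [x]|h x]; [exact|apply: contrapT => n; apply: h; exists x].
Qed.

Lemma definable_ex2 (P Q : M -> env -> Prop) :
  definable (fun e => P (e 0) (fun k => e k.+1)) ->
  definable (fun e => Q (e 0) (fun k => e k.+1)) ->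
  definable (fun e => exists2 x, P x e & Q x e).
Proof.
move=> dp dq; apply: definable_iff (@definable_ex (fun x e => P x e /\ Q x e) (definable_and dp dq)) => e.
by split=> [[x hp hq]|[x [hp hq]]]; exists x.
Qed.

Lemma definable_let f (Q : M -> env -> Prop) :
  fdefinable f -> definable (fun e => Q (e 0) (fun k => e k.+1)) -> definable (fun e => Q (f e) e).
Proof.
move=> df dq; apply: definable_iff (@definable_ex (fun x e => x = f e /\ Q x e) (definable_and df dq)) => e.
by split=> [h|[x [->]]] //; exists (f e).
Qed.

Lemma definable_const (A : Prop) : definable (fun=> A).
Proof.
by have [h|h] := pselect A;
  [exists (feq tzero tzero)|exists (fnot (feq tzero tzero))];
  exists inl => e; rewrite /fo_sat /=; intuition.
Qed.

Lemma fdefinable_var k : fdefinable (fun e => e k).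
Proof. by exists (feq (tvar 0) (tvar k.+1)), inl. Qed.

Lemma fdefinable_const a : fdefinable (fun=> a).
Proof.
exists (feq (tvar 0) (tvar 1)), (fun k => if k is 0 then inl 0 else inr a).
by [].
Qed.

Lemma definable_eq f g : fdefinable f -> fdefinable g -> definable (fun e => f e = g e).
Proof.
move=> df dg; apply: (@definable_let f (fun x e => x = g e)) => //.
Qed.

Lemma definable_le f g : fdefinable f -> fdefinable g -> definable (fun e => (f e <= g e)%A).
Proof.
move=> df dg; apply: (@definable_let f (fun x e => (x <= g e)%A)) => //; 
apply: (@definable_let (fun e => g (fun k => e k.+1)) (fun x e => (e 0%N <= x)%A)).
  exact: (fdefinable_ren _ dg).
by exists (fle (tvar 1) (tvar 0)), inl.
Qed.

Lemma definable_lt f g : fdefinable f -> fdefinable g -> definable (fun e => (f e < g e)%A).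
Proof.
by move=> df dg; apply: definable_and; [exact: definable_le|apply: definable_not; exact: definable_eq].
Qed.

Lemma fdefinable_add f g : fdefinable f -> fdefinable g -> fdefinable (fun e => (f e + g e)%A).
Proof.
move=> df dg; rewrite /fdefinable.
apply: (@definable_let (fun e => f (fun k => e k.+1))
          (fun x e => e 0 = (x + g (fun k => e k.+1))%A)).
  exact: (fdefinable_ren S df).
apply: (@definable_let (fun e => g (fun k => e k.+2)) (fun x e => e 1 = (e 0%N + x)%A)).
  exact: (fdefinable_ren (fun k => k.+2) dg).
by exists (feq (tvar 2) (tadd (tvar 1) (tvar 0))), inl.
Qed.

Lemma fdefinable_mul f g : fdefinable f -> fdefinable g -> fdefinable (fun e => (f e * g e)%A).
Proof.
move=> df dg; rewrite /fdefinable.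
apply: (@definable_let (fun e => f (fun k => e k.+1))
          (fun x e => e 0 = (x * g (fun k => e k.+1))%A)).
  exact: (fdefinable_ren S df).
apply: (@definable_let (fun e => g (fun k => e k.+2)) (fun x e => e 1 = (e 0%N * x)%A)).
  exact: (fdefinable_ren (fun k => k.+2) dg).
by exists (feq (tvar 2) (tmul (tvar 1) (tvar 0))), inl.
Qed.

Definition pif (A : Prop) (x y : M) : M := if `[< A >] then x else y.

Lemma fdefinable_if P f g : definable P -> fdefinable f -> fdefinable g -> fdefinable (fun e => pif (P e) (f e) (g e)).
Proof.
move=> dp df dg; rewrite /fdefinable /pif.
have dp' : definable (fun e => P (fun k => e k.+1)) by exact: (definable_ren S dp).
apply: definable_iff (definable_and (definable_imp dp' df) (definable_imp (definable_not dp') dg)) => e /=.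
by case: asboolP => h; split=> [|[]]; tauto.
Qed.

Section Satisfaction.
Variables (T : Type) (pi : T -> set M).
Hypothesis dpi : forall p, definable1 (pi p).

Lemma fdefinable_teval t (s : nat -> env -> M) :
  (forall k, fdefinable (s k)) -> fdefinable (fun e => teval (s^~ e) t).
Proof.
move=> ds; elim: t => //= [||u IHu v IHv|u IHu v IHv]; try exact: fdefinable_const.
  exact: fdefinable_add.
exact: fdefinable_mul.
Qed.

Lemma definable_mem p f : fdefinable f -> definable (fun e => pi p (f e)).
Proof.
move=> df; apply: (@definable_let f (fun x _ => pi p x)) => //; exact: dpi.
Qed.

Let push (s : nat -> env -> M) (k : nat) (e : env) : M :=
  if k is k'.+1 then s k' (fun i => e i.+1) else e 0.

Let push_dF s : (forall k, fdefinable (s k)) -> forall k, fdefinable (push s k).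
Proof. by move=> ds [|k] /=; [exact: fdefinable_var|exact: (fdefinable_ren S (ds k))]. Qed.

Let pushE s e : push s ^~ e = scons (e 0) (s^~ (fun i => e i.+1)).
Proof. by apply/funext => -[]. Qed.

Lemma definable_sat (phi : formula T) (s : nat -> env -> M) :
  (forall k, fdefinable (s k)) -> definable (fun e => sat pi (s^~ e) phi).
Proof.
elim: phi s =>
  [u t|u t|t p|f IH|f IHf g IHg|f IHf g IHg|t f IH|t f IH|f IH|f IH] s ds /=.
- by apply: definable_eq; exact: fdefinable_teval.
- by apply: definable_le; exact: fdefinable_teval.
- by apply: definable_mem; exact: fdefinable_teval.
- by apply: definable_not; exact: IH.
- by apply: definable_and; [exact: IHf|exact: IHg].
- by apply: definable_or; [exact: IHf|exact: IHg].
- apply: (@definable_ex (fun x e => (x <= teval (s^~ e) t)%A /\ _)); apply: definable_and.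
    by apply: definable_le; [exact: fdefinable_var|exact: (fdefinable_ren S (fdefinable_teval _ ds))].
  apply: definable_iff (IH _ (push_dF ds)) => e; by rewrite pushE.
- apply: (@definable_all (fun x e => (x <= teval (s^~ e) t)%A -> _)); apply: definable_imp.
    by apply: definable_le; [exact: fdefinable_var|exact: (fdefinable_ren S (fdefinable_teval _ ds))].
  apply: definable_iff (IH _ (push_dF ds)) => e; by rewrite pushE.
- apply: definable_ex; apply: definable_iff (IH _ (push_dF ds)) => e; by rewrite pushE.
- apply: definable_all; apply: definable_iff (IH _ (push_dF ds)) => e; by rewrite pushE.
Qed.

End Satisfaction.

(** The composition of definable predicates with definable functions, from which
    the forms of fixed arity below follow. *)
Lemma definable_subst P (s : nat -> env -> M) :
  (forall k, fdefinable (s k)) -> definable P -> definable (fun e => P (s^~ e)).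
Proof.
move=> ds [phi [l h]].
apply: definable_iff (@definable_sat void _ _ phi
  (fun k e => match l k with inl i => s i e | inr a => a end) _) => [e|[]|k].
  by rewrite h; split; apply: fo_sat_eq => k /=; case: (l k).
by case: (l k) => // a; exact: fdefinable_const.
Qed.

Lemma fdefinable_subst f (s : nat -> env -> M) :
  (forall k, fdefinable (s k)) -> fdefinable f -> fdefinable (fun e => f (s^~ e)).
Proof.
move=> ds df; rewrite /fdefinable.
apply: (@definable_subst (fun e => e 0 = f (fun k => e k.+1))
  (fun k e => if k is k'.+1 then s k' (fun i => e i.+1) else e 0)) => // -[|k].
  exact: fdefinable_var.
exact: (fdefinable_ren S (ds k)).
Qed.

Let args (f g h : env -> M) (k : nat) : env -> M :=
  match k with 0 => f | 1 => g | _ => h end.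

Let args_dF f g h : fdefinable f -> fdefinable g -> fdefinable h -> forall k, fdefinable (args f g h k).
Proof. by move=> ? ? ? [|[|k]]. Qed.

Lemma definable_app1 (P : M -> Prop) f : definable1 P -> fdefinable f -> definable (fun e => P (f e)).
Proof. by move=> dp df; apply: (definable_subst (args_dF df df df) dp). Qed.

Lemma definable_app2 (P : M -> M -> Prop) f g : definable2 P -> fdefinable f -> fdefinable g -> definable (fun e => P (f e) (g e)).
Proof. by move=> dp df dg; apply: (definable_subst (args_dF df dg df) dp). Qed.

Lemma definable_app3 (P : M -> M -> M -> Prop) f g h : definable3 P -> fdefinable f -> fdefinable g -> fdefinable h ->
  definable (fun e => P (f e) (g e) (h e)).
Proof. by move=> dp df dg dh; apply: (definable_subst (args_dF df dg dh) dp). Qed.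

Lemma fdefinable_app1 F f : fdefinable1 F -> fdefinable f -> fdefinable (fun e => F (f e)).
Proof. by move=> dp df; apply: (fdefinable_subst (args_dF df df df) dp). Qed.

Lemma fdefinable_app2 F f g : fdefinable2 F -> fdefinable f -> fdefinable g -> fdefinable (fun e => F (f e) (g e)).
Proof. by move=> dp df dg; apply: (fdefinable_subst (args_dF df dg df) dp). Qed.

Lemma fdefinable_app3 F f g h : fdefinable3 F -> fdefinable f -> fdefinable g -> fdefinable h ->
  fdefinable (fun e => F (f e) (g e) (h e)).
Proof. by move=> dp df dg dh; apply: (fdefinable_subst (args_dF df dg dh) dp). Qed.

Lemma DefP (D : set M) : Def D <-> definable1 D.
Proof.
split=> [[phi [v ->]]|[phi [s h]]].
  apply: (@definable_sat void _ _ phi (fun k e => scons (e 0) v k)) => [[]|[|k]] /=.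
    exact: fdefinable_var.
  exact: fdefinable_const.
exists (fren (fun k => if s k is inl 0 then 0 else k.+1) phi).
exists (fun k => match s k with inl i => szero | inr a => a end).
apply/seteqP; split=> x /=; rewrite /fo_sat sat_ren.
  move=> xD; have := proj1 (h (scons x (fun=> szero))) xD.
  by apply: fo_sat_eq => k /=; case E: (s k) => [[]|] /=; rewrite ?E.
move=> hx; apply: (proj2 (h (scons x (fun=> szero)))); move: hx.
by apply: fo_sat_eq => k /=; case E: (s k) => [[]|] /=; rewrite ?E.
Qed.

End Definability.

(** [dfn] proves definability goals by following the syntax; [dfn_user] is
    extended as new definable notions appear. *)
Ltac dfn_user := fail.

Ltac dfn_step := cbv beta; first
  [ eassumption
  | match goal with
    | H : definable1 ?R |- definable (fun e => ?R (@?f e)) => refine (definable_app1 H _)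
    | H : definable2 ?R |- definable (fun e => ?R (@?f e) (@?g e)) => refine (definable_app2 H _ _)
    | H : definable3 ?R |- definable (fun e => ?R (@?f e) (@?g e) (@?h e)) => refine (definable_app3 H _ _ _)
    | H : fdefinable1 ?R |- fdefinable (fun e => ?R (@?f e)) => refine (fdefinable_app1 H _)
    | H : fdefinable2 ?R |- fdefinable (fun e => ?R (@?f e) (@?g e)) => refine (fdefinable_app2 H _ _)
    | H : fdefinable3 ?R |- fdefinable (fun e => ?R (@?f e) (@?g e) (@?h e)) => refine (fdefinable_app3 H _ _ _)
    end
  | dfn_user
  | match goal with
    | |- definable1 _ => rewrite /definable1
    | |- definable2 _ => rewrite /definable2
    | |- definable3 _ => rewrite /definable3
    | |- fdefinable1 _ => rewrite /fdefinable1
    | |- fdefinable2 _ => rewrite /fdefinable2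
    | |- fdefinable3 _ => rewrite /fdefinable3
    | |- definable (fun _ => ?a) => exact (@definable_const _ a)
    | |- fdefinable (fun _ => ?a) => exact (@fdefinable_const _ a)
    | |- fdefinable (fun e => e ?k) => exact (@fdefinable_var _ k)
    | |- fdefinable (fun e => sadd (@?f e) (@?g e)) => refine (@fdefinable_add _ f g _ _)
    | |- fdefinable (fun e => smul (@?f e) (@?g e)) => refine (@fdefinable_mul _ f g _ _)
    | |- fdefinable (fun e => pif (@?P e) (@?f e) (@?g e)) =>
        refine (@fdefinable_if _ P f g _ _ _)
    | |- definable (fun e => @?f e = @?g e) => refine (@definable_eq _ f g _ _)
    | |- definable (fun e => sle (@?f e) (@?g e)) => refine (@definable_le _ f g _ _)
    | |- definable (fun e => slt (@?f e) (@?g e)) => refine (@definable_lt _ f g _ _)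
    | |- definable (fun e => ~ @?A e) => refine (@definable_not _ A _)
    | |- definable (fun e => @?A e /\ @?B e) => refine (@definable_and _ A B _ _)
    | |- definable (fun e => @?A e \/ @?B e) => refine (@definable_or _ A B _ _)
    | |- definable (fun e => @?A e <-> @?B e) => refine (@definable_iffP _ A B _ _)
    | |- definable (fun e => @?A e -> @?B e) => refine (@definable_imp _ A B _ _)
    | |- definable (fun e => exists x, @?A e x) => refine (@definable_ex _ (fun x e => A e x) _)
    | |- definable (fun e => ex2 (fun x => @?A e x) (fun x => @?B e x)) =>
        refine (@definable_ex2 _ (fun x e => A e x) (fun x e => B e x) _ _)
    | |- definable (fun e => forall x, @?A e x) => refine (@definable_all _ (fun x e => A e x) _)
    end ].

Ltac dfn := repeat dfn_step.

(** * The ordered ring of differences of a model *)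

Section Differences.
Variables (M : structure) (MPA : PA M).
Let H : PA_minus M := proj1 MPA.

Add Ring model_ring : (Defs.pa_semiring MPA).

Local Open Scope arith_scope.
Implicit Types x y : M.

Let addIr x y (z : M) : x + z = y + z -> x = y.
Proof.
move=> e; apply: contrapT => n; case: (pa_le_total H x y) => h.
  by case: (pa_ltD H z (conj h n)) => _; apply.
by case: (pa_ltD H z (conj h (fun e' => n (esym e')))) => _; apply.
Qed.

Let mul_eq0 x y : x * y = 0 -> x = 0 \/ y = 0.
Proof.
move=> e; have [|y0] := pselect (y = 0); [by right|left].
apply: contrapT => x0.
have lt0 (z : M) : z <> 0 -> 0 < z by move=> n; split; [exact: (pa_le0x H)|exact/nesym].
case: (pa_ltM H (lt0 _ y0) (lt0 _ x0)) => _; apply.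
by rewrite e; ring.
Qed.

Let cls (p : M * M) : set (M * M) := [set q | p.1 + q.2 = q.1 + p.2].

(** A difference is represented by the set of all pairs of elements with that
    difference; the resulting discretely ordered ring has the model as its
    nonnegative part, so that subtraction and linear arithmetic apply to it. *)
Definition diff_ring : Type :=
  let _ := MPA in {C : set (M * M) | exists p, C = cls p}.

Let mk (p : M * M) : diff_ring := exist _ (cls p) (ex_intro _ p erefl).

Let cls_trans p q r : cls p q -> cls p r -> cls q r.
Proof.
rewrite /cls /= => e h; apply: (@addIr _ _ p.1).
have -> : q.1 + r.2 + p.1 = q.1 + (p.1 + r.2) by ring.
rewrite h; have -> : q.1 + (r.1 + p.2) = r.1 + (q.1 + p.2) by ring.
by rewrite -e; ring.
Qed.

Let mkE p q : mk p = mk q <-> p.1 + q.2 = q.1 + p.2.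
Proof.
split=> [[e]|e].
  have : cls q q by [].
  by rewrite -e.
have e' : cls q p by rewrite /cls /= e.
by apply: eq_exist; apply/seteqP; split=> r; exact: cls_trans.
Qed.

Let mk_surj (z : diff_ring) : exists p, z = mk p.
Proof. by case: z => C [p e]; exists p; apply: eq_exist. Qed.

Let rp (z : diff_ring) : M * M := projT1 (cid (mk_surj z)).

Let rpK z : mk (rp z) = z.
Proof. by rewrite /rp; case: cid. Qed.

Let rpE p : p.1 + (rp (mk p)).2 = (rp (mk p)).1 + p.2.
Proof. by apply/mkE; rewrite rpK. Qed.

Definition zadd (z w : diff_ring) : diff_ring := mk ((rp z).1 + (rp w).1, (rp z).2 + (rp w).2).
Definition zopp (z : diff_ring) : diff_ring := mk ((rp z).2, (rp z).1).
Definition zmul (z w : diff_ring) : diff_ring :=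
  mk ((rp z).1 * (rp w).1 + (rp z).2 * (rp w).2,
      (rp z).1 * (rp w).2 + (rp z).2 * (rp w).1).
Definition zle (z w : diff_ring) : bool := `[< (rp z).1 + (rp w).2 <= (rp w).1 + (rp z).2 >].
Definition to_diff (x : M) : diff_ring := mk (x, 0).

Let zaddE p q : zadd (mk p) (mk q) = mk (p.1 + q.1, p.2 + q.2).
Proof.
apply/mkE => /=; move: (rpE p) (rpE q).
move: (rp (mk p)) (rp (mk q)) => [a b] [c d] /=; case: p => p1 p2; case: q => q1 q2 /= e f.
have -> : a + c + (p2 + q2) = (a + p2) + (c + q2) by ring.
by rewrite -e -f; ring.
Qed.

Let zoppE p : zopp (mk p) = mk (p.2, p.1).
Proof.
apply/mkE => /=; move: (rpE p).
move: (rp _) => [a b] /=; case: p => p1 p2 /= e.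
have -> : b + p1 = p1 + b by ring.
by rewrite e; ring.
Qed.

Let zmulE p q : zmul (mk p) (mk q) =
  mk (p.1 * q.1 + p.2 * q.2, p.1 * q.2 + p.2 * q.1).
Proof.
have mulL (p' q' r : M * M) : p'.1 + q'.2 = q'.1 + p'.2 ->
    mk (p'.1 * r.1 + p'.2 * r.2, p'.1 * r.2 + p'.2 * r.1) =
    mk (q'.1 * r.1 + q'.2 * r.2, q'.1 * r.2 + q'.2 * r.1).
  case: p' q' r => [a b] [c d] [u v] /= e; apply/mkE => /=.
  have -> : a * u + b * v + (c * v + d * u) = (a + d) * u + (c + b) * v by ring.
  rewrite e; have -> : (c + b) * u + (c + b) * v = (c + b) * u + (a + d) * v.
    by rewrite e.
  by ring.
have sw (p' q' : M * M) : mk (p'.1 * q'.1 + p'.2 * q'.2, p'.1 * q'.2 + p'.2 * q'.1) =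
                mk (q'.1 * p'.1 + q'.2 * p'.2, q'.1 * p'.2 + q'.2 * p'.1).
  by apply/mkE => /=; ring.
rewrite /zmul (mulL _ _ _ (esym (rpE p))) sw (mulL _ _ _ (esym (rpE q))).
by rewrite sw.
Qed.

Let leDr x y (z : M) : x + z <= y + z <-> x <= y.
Proof.
split=> h; last first.
  have [->|n] := pselect (x = y); first exact: (pa_lexx H).
  by case: (pa_ltD H z (conj h n)).
apply: contrapT => n; case: (pa_le_total H x y) => // yx.
have nyx : y <> x by move=> e; apply: n; rewrite e; exact: (pa_lexx H).
case: (pa_ltD H z (conj yx nyx)) => h1; apply.
exact: (pa_le_anti H h1 h).
Qed.

Let zleE p q : zle (mk p) (mk q) <-> p.1 + q.2 <= q.1 + p.2.
Proof.
have key (p' q' r t : M * M) : p'.1 + r.2 = r.1 + p'.2 -> q'.1 + t.2 = t.1 + q'.2 ->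
    p'.1 + q'.2 <= q'.1 + p'.2 -> r.1 + t.2 <= t.1 + r.2.
  case: p' q' r t => [a a'] [b b'] [c c'] [d d'] /= e f h.
  rewrite -(leDr _ _ (a' + b)).
  have -> : c + d' + (a' + b) = (c + a') + (b + d') by ring.
  rewrite -e f.
  have -> : a + c' + (d + b') = (a + b') + (c' + d) by ring.
  have -> : d + c' + (a' + b) = (b + a') + (c' + d) by ring.
  exact/leDr.
rewrite /zle; split=> [/asboolP|h]; last apply/asboolP.
  by apply: key; rewrite -rpE.
exact: key (rpE p) (rpE q) h.
Qed.

Let mk_ind (P : diff_ring -> Prop) : (forall p, P (mk p)) -> forall z, P z.
Proof. by move=> h z; rewrite -(rpK z). Qed.

Let zaddA : associative zadd.
Proof.
elim/mk_ind => p; elim/mk_ind => q; elim/mk_ind => r; rewrite !zaddE /=.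
by apply/mkE => /=; ring.
Qed.

Let zaddC : commutative zadd.
Proof.
by elim/mk_ind => p; elim/mk_ind => q; rewrite !zaddE; apply/mkE => /=; ring.
Qed.

Let zadd0 : left_id (to_diff 0) zadd.
Proof. by elim/mk_ind => p; rewrite !zaddE; apply/mkE => /=; ring. Qed.

Let zaddN : left_inverse (to_diff 0) zopp zadd.
Proof. by elim/mk_ind => p; rewrite zoppE zaddE; apply/mkE => /=; ring. Qed.

HB.instance Definition _ := gen_eqMixin diff_ring.
HB.instance Definition _ := gen_choiceMixin diff_ring.
HB.instance Definition _ := GRing.isZmodule.Build diff_ring zaddA zaddC zadd0 zaddN.

Let zmulA : associative zmul.
Proof.
elim/mk_ind => p; elim/mk_ind => q; elim/mk_ind => r; rewrite !zmulE /=.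
by apply/mkE => /=; ring.
Qed.

Let zmulC : commutative zmul.
Proof.
by elim/mk_ind => p; elim/mk_ind => q; rewrite !zmulE; apply/mkE => /=; ring.
Qed.

Let zmul1 : left_id (to_diff 1) zmul.
Proof. by elim/mk_ind => p; rewrite !zmulE; apply/mkE => /=; ring. Qed.

Let zmulD : left_distributive zmul zadd.
Proof.
elim/mk_ind => p; elim/mk_ind => q; elim/mk_ind => r.
by rewrite zaddE !zmulE zaddE; apply/mkE => /=; ring.
Qed.

Let z10 : to_diff 1 != to_diff 0 :> diff_ring.
Proof.
apply/eqP => /mkE /=; rewrite !(pa_addx0 H) => e.
by case: (pa_lt01 H) => _; apply.
Qed.

HB.instance Definition _ :=
  GRing.Zmodule_isComNzRing.Build diff_ring zmulA zmulC zmul1 zmulD z10.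

Let zunit : {pred diff_ring} := fun z => `[< exists w : diff_ring, (w * z = 1)%R >].
Let zinv (z : diff_ring) : diff_ring :=
  if pselect (exists w : diff_ring, (w * z = 1)%R) is left h then projT1 (cid h) else z.

Let zmulV : {in zunit, left_inverse 1%R zinv *%R}.
Proof. by move=> z /asboolP h; rewrite /zinv; case: pselect => // h'; case: cid. Qed.

Let zunitP (x y : diff_ring) : (y * x = 1)%R -> zunit x.
Proof. by move=> e; apply/asboolP; exists y. Qed.

Let zinv_out : {in [predC zunit], zinv =1 id}.
Proof. by move=> z /asboolP n; rewrite /zinv; case: pselect. Qed.

HB.instance Definition _ :=
  GRing.ComNzRing_hasMulInverse.Build diff_ring zmulV zunitP zinv_out.

Let dest p : exists x, mk p = to_diff x \/ mk p = zopp (to_diff x).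
Proof.
case: p => a b; case: (pa_le_total H a b) => h; have [z e] := Defs.pa_le_sub MPA h.
  by exists z; right; rewrite zoppE; apply/mkE => /=; rewrite -e; ring.
by exists z; left; apply/mkE => /=; rewrite -e; ring.
Qed.

Lemma to_diff_eq x y : to_diff x = to_diff y <-> x = y.
Proof. by rewrite mkE /= !(pa_addx0 H). Qed.

Lemma to_diff_add x y : to_diff (x + y) = (to_diff x + to_diff y)%R.
Proof. by rewrite [RHS]zaddE; apply/mkE => /=; ring. Qed.

Lemma to_diff_mul x y : to_diff (x * y) = (to_diff x * to_diff y)%R.
Proof. by rewrite [RHS]zmulE; apply/mkE => /=; ring. Qed.

Let zmulf_eq0 : GRing.integral_domain_axiom diff_ring.
Proof.
have key x y : (to_diff x * to_diff y = 0)%R -> (to_diff x == 0)%R || (to_diff y == 0)%R.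
  rewrite -to_diff_mul => /to_diff_eq /mul_eq0 [] ->; rewrite eqxx //; exact: orbT.
elim/mk_ind => p; elim/mk_ind => q.
case: (dest p) => x [] ->; case: (dest q) => y [] ->.
- exact: key.
- rewrite -[zopp _]/(- to_diff y)%R GRing.mulrN => /eqP.
  by rewrite !GRing.oppr_eq0 => /eqP /key.
- rewrite -[zopp _]/(- to_diff x)%R GRing.mulNr => /eqP.
  by rewrite !GRing.oppr_eq0 => /eqP /key.
- rewrite -[zopp (to_diff x)]/(- to_diff x)%R -[zopp (to_diff y)]/(- to_diff y)%R.
  by rewrite GRing.mulrNN !GRing.oppr_eq0 => /key.
Qed.

HB.instance Definition _ := GRing.ComUnitRing_isIntegral.Build diff_ring zmulf_eq0.

Lemma to_diff_le x y : (zle (to_diff x) (to_diff y)) <-> x <= y.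
Proof. by rewrite zleE /= !(pa_addx0 H). Qed.

Let zle0 (z : diff_ring) : zle 0%R z -> exists x, z = to_diff x.
Proof.
elim/mk_ind: z => p; have [x [->|->]] := dest p; first by exists x.
rewrite zoppE => /zleE /=; rewrite (pa_addC H) !(pa_addx0 H) => x0; exists x.
by apply/mkE => /=; rewrite (pa_le_anti H x0 (pa_le0x H x)).
Qed.

Let zle_add (z w : diff_ring) : zle 0%R z -> zle 0%R w -> zle 0%R (z + w)%R.
Proof.
by move=> /zle0[x ->] /zle0[y ->]; rewrite -to_diff_add; apply/to_diff_le; exact: (pa_le0x H).
Qed.

Let zle_mul (z w : diff_ring) : zle 0%R z -> zle 0%R w -> zle 0%R (z * w)%R.
Proof.
by move=> /zle0[x ->] /zle0[y ->]; rewrite -to_diff_mul; apply/to_diff_le; exact: (pa_le0x H).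
Qed.

Let zle_anti (z : diff_ring) : zle 0%R z -> zle z 0%R -> z = 0%R.
Proof.
move=> /zle0[x ->] /to_diff_le h; congr to_diff; exact: (pa_le_anti H h (pa_le0x H x)).
Qed.

Let zle_sub (z w : diff_ring) : zle 0%R (w - z)%R = zle z w.
Proof.
elim/mk_ind: z => p; elim/mk_ind: w => q.
rewrite -[(_ - _)%R]/(zadd _ (zopp _)) zoppE zaddE.
have e1 : 0 + (q.2 + p.1) = p.1 + q.2 by ring.
have e2 : q.1 + p.2 + 0 = q.1 + p.2 by ring.
by apply/idP/idP => /zleE /= h; apply/zleE; move: h => /=; rewrite e1 e2.
Qed.

Let zle_total (z : diff_ring) : zle 0%R z || zle z 0%R.
Proof.
elim/mk_ind: z => p; have [x [->|->]] := dest p; apply/orP; [left|right].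
  by apply/to_diff_le; exact: (pa_le0x H).
rewrite zoppE; apply/zleE => /=; rewrite !(pa_addx0 H) (pa_addC H) (pa_addx0 H).
exact: (pa_le0x H).
Qed.

Let znorm (z : diff_ring) : diff_ring := if zle 0%R z then z else (- z)%R.

Let znormN (z : diff_ring) : znorm (- z)%R = znorm z.
Proof.
have e : zle 0%R (- z)%R = zle z 0%R by rewrite -(zle_sub z) GRing.sub0r.
rewrite /znorm e; case: ifPn => h; case: ifPn => h' //; last first.
- by move: (zle_total z); rewrite (negbTE h) (negbTE h').
- by rewrite GRing.opprK.
- by rewrite (zle_anti h' h) GRing.oppr0.
Qed.

Let znorm0 (z : diff_ring) : zle 0%R z -> znorm z = z.
Proof. by rewrite /znorm => ->. Qed.

Let zlt (z w : diff_ring) : bool := (w != z) && zle z w.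
Let zlt_def (z w : diff_ring) : zlt z w = (w != z) && zle z w.
Proof. by []. Qed.

HB.instance Definition _ := Num.IntegralDomain_isLeReal.Build diff_ring
  zle_add zle_mul zle_anti zle_sub zle_total znormN znorm0 zlt_def.

Lemma to_diff_leR x y : (to_diff x <= to_diff y)%R <-> x <= y.
Proof. exact: to_diff_le. Qed.

Lemma to_diff_ltR x y : (to_diff x < to_diff y)%R <-> x < y.
Proof.
rewrite Order.POrderTheory.lt_neqAle; split=> [/andP[/eqP n /to_diff_leR h]|[h n]].
  by split=> // e; apply: n; rewrite e.
by apply/andP; split; [apply/eqP => /to_diff_eq|apply/to_diff_leR].
Qed.

Lemma to_diff_surj (z : diff_ring) : (0 <= z)%R -> exists x, z = to_diff x.
Proof. exact: zle0. Qed.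

Lemma to_diff0 : to_diff 0 = 0%R. Proof. by []. Qed.
Lemma to_diff1 : to_diff 1 = 1%R. Proof. by []. Qed.

Lemma to_diff_ge0 x : (0 <= to_diff x)%R.
Proof. by apply/to_diff_leR; exact: (pa_le0x H). Qed.

End Differences.

Arguments to_diff {M} MPA x%A.

From mathcomp Require Import ring lra.
Import Order.TTheory GRing.Theory Num.Theory.

Section Discrete.
Variables (M : structure) (MPA : PA M).
Let H : PA_minus M := proj1 MPA.
Local Open Scope arith_scope.
Implicit Types x y z : M.

Lemma to_diff_lt1 x y : x < y <-> (to_diff MPA x + 1 <= to_diff MPA y)%R.
Proof.
rewrite -to_diff1 -to_diff_add; split=> [xy|/to_diff_leR xy].
  by apply/to_diff_leR; exact: (Defs.pa_ltS MPA).
exact: (Defs.pa_lt_le_trans MPA (Defs.pa_S_lt MPA x)).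
Qed.

Lemma pa_leNgt x y : ~ x <= y <-> y < x.
Proof.
split=> [n|/to_diff_lt1 yx /(@to_diff_leR _ MPA) xy]; last by lra.
case: (pa_le_total H x y) => // yx; split=> // e.
by apply: n; rewrite e; exact: (pa_lexx H).
Qed.

Lemma pa_ltNge x y : ~ x < y <-> y <= x.
Proof. by rewrite -pa_leNgt notK. Qed.

End Discrete.

(** [pa MPA] settles goals of ordered arithmetic in the model by passing to
    the ring of differences, where strict inequalities become [x + 1 <= y]. *)
Ltac to_ring MPA :=
  match goal with
  | |- ~ _ => move=> ?
  | |- sle _ _ => apply: contrapT => ?
  | |- slt _ _ => apply/(pa_leNgt MPA) => ?
  | |- _ => idtac
  end;
  repeat match goal with
  | h : ~ (@eq (carrier _) _ _) |- _ => clear h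
  | h : _ -> @eq (carrier _) _ _ |- _ => clear h
  end;
  repeat match goal with
  | h : ~ sle _ _ |- _ => move/(pa_leNgt MPA): h => h
  | h : ~ slt _ _ |- _ => move/(pa_ltNge MPA): h => h
  | h : sle _ _ |- _ => move/(to_diff_leR MPA): h => h
  | h : slt _ _ |- _ => move/(to_diff_lt1 MPA): h => h
  | h : @eq (carrier _) _ _ |- _ => move/(to_diff_eq MPA): h => h
  end;
  match goal with
  | |- @eq (carrier _) _ _ => apply/(to_diff_eq MPA)
  | |- _ => idtac
  end;
  repeat match goal with
  | x : carrier _ |- _ =>
      lazymatch goal with
      | h : is_true (0 <= to_diff MPA x)%R |- _ => fail
      | |- _ => have := to_diff_ge0 MPA x; move=> ?
      end
  end;
  rewrite ?(to_diff_add MPA, to_diff_mul MPA, to_diff0 MPA, to_diff1 MPA);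
  repeat match goal with
  | h : context [to_diff MPA (sadd _ _)] |- _ => rewrite to_diff_add in h
  | h : context [to_diff MPA (smul _ _)] |- _ => rewrite to_diff_mul in h
  | h : context [to_diff MPA szero] |- _ => rewrite to_diff0 in h
  | h : context [to_diff MPA sone] |- _ => rewrite to_diff1 in h
  end;
  repeat match goal with
  | h : ?P |- _ =>
      lazymatch P with
      | is_true _ => fail
      | context [@eq (carrier _) _ _] => clear h
      | @eq (set _) _ _ => clear h
      end
  end.

Ltac nn MPA t := have ? := to_diff_ge0 MPA t.
Ltac pa MPA := to_ring MPA; lra.
Ltac npa MPA := to_ring MPA; nra.


(** * Induction, least elements, division and pairing *)

Section Graph.
Variable M : structure.
Notation env := (nat -> M).

(** A function known only through [the_elt] is definable through its graph. *)
Lemma fdefinable_graph (f : env -> M) (G : M -> env -> Prop) :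
  definable (fun e => G (e 0) (fun k => e k.+1)) -> (forall e, G (f e) e) ->
  (forall e y, G y e -> y = f e) -> fdefinable f.
Proof. by move=> dG Gf uG; apply: definable_iff dG => e; split=> [->|/uG]. Qed.

(** Definite description; the value is 0 when nothing is described. *)
Definition the_elt (P : M -> Prop) : M :=
  if pselect (exists x, P x) is left h then projT1 (cid h) else szero.

Lemma the_eltP (P : M -> Prop) : (exists x, P x) -> P (the_elt P).
Proof. by move=> h; rewrite /the_elt; case: pselect => // h'; case: cid. Qed.

End Graph.

Section Induction.
Variables (M : structure) (MPA : PA M).
Local Open Scope arith_scope.
Notation H := (proj1 MPA).
Implicit Types x y z : M.

Lemma pa_ind (P : M -> Prop) : definable1 P -> P 0 -> (forall x, P x -> P (x + 1)) ->
  forall x, P x.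
Proof.
move=> /DefP[phi [v e]] P0 PS.
have E x : P x <-> fo_sat (scons x v) phi by rewrite e.
move=> x; apply/E; move: x; apply: (proj2 MPA phi v); first exact/E.
by move=> x /E /PS /E.
Qed.

Lemma pa_least (P : M -> Prop) : definable1 P -> (exists x, P x) ->
  exists x, P x /\ forall y, P y -> x <= y.
Proof.
move=> dp [a Pa]; apply: contrapT => n.
have key : forall x, forall y, y <= x -> ~ P y.
  apply: pa_ind; first by dfn.
    move=> y y0 Py; apply: n; exists y; split=> // z _; by pa MPA.
  move=> x IH y yx Py; apply: n; exists y; split=> // z Pz.
  apply: contrapT => yz; apply: (IH z) => //; by pa MPA.
exact: (key a a (pa_lexx H a)).
Qed.

Lemma pa_bounded (F : M -> M) n : fdefinable1 F -> exists b, forall i, i <= n -> F i <= b.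
Proof.
move=> defF; move: n; apply: pa_ind; first by dfn.
  by exists (F 0) => i i0; have -> : i = 0; [pa MPA|exact: (pa_lexx H)].
move=> n [b hb]; exists (b + F (n + 1)) => i ni.
have [/hb h|h] := pselect (i <= n).
  by nn MPA (F (n + 1)); pa MPA.
have -> : i = n + 1 by pa MPA.
by pa MPA.
Qed.

Lemma pa_div x (m : M) : 0 < m -> exists q r, r < m /\ x = q * m + r.
Proof.
move=> m0; move: x; apply: pa_ind; first by dfn.
  by exists 0, 0; split=> //; pa MPA.
move=> x [q [r [rm ->]]]; have [h|h] := pselect (r + 1 < m).
  by exists q, (r + 1); split=> //; pa MPA.
have e : r + 1 = m by pa MPA.
by exists (q + 1), 0; rewrite -e; split; pa MPA.
Qed.

Lemma pa_leM (x y z w : M) : x <= y -> z <= w -> x * z <= y * w.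
Proof. by move=> h h'; npa MPA. Qed.

Lemma pa_ltS (x y : M) : x < y <-> x + 1 <= y.
Proof. by split=> h; pa MPA. Qed.

Lemma z_ge1 (z : diff_ring MPA) : (0 < z)%R -> (1 <= z)%R.
Proof.
move=> z0; have [x e] := to_diff_surj (ltW z0); rewrite e in z0 *.
have : 0 < x by apply/(to_diff_ltR MPA); rewrite to_diff0.
by move=> /(to_diff_lt1 MPA); rewrite to_diff0 add0r.
Qed.

Lemma div_uniq (q q' r r' m : M) : r < m -> r' < m -> q * m + r = q' * m + r' ->
  q = q' /\ r = r'.
Proof.
move=> rm r'm e; suff eq : q = q' by split=> //; rewrite eq in e; pa MPA.
apply: contrapT => n; have [h|h] := pselect (q < q').
  by npa MPA.
have {}h : q' < q by apply/(pa_leNgt MPA) => h'; apply: h; split.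
by npa MPA.
Qed.

(** The pairing is the polynomial (x+y)^2 + x, so that it is available as a
    term of the language in every closed substructure. *)
Definition cpair (x y : M) : M := (x + y) * (x + y) + x.

Lemma cpair_inj (x y x' y' : M) : cpair x y = cpair x' y' -> x = x' /\ y = y'.
Proof.
rewrite /cpair => e; have es : x + y = x' + y'.
  apply: contrapT => n; have [h|h] := pselect (x + y < x' + y').
    by npa MPA.
  have {}h : x' + y' < x + y.
    by apply/(pa_leNgt MPA) => h'; apply: h; split.
  by npa MPA.
by rewrite es in e; split; pa MPA.
Qed.

Lemma cpair_ge1 x y : x <= cpair x y.
Proof. by rewrite /cpair; npa MPA. Qed.

Lemma cpair_ge2 x y : y <= cpair x y.
Proof.
rewrite /cpair; have [->|y0] := pselect (y = 0); first by npa MPA.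
have h : 0 < y by apply/(pa_leNgt MPA) => h; apply: y0; pa MPA.
by npa MPA.
Qed.

Lemma cpair_mono (x y x' y' : M) : x <= x' -> y <= y' -> cpair x y <= cpair x' y'.
Proof. by rewrite /cpair => h h'; npa MPA. Qed.

End Induction.

Lemma fdefinable_pr (M : structure) (f g : (nat -> M) -> M) :
  fdefinable f -> fdefinable g -> fdefinable (fun e => cpair (f e) (g e)).
Proof. by move=> df dg; rewrite /cpair; dfn. Qed.

(** * Coding of sequences and definable recursion *)

Section Coding.
Variables (M : structure) (MPA : PA M).
Local Open Scope arith_scope.
Notation H := (proj1 MPA).
Implicit Types c d g i n u x y z : M.

Let divides x y : Prop := exists q : M, y = x * q.

(** The common multiple is built by recursion so that any bound [B] that
    survives the recursion step holds for it. *)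
Lemma common_multiple (B : M -> M -> Prop) : definable2 B -> B 0 1 ->
  (forall k z, B k z -> B (k + 1) (z * (k + 1))) ->
  forall n, exists z, [/\ B n z, 0 < z & forall t, 0 < t -> t <= n -> divides t z].
Proof.
move=> dB B0 BS; apply: (pa_ind MPA) => //.
- suff: definable1 (fun n => exists z, B n z /\ (0 < z /\
            forall t, 0 < t -> t <= n -> divides t z)).
    apply: definable_iff => e; split=> [[z []]|[z [? []]]]; exists z; split=> //.
  by rewrite /divides; dfn.
- by exists 1; split=> // [|t t0 t1]; pa MPA.
move=> k [z [Bz z0 zd]]; exists (z * (k + 1)); split; [exact: BS|npa MPA|].
move=> t t0 tk; have [h|h] := pselect (t <= k).
  by have [q ->] := zd t t0 h; exists (q * (k + 1)); pa MPA.
have -> : t = k + 1 by pa MPA.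
by exists z; pa MPA.
Qed.

(* Units modulo m, with witnesses in the model so that the notion is definable. *)
Let unit m a : Prop := exists u v : M, u * a = 1 + v * m.

Let unitM m a b : unit m a -> unit m b -> unit m (a * b).
Proof.
move=> [u [v e]] [u' [v' e']]; exists (u * u'), (v + v' + v * v' * m).
by to_ring MPA; ring: e e'.
Qed.

Definition modulus (d i : M) : M := 1 + (i + 1) * d.

(* For j = k + t, the number t is congruent to (j+1) (1 + (k+1) d) modulo
   1 + (j+1) d, and t is a unit there because it divides d. *)
Let unit_modulus d j k n : 0 < d ->
  (forall t, 0 < t -> t <= n -> divides t d) -> k < j -> j <= n ->
  unit (modulus d j) (modulus d k).
Proof.
move=> d0 dd kj jn; have [t [e t0]] : exists t, j = k + t /\ 0 < t.
  have [z [ez z0]] : exists z, (to_diff MPA j - to_diff MPA k = to_diff MPA z)%R /\ 0 < z.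
    have [|z ez] := @to_diff_surj _ MPA (to_diff MPA j - to_diff MPA k)%R; first by pa MPA.
    by exists z; split=> //; to_ring MPA; lra.
  by exists z; split=> //; to_ring MPA; lra.
have [q dq] : divides t d by apply: dd => //; pa MPA.
have [v ev] : exists v, (to_diff MPA v = to_diff MPA ((j + 1) * d * (q * (j + 1) * (k + 1)))%A
    + (to_diff MPA ((j + 1) * d)%A - 1))%R.
  have [|v ev] := @to_diff_surj _ MPA (to_diff MPA ((j + 1) * d * (q * (j + 1) * (k + 1)))%A
    + (to_diff MPA ((j + 1) * d)%A - 1))%R; last by exists v.
  nn MPA ((j + 1) * d * (q * (j + 1) * (k + 1))).
  have : 0 < (j + 1) * d by npa MPA.
  by move=> /(to_diff_lt1 MPA); rewrite to_diff0; lra.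
exists (q * (j + 1) * (j + 1) * ((j + 1) * d)), v.
rewrite /modulus; to_ring MPA.
by rewrite ev e dq; ring.
Qed.

(** Chinese remaindering, one modulus at a time; the product of the moduli
    obeys any bound [B] that survives multiplication by the next modulus. *)
Lemma chinese_code (B : M -> M -> Prop) (F : M -> M) (d n : M) :
  definable2 B -> fdefinable1 F -> B 0 1 ->
  (forall k z, k < n -> B k z -> B (k + 1) (z * modulus d k)) ->
  0 < d -> (forall t, 0 < t -> t <= n -> divides t d) ->
  (forall i, i < n -> F i < modulus d i) ->
  exists c z, [/\ B n z, c < z & forall i, i < n -> beta c d i (F i)].
Proof.
move=> dB defF B0 BS d0 dd Fm.
pose Q k := exists c z, B k z /\ (c < z /\ ((forall i, i < k -> beta c d i (F i))
  /\ ((forall i, i < k -> divides (modulus d i) z) /\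
      (forall j, k <= j -> j < n -> unit (modulus d j) z)))).
suff key : forall k, k <= n -> Q k.
  by have [c [z [? [? [? _]]]]] := key n (pa_lexx H n); exists c, z.
apply: (pa_ind MPA).
- by rewrite /Q /beta /divides /unit /modulus; dfn.
- move=> _; exists 0, 1; split=> //; split; first by pa MPA.
  split; [|split] => i; [by move=> h; exfalso; pa MPA..|move=> _ _].
  by exists 1, 0; pa MPA.
move=> k IH kn.
have [c [z [Bz [cz [cF [zm zu]]]]]] : Q k by apply: IH; pa MPA.
have [w [v ew]] : unit (modulus d k) z by apply: zu; pa MPA.
have [m em] : exists m, m = modulus d k by exists (modulus d k).
rewrite -em in ew.
have Fk : F k < m by rewrite em; apply: Fm; pa MPA.
have m0 : 0 < m by rewrite em /modulus; npa MPA.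
(* w inverts z, and F k - c is represented by F k + c (m - 1), which is not
   negative. *)
have [q [t [tm et]]] := pa_div MPA (w * (F k + c * ((k + 1) * d))) m0.
exists (c + z * t), (z * m); split; first by rewrite em; apply: BS => //; pa MPA.
split.
  have := pa_leM MPA (pa_lexx H z) (proj1 (pa_ltS MPA _ _) tm).
  by move=> h; clear ew et zm zu IH; pa MPA.
split; [move=> i ik|split].
- have [h|h] := pselect (i < k).
    have [fm [p ep]] := cF i h; have [r er] := zm i h.
    split=> //; exists (p + r * t); move: ep er; rewrite -/(modulus d i) => -> ->.
    by pa MPA.
  have -> : i = k by pa MPA.
  split; rewrite -/(modulus d k) -em //.
  have eqn : (to_diff MPA c + to_diff MPA z * to_diff MPA t = (to_diff MPA c +
      to_diff MPA (v * (F k + c * ((k + 1) * d)))%A - to_diff MPA (z * q)%A) * to_diff MPA m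
      + to_diff MPA (F k))%R.
    rewrite /modulus in em; clear - em ew et; to_ring MPA.
    have et' : (to_diff MPA t = to_diff MPA w * (to_diff MPA (F k) + to_diff MPA c *
        ((to_diff MPA k + 1) * to_diff MPA d)) - to_diff MPA q * to_diff MPA m)%R by lra.
    have -> : (to_diff MPA z * to_diff MPA t = to_diff MPA w * to_diff MPA z * (to_diff MPA (F k) +
        to_diff MPA c * ((to_diff MPA k + 1) * to_diff MPA d)) - to_diff MPA z * to_diff MPA q * to_diff MPA m)%R.
      by rewrite et'; ring.
    by rewrite ew em; ring.
  have [|Q0 eQ] := @to_diff_surj _ MPA
      (to_diff MPA c + to_diff MPA (v * (F k + c * ((k + 1) * d)))%A - to_diff MPA (z * q)%A)%R.
    apply: contrapT => n0.
    have {}n0 : (to_diff MPA c + to_diff MPA (v * (F k + c * ((k + 1) * d)))%A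
        - to_diff MPA (z * q)%A + 1 <= 0)%R.
      have := @z_ge1 _ MPA (to_diff MPA (z * q)%A - to_diff MPA c
        - to_diff MPA (v * (F k + c * ((k + 1) * d)))%A)%R.
      by move/negP: n0; rewrite -ltNge => n0 /(_ ltac:(lra)); lra.
    have e1 : (to_diff MPA c + to_diff MPA z * to_diff MPA t = (to_diff MPA c +
      to_diff MPA (v * (F k + c * ((k + 1) * d)))%A - to_diff MPA (z * q)%A) * to_diff MPA m
      + to_diff MPA (F k)%A)%R.
      exact: eqn.
    have : (0 <= to_diff MPA c + to_diff MPA z * to_diff MPA t)%R.
      by nn MPA (c + z * t); to_ring MPA; lra.
    nn MPA m; rewrite eqn; move/(to_diff_lt1 MPA): Fk; nra.
  exists Q0; apply/(to_diff_eq MPA); rewrite !(to_diff_add, to_diff_mul) -eQ.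
  by rewrite eqn.
- move=> i ik; have [h|h] := pselect (i < k).
    by have [r ->] := zm i h; exists (r * m); pa MPA.
  have -> : i = k by pa MPA.
  by exists z; rewrite -em; pa MPA.
move=> j kj jn; apply: unitM; first by apply: zu => //; pa MPA.
by rewrite em; apply: (@unit_modulus d j k n) => //; pa MPA.
Qed.


Lemma beta_uniq c d i u u' : beta c d i u -> beta c d i u' -> u = u'.
Proof. exact: (Defs.beta_fun MPA). Qed.

Lemma beta_total c d i : exists u : M, beta c d i u.
Proof.
have m0 : 0 < 1 + (i + 1) * d by npa MPA.
by have [q [r [rm e]]] := pa_div MPA c m0; exists r; split=> //; exists q.
Qed.

(** Goedel's argument: a multiple of 1, ..., n+1 that also exceeds all the values
    gives moduli that are pairwise coprime and large enough. *)
Lemma beta_code (F : M -> M) n : fdefinable1 F ->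
  exists c d, forall i, i <= n -> beta c d i (F i).
Proof.
move=> defF; have [b hb] := pa_bounded MPA n defF.
have [z [_ z0 zd]] := @common_multiple (fun _ _ => True) ltac:(dfn) I
  (fun _ _ _ => I) (n + 1).
have h := pa_leM MPA (proj1 (pa_ltS MPA _ _) z0) (pa_lexx H (b + 1)).
have [|||c [_ [_ _ cF]]] := @chinese_code (fun _ _ => True) F (z * (b + 1)) (n + 1)
  ltac:(dfn) defF I (fun _ _ _ _ => I).
- by pa MPA.
- by move=> t t0 tn; have [q ->] := zd t t0 tn; exists (q * (b + 1)); pa MPA.
- move=> i ni; have hi : F i <= b by apply: hb; pa MPA.
  nn MPA (F i); rewrite /modulus.
  have h1 := pa_leM MPA (_ : 1 <= i + 1) (pa_lexx H (z * (b + 1))).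
  by have {}h1 := h1 ltac:(pa MPA); pa MPA.
by exists c, (z * (b + 1)) => i ni; apply: cF; pa MPA.
Qed.

(** The graph of the function defined by primitive recursion from [g] and [h],
    in the form in which [pow2] is the case of iterated doubling. *)
Definition rec_graph (g : M) (h : M -> M -> M) (x y : M) : Prop :=
  exists c d, beta c d 0 g /\
    ((forall i, i < x -> exists u, beta c d i u /\ beta c d (i + 1) (h i u)) /\
     beta c d x y).

Definition prim_rec g h x : M := the_elt (rec_graph g h x).

Lemma rec_graph_uniq g h x y y' : rec_graph g h x y -> rec_graph g h x y' -> y = y'.
Proof.
move=> [c [d [b0 [bS bx]]]] [c' [d' [b0' [bS' bx']]]].
have key : forall i, i <= x -> exists u, beta c d i u /\ beta c' d' i u.
  apply: (pa_ind MPA); first by rewrite /beta; dfn.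
    by move=> _; exists g.
  move=> i IH ix; have [u [bu bu']] : exists u, beta c d i u /\ beta c' d' i u.
    by apply: IH; pa MPA.
  have [|v [bv bv1]] := bS i; first by pa MPA.
  have [|w [bw bw1]] := bS' i; first by pa MPA.
  exists (h i u); split; first by rewrite (beta_uniq bu bv).
  by rewrite (beta_uniq bu' bw).
have [u [bu bu']] := key x (pa_lexx H x).
by rewrite (beta_uniq bx bu) (beta_uniq bx' bu').
Qed.

(** The code for the values up to [x] need not extend to one for [x + 1]; the
    sequence prolonged by one entry is definable and is coded afresh. *)
Lemma rec_graph_total g h x : fdefinable2 h -> exists y, rec_graph g h x y.
Proof.
move=> dh; move: x; apply: (pa_ind MPA).
- by rewrite /rec_graph /beta; dfn.
- have [c [d hb]] := @beta_code (fun=> g) 0 ltac:(dfn).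
  exists g, c, d; split; first by apply: hb; pa MPA.
  split; last by apply: hb; pa MPA.
  by move=> i i0; exfalso; pa MPA.
move=> x [y [c [d [b0 [bS bx]]]]].
pose F i := pif (i <= x) (the_elt (beta c d i)) (h x y).
have Fx i : i <= x -> beta c d i (F i).
  move=> ix; rewrite /F /pif; case: asboolP => // _.
  by apply: the_eltP; exact: beta_total.
have FS : F (x + 1) = h x y.
  by rewrite /F /pif; case: asboolP => // xx; exfalso; pa MPA.
have defF : fdefinable1 F.
  apply: fdefinable_if; [by dfn| |by dfn].
  apply: (@fdefinable_graph _ _ (fun y e => beta c d (e 0%N) y)) => [|e|e y'].
  - by rewrite /beta; dfn.
  - by apply: the_eltP; exact: beta_total.
  by move/beta_uniq; apply; apply: the_eltP; exact: beta_total.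
have [c' [d' hb]] := beta_code (x + 1) defF.
exists (h x y), c', d'; split.
  have x0 : 0 <= x by exact: (pa_le0x H).
  by rewrite (beta_uniq b0 (Fx _ x0)); apply: hb; pa MPA.
split; last by rewrite -FS; apply: hb; exact: (pa_lexx H).
move=> i ix; have ix' : i <= x by pa MPA.
exists (F i); split; first by apply: hb; pa MPA.
have [->|n] := pselect (i = x).
  by rewrite -(beta_uniq bx (Fx _ (pa_lexx H x))) -FS; apply: hb; exact: (pa_lexx H).
have lix : i < x by split.
have [u [bu bu1]] := bS i lix.
rewrite -(beta_uniq bu (Fx _ ix')) (beta_uniq bu1 (Fx (i + 1) _)); last by pa MPA.
by apply: hb; pa MPA.
Qed.

Lemma prim_recP g h x : fdefinable2 h -> rec_graph g h x (prim_rec g h x).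
Proof. by move=> dh; apply: the_eltP; exact: rec_graph_total. Qed.

Lemma prim_rec_eq g h x y : rec_graph g h x y -> y = prim_rec g h x.
Proof. by move=> hy; apply: (rec_graph_uniq hy); apply: the_eltP; exists y. Qed.

Lemma prim_rec0 g h : fdefinable2 h -> prim_rec g h 0 = g.
Proof.
move=> dh; have [c [d [b0 [_ b0']]]] := prim_recP g 0 dh.
exact: (beta_uniq b0' b0).
Qed.

Lemma prim_recS g h x : fdefinable2 h -> prim_rec g h (x + 1) = h x (prim_rec g h x).
Proof.
move=> dh; have [c [d [b0 [bS bx]]]] := prim_recP g (x + 1) dh.
have [|u [bu bu1]] := bS x; first by pa MPA.
rewrite (beta_uniq bx bu1); congr h; apply: prim_rec_eq; exists c, d; split=> //.
by split=> // i ix; apply: bS; pa MPA.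
Qed.

Lemma fdefinable_recf (g : (nat -> M) -> M) (h : (nat -> M) -> M -> M -> M) (x : (nat -> M) -> M) :
  fdefinable g -> fdefinable (fun e => h (fun k => e k.+2) (e 0%N) (e 1%N)) -> fdefinable x ->
  fdefinable (fun e => prim_rec (g e) (h e) (x e)).
Proof.
move=> dg dh dx.
have dhe e : fdefinable2 (h e).
  apply: (@fdefinable_subst _ (fun e => h (fun k => e k.+2) (e 0%N) (e 1%N))
    (fun k e' => if k is k'.+2 then e k' else e' k)) => // -[|[|k]]; by dfn.
apply: (@fdefinable_graph _ _ (fun y e => rec_graph (g e) (h e) (x e) y)) => [|e|e y].
- have dh' : fdefinable (fun e => h (fun k => e k.+4.+1) (e 1%N) (e 0%N)).
    by apply: (fdefinable_subst (s := fun k e => match k with 0 => e 1%N | 1 => e 0%N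
               | k'.+2 => e k'.+4.+1 end) _ dh) => -[|[|k]]; dfn.
  have dg' r := fdefinable_ren r dg; have dx' r := fdefinable_ren r dx.
  rewrite /rec_graph /beta; dfn; try exact: (dg' (fun k => k.+3));
    try exact: (dg' (fun k => k.+4)); try exact: (dx' (fun k => k.+3));
    try exact: (dx' (fun k => k.+4)); exact: (fdefinable_ren S dh').
- exact: (prim_recP _ _ (dhe e)).
exact: prim_rec_eq.
Qed.

End Coding.

(** * Exponentiation and binary sequences *)

Definition exp2 (M : structure) (x : M) : M := prim_rec sone (fun _ u => sadd u u) x.

Section Exponential.
Variables (M : structure) (MPA : PA M).
Local Open Scope arith_scope.
Notation H := (proj1 MPA).
Implicit Types a b c d k n x y z : M.

Let ddouble : fdefinable2 (fun _ u : M => u + u). Proof. by dfn. Qed.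

Lemma fdefinable_ex (f : (nat -> M) -> M) : fdefinable f -> fdefinable (fun e => exp2 (f e)).
Proof. by move=> df; apply: fdefinable_recf => //; dfn. Qed.

Lemma exp2_0 : exp2 (0 : M) = 1. Proof. exact: (prim_rec0 MPA). Qed.

Lemma exp2S x : exp2 (x + 1) = exp2 x + exp2 x. Proof. exact: (prim_recS MPA). Qed.

Lemma pow2E a b : pow2 a b <-> b = exp2 a.
Proof.
split=> [[c [d [b0 bS ba]]]|->].
  by apply: (prim_rec_eq MPA); exists c, d.
by have [c [d [b0 [bS ba]]]] := prim_recP MPA 1 a ddouble; exists c, d.
Qed.

Lemma exp2_gt x : x < exp2 x.
Proof.
move: x; apply: (pa_ind MPA); first by dfn; exact: fdefinable_ex (fdefinable_var _ _).
  by rewrite exp2_0; pa MPA.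
by move=> x h; rewrite exp2S; nn MPA (exp2 x); pa MPA.
Qed.

Lemma exp2_gt0 x : 0 < exp2 x.
Proof. by have h := exp2_gt x; nn MPA (exp2 x); pa MPA. Qed.

Lemma exp2D x y : exp2 (x + y) = exp2 x * exp2 y.
Proof.
move: y; apply: (pa_ind MPA).
- by dfn; apply: fdefinable_ex; dfn.
- by rewrite exp2_0; have -> : x + 0 = x; pa MPA.
move=> y IH; have -> : x + (y + 1) = (x + y) + 1 by pa MPA.
by rewrite !exp2S IH; pa MPA.
Qed.

Lemma exp2_mono x y : x <= y -> exp2 x <= exp2 y.
Proof.
move=> /(Defs.pa_le_sub MPA)[z <-]; rewrite exp2D.
have := pa_leM MPA (pa_lexx H (exp2 x)) (proj1 (pa_ltS MPA _ _) (exp2_gt0 z)).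
by move=> h; pa MPA.
Qed.

Lemma exp2_lt x y : x < y -> exp2 x < exp2 y.
Proof.
move=> /(pa_ltS MPA)/exp2_mono; rewrite exp2S => h; have := exp2_gt0 x => h'.
by pa MPA.
Qed.

End Exponential.

Ltac dfn_user ::= first
  [ match goal with
    | |- fdefinable (fun e => cpair (@?f e) (@?g e)) => refine (@fdefinable_pr _ f g _ _)
    | |- fdefinable (fun e => exp2 (@?f e)) =>
        match goal with A : PA _ |- _ => refine (@fdefinable_ex _ A f _) end
    end ].

Section SmallCodes.
Variables (M : structure) (MPA : PA M).
Local Open Scope arith_scope.
Notation H := (proj1 MPA).
Implicit Types a b c d k n x y z : M.

(* Squaring moves from E k to E (k + 1), so that each new factor below E k costs
   one step. *)
Let E k : M := exp2 (exp2 k).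

Let EM k n a b : a <= E k -> b <= E n -> k <= n -> a * b <= E (n + 1).
Proof.
move=> ha hb kn; rewrite /E exp2S // exp2D //; apply: (pa_leM MPA) => //.
by apply: (pa_le_trans H ha); do 2 apply: exp2_mono => //.
Qed.

(** A bound on a code for 2^a, obtained by bounding every product formed in
    the course of its construction by a double exponential; an exponentially
    closed cut therefore computes powers of 2 correctly. *)
Lemma small_pow2 a : exists c d, [/\ beta c d 0 1,
  forall i, i < a -> exists u, beta c d i u /\ beta c d (i + 1) (u + u),
  beta c d a (exp2 a),
  c <= exp2 (exp2 (a + a + (1 + 1 + 1 + 1 + 1)))
  & d <= exp2 (exp2 (a + a + (1 + 1 + 1 + 1 + 1)))].
Proof.
have E1 k : 1 <= E k by have := exp2_gt0 MPA (exp2 k) => h; rewrite /E; pa MPA.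
have [|||z [zE z0 zd]] := @common_multiple _ MPA (fun k z => z <= E k) _ _ _ (a + 1).
- by rewrite /E; dfn.
- exact: E1.
- move=> k z zk; apply: EM zk _ (pa_lexx H k).
  have h1 := exp2_gt MPA k; have h2 := exp2_gt MPA (exp2 k).
  by rewrite /E; nn MPA (exp2 k); nn MPA (exp2 (exp2 k)); pa MPA.
have [d ed] : exists d, d = z * exp2 (a + 1) by exists (z * exp2 (a + 1)).
have dE : d <= E (a + 1 + 1).
  rewrite ed; apply: EM zE _ (pa_lexx H _); rewrite /E; apply: exp2_mono => //.
  by have h := exp2_gt MPA (a + 1); nn MPA (exp2 (a + 1)); pa MPA.
have e0 := exp2_gt0 MPA (a + 1).
have h := pa_leM MPA (proj1 (pa_ltS MPA _ _) z0) (pa_lexx H (exp2 (a + 1))).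
have d0 : 0 < d by nn MPA (z * exp2 (a + 1)); pa MPA.
have mE k : k < a + 1 -> modulus d k <= E (a + 1 + 1 + 1).
  move=> ka; apply: (pa_le_trans H (y := (a + 1 + 1) * d)).
    have h' := pa_leM MPA (proj1 (pa_ltS MPA _ _) ka) (pa_lexx H d).
    by rewrite /modulus; pa MPA.
  apply: EM (pa_lexx H _) => //.
  have h1 := exp2_gt MPA (a + 1 + 1); have h2 := exp2_gt MPA (exp2 (a + 1 + 1)).
  by rewrite /E; nn MPA (exp2 (a + 1 + 1)); nn MPA (exp2 (exp2 (a + 1 + 1))); pa MPA.
have defF : fdefinable1 (@exp2 M) by dfn.
have [||||||c [w [wE cw cF]]] := @chinese_code _ MPA
    (fun k w => w <= E (a + 1 + 1 + 1 + k)) (@exp2 M) d (a + 1) _ defF.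
- by rewrite /E; dfn.
- exact: E1.
- move=> k w ka wk; have -> : a + 1 + 1 + 1 + (k + 1) = a + 1 + 1 + 1 + k + 1 by pa MPA.
  rewrite (pa_mulC H); apply: EM (mE _ ka) wk _; by pa MPA.
- exact: d0.
- move=> t t0 ta; have [q ez] := zd t t0 ta; exists (q * exp2 (a + 1)).
  by rewrite ed ez (pa_mulA H).
- move=> i ia; have h1 := exp2_lt MPA ia.
  have h2 := pa_leM MPA (_ : 1 <= i + 1) (pa_lexx H d).
  have {}h2 := h2 ltac:(pa MPA).
  by rewrite /modulus; nn MPA (exp2 i); pa MPA.
have l1 : a + 1 + 1 + 1 + (a + 1) <= a + a + (1 + 1 + 1 + 1 + 1) by pa MPA.
have l2 : a + 1 + 1 <= a + a + (1 + 1 + 1 + 1 + 1) by pa MPA.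
exists c, d; split.
- by rewrite -(exp2_0 MPA); apply: cF; pa MPA.
- move=> i ia; exists (exp2 i); split; first by apply: cF; pa MPA.
  by rewrite -exp2S //; apply: cF; pa MPA.
- by apply: cF; pa MPA.
- apply: (pa_le_trans H (proj1 cw)); apply: (pa_le_trans H wE).
  by do 2 apply: exp2_mono => //.
by apply: (pa_le_trans H dE); do 2 apply: exp2_mono => //.
Qed.


End SmallCodes.

(** [iseg t s]: in binary and without its leading 1, [t] is an initial segment of
    [s], as in [initial_seg] but with exponentiation as a function. *)
Definition iseg (M : structure) (t s : M) : Prop :=
  (t <> 0 /\ exists k r : M, r < exp2 k /\ s = t * exp2 k + r)%A.

Definition has_len (M : structure) (t k : M) : Prop :=
  (exp2 k <= t /\ t < exp2 k + exp2 k)%A.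

(** Entry number [k] of the sequence [s] is 1, respectively 0; neither holds
    beyond its length. *)
Definition bit1 (M : structure) (k s : M) : Prop :=
  (exists t, has_len t k /\ iseg (t + t + 1) s)%A.
Definition bit0 (M : structure) (k s : M) : Prop :=
  (exists t, has_len t k /\ iseg (t + t) s)%A.

Section DefinableSequences.
Variables (M : structure) (MPA : PA M).

Let definable2_len : definable2 (@has_len M). Proof. by rewrite /has_len; dfn. Qed.
Let definable2_ini : definable2 (@iseg M). Proof. by rewrite /iseg; dfn. Qed.
Let definable2_bit1 : definable2 (@bit1 M). Proof. by rewrite /bit1; dfn. Qed.
Let definable2_bit0 : definable2 (@bit0 M). Proof. by rewrite /bit0; dfn. Qed.

Implicit Types f g : (nat -> M) -> M.

Lemma definable_len f g : fdefinable f -> fdefinable g -> definable (fun e => has_len (f e) (g e)).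
Proof. exact: definable_app2. Qed.

Lemma definable_ini f g : fdefinable f -> fdefinable g -> definable (fun e => iseg (f e) (g e)).
Proof. exact: definable_app2. Qed.

Lemma definable_bit1 f g : fdefinable f -> fdefinable g -> definable (fun e => bit1 (f e) (g e)).
Proof. exact: definable_app2. Qed.

Lemma definable_bit0 f g : fdefinable f -> fdefinable g -> definable (fun e => bit0 (f e) (g e)).
Proof. exact: definable_app2. Qed.

End DefinableSequences.

Ltac dfn_user ::= first
  [ match goal with
    | |- fdefinable (fun e => cpair (@?f e) (@?g e)) => refine (@fdefinable_pr _ f g _ _)
    | A : PA _ |- fdefinable (fun e => exp2 (@?f e)) => refine (@fdefinable_ex _ A f _)
    | A : PA _ |- definable (fun e => has_len (@?f e) (@?g e)) => refine (@definable_len _ A f g _ _)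
    | A : PA _ |- definable (fun e => iseg (@?f e) (@?g e)) => refine (@definable_ini _ A f g _ _)
    | A : PA _ |- definable (fun e => bit1 (@?f e) (@?g e)) => refine (@definable_bit1 _ A f g _ _)
    | A : PA _ |- definable (fun e => bit0 (@?f e) (@?g e)) => refine (@definable_bit0 _ A f g _ _)
    end ].

Section Sequences.
Variables (M : structure) (MPA : PA M).
Local Open Scope arith_scope.
Notation H := (proj1 MPA).
Implicit Types k l m n r s t u x y : M.

Lemma len_neq0 t k : has_len t k -> t <> 0.
Proof. by move=> [h _] t0; have := exp2_gt0 MPA k => h'; rewrite t0 in h; pa MPA. Qed.

Lemma len_uniq t k l : has_len t k -> has_len t l -> k = l.
Proof.
have key k' l' : has_len t k' -> has_len t l' -> ~ k' < l'.
  move=> [_ h1] [h2 _] /(pa_ltS MPA) /(exp2_mono MPA).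
  by rewrite exp2S // => h3; pa MPA.
move=> hk hl; apply: contrapT => n; case: (pa_le_total H k l) => h.
  exact: (key _ _ hk hl (conj h n)).
exact: (key _ _ hl hk (conj h (nesym n))).
Qed.

Lemma len_total t : t <> 0 -> exists k, has_len t k.
Proof.
move=> t0; have [||k [tk km]] := @pa_least _ MPA (fun k => t < exp2 k + exp2 k).
- by dfn.
- by exists t; have h := exp2_gt MPA t; nn MPA (exp2 t); pa MPA.
exists k; split=> //; have [e|k0] := pselect (k = 0).
  rewrite e exp2_0 //; apply: contrapT => h; apply: t0; pa MPA.
have [k' ek] : exists k', k' + 1 = k.
  have [|z ez] := @Defs.pa_le_sub _ MPA 1 k.
    by apply: contrapT => h; apply: k0; pa MPA.
  by exists z; rewrite (pa_addC H).
rewrite -ek exp2S //; apply: contrapT => h.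
have : k <= k' by apply: km; pa MPA.
by move=> h'; pa MPA.
Qed.

Lemma len_le t k : has_len t k -> k <= t.
Proof. by move=> [h _]; have h' := exp2_gt MPA k; nn MPA (exp2 k); pa MPA. Qed.

Lemma len_dbl t k : has_len t k -> has_len (t + t) (k + 1) /\ has_len (t + t + 1) (k + 1).
Proof. by rewrite /has_len exp2S // => -[h1 h2]; nn MPA (exp2 k); split; split; pa MPA. Qed.

Lemma iseg_refl s : s <> 0 -> iseg s s.
Proof. by move=> s0; split=> //; exists 0, 0; rewrite exp2_0 //; split; pa MPA. Qed.

Lemma iseg_trans t s u : iseg t s -> iseg s u -> iseg t u.
Proof.
move=> [t0 [k [r [rk es]]]] [_ [l [q [ql eu]]]]; split=> //.
exists (k + l), (r * exp2 l + q); rewrite exp2D // eu es.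
have h := pa_leM MPA (proj1 (pa_ltS MPA _ _) rk) (pa_lexx H (exp2 l)).
by split; pa MPA.
Qed.

Lemma iseg_le t s : iseg t s -> t <= s.
Proof.
move=> [t0 [k [r [rk ->]]]].
have h := pa_leM MPA (pa_lexx H t) (proj1 (pa_ltS MPA _ _) (exp2_gt0 MPA k)).
by pa MPA.
Qed.

Lemma iseg_dbl s : s <> 0 -> iseg s (s + s) /\ iseg s (s + s + 1).
Proof.
by move=> s0; split; split=> //; exists 1; [exists 0|exists 1];
  have := exp2S MPA 0; rewrite exp2_0 // => e; have {}e : exp2 (1 : M) = 1 + 1;
  by [rewrite -e; congr exp2; pa MPA|rewrite e; split; pa MPA].
Qed.

Lemma iseg_comp t u s : iseg t s -> iseg u s -> iseg t u \/ iseg u t.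
Proof.
have key k l t' u' r r' : r < exp2 k -> r' < exp2 l ->
    t' * exp2 k + r = u' * exp2 l + r' -> u' <> 0 -> k <= l -> iseg u' t'.
  move=> rk rl e u0 /(Defs.pa_le_sub MPA)[m em].
  have [q [r2 [h2 e2]]] := pa_div MPA r' (exp2_gt0 MPA k).
  rewrite -em exp2D // in rl e.
  have [-> _] : t' = u' * exp2 m + q /\ r = r2.
    by apply: (div_uniq MPA rk h2); rewrite e e2; pa MPA.
  split=> //; exists m, q; split=> //; apply/(pa_leNgt MPA) => h.
  have := pa_leM MPA h (pa_lexx H (exp2 k)) => h'.
  by rewrite e2 in rl; nn MPA r2; pa MPA.
move=> [t0 [k [r [rk e]]]] [u0 [l [q [ql e']]]].
rewrite e in e'; case: (pa_le_total H k l) => h.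
  by right; apply: key rk ql e' u0 h.
by left; apply: key ql rk (esym e') t0 h.
Qed.

Lemma iseg_le_comp t u s : iseg t s -> iseg u s -> t <= u -> iseg t u.
Proof.
move=> ts us tu; case: (iseg_comp ts us) => // ut.
have -> : t = u by apply: (pa_le_anti H tu); exact: iseg_le.
by apply: iseg_refl; case: us.
Qed.

Lemma iseg_cases t s : iseg t s -> t = s \/ t + t <= s.
Proof.
move=> [t0 [k [r [rk ->]]]]; have [k0|k0] := pselect (k = 0).
  by rewrite k0 exp2_0 // in rk *; left; pa MPA.
right; have k1 : 0 + 1 <= k by apply: contrapT => h; apply: k0; pa MPA.
have h := exp2_mono MPA k1; rewrite exp2S // exp2_0 // in h.
have := pa_leM MPA (pa_lexx H t) h => h'; by pa MPA.
Qed.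

Lemma iseg_same t s k : iseg t s -> has_len t k -> has_len s k -> t = s.
Proof.
move=> /iseg_cases[//|h] [h1 _] [_ h2]; exfalso; by pa MPA.
Qed.

Lemma iseg_len s n k : has_len s n -> k <= n -> exists t, iseg t s /\ has_len t k.
Proof.
move=> [s1 s2] /(Defs.pa_le_sub MPA)[m em]; rewrite -em exp2D // in s1 s2.
have [q [r [rm es]]] := pa_div MPA s (exp2_gt0 MPA m); rewrite es in s1 s2.
have q1 : exp2 k <= q.
  apply: contrapT => /(pa_leNgt MPA) h.
  by have := pa_leM MPA (proj1 (pa_ltS MPA _ _) h) (pa_lexx H (exp2 m)) => h'; pa MPA.
have q2 : q < exp2 k + exp2 k.
  apply/(pa_leNgt MPA) => h.
  by have := pa_leM MPA h (pa_lexx H (exp2 m)) => h'; nn MPA r; pa MPA.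
exists q; split=> //; split; last by exists m, r.
exact: (len_neq0 (conj q1 q2)).
Qed.

Lemma iseg_lenle t s k n : iseg t s -> has_len t k -> has_len s n -> k <= n.
Proof.
move=> ts tk [s1 s2]; apply/(pa_ltNge MPA) => h.
have := exp2_mono MPA (proj1 (pa_ltS MPA _ _) h); rewrite exp2S // => h1.
by have h2 := iseg_le ts; case: tk => h3 _; pa MPA.
Qed.

Lemma iseg_step t s : iseg t (s + s) \/ iseg t (s + s + 1) ->
  [\/ t = s + s, t = s + s + 1 | iseg t s].
Proof.
move=> h; have [s0|s0] := pselect (s = 0).
  case: h => h; first by have := iseg_le h; case: h; rewrite s0 => t0 _ h; case: t0; pa MPA.
  have := iseg_le h; case: h; rewrite s0 => t0 _ h; apply: Or32.
  have : 1 <= t by apply: contrapT => n; apply: t0; pa MPA.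
  by move=> h'; pa MPA.
have [d0 d1] := iseg_dbl s0.
have key u : (u = s + s \/ u = s + s + 1) -> iseg s u -> iseg t u -> t = u \/ iseg t s.
  move=> eu su tu; case: (iseg_cases tu) => [|h2]; [by left|right].
  apply: iseg_le_comp tu su _; case: eu => eu; rewrite eu in h2; last by pa MPA.
  by pa MPA.
case: h => h.
  by case: (key _ (or_introl erefl) d0 h) => h2; [apply: Or31|apply: Or33].
by case: (key _ (or_intror erefl) d1 h) => h2; [apply: Or32|apply: Or33].
Qed.

Lemma iseg_next t s : iseg t s -> t <> s -> iseg (t + t) s \/ iseg (t + t + 1) s.
Proof.
move=> ts ns; have t0 : t <> 0 by case: ts.
have [n sn] : exists n, has_len s n.
  apply: len_total => s0; apply: t0.
  by have := iseg_le ts; rewrite s0 => h; pa MPA.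
have [k tk] := len_total t0; have kn := iseg_lenle ts tk sn.
have kn' : k + 1 <= n.
  apply: contrapT => h; apply: ns; apply: (iseg_same ts tk).
  by have -> : k = n by pa MPA.
have [u [us ul]] := iseg_len sn kn'.
have tu : iseg t u.
  apply: iseg_le_comp ts us _; case: tk => _ h1; case: ul; rewrite exp2S // => h2 _.
  by pa MPA.
case: (tu) => _ [m [r [rm eu]]].
have [m0|m0] := pselect (m = 0).
  rewrite m0 exp2_0 // in rm eu; exfalso.
  have e : u = t by pa MPA.
  rewrite e in ul; have := len_uniq tk ul => h; by pa MPA.
have [m1|m1] := pselect (m = 1).
  have e2 : exp2 (1 : M) = 1 + 1.
    by have := exp2S MPA 0; rewrite exp2_0 // => <-; congr exp2; pa MPA.
  rewrite m1 e2 in rm eu.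
  have [r0|r0] := pselect (r = 0).
    by left; have <- : u = t + t by rewrite r0 in eu; pa MPA.
  right; have <- // : u = t + t + 1.
  have : 1 <= r by apply: contrapT => h; apply: r0; pa MPA.
  by move=> h; pa MPA.
exfalso; have h : 0 + 1 + 1 <= m.
  apply: contrapT => h; have [h'|h'] := pselect (m <= 0); first by apply: m0; pa MPA.
  by apply: m1; pa MPA.
have := exp2_mono MPA h; rewrite !exp2S // exp2_0 // => h1.
have := pa_leM MPA (pa_lexx H t) h1 => h2.
by case: tk => h3 _; case: ul; rewrite exp2S // => _ h4; pa MPA.
Qed.

Lemma bit_excl k s : bit1 k s -> bit0 k s -> False.
Proof.
move=> [t [tk ts]] [u [uk us]].
have [_ l1] := len_dbl tk; have [l2 _] := len_dbl uk.
have e : t + t + 1 = u + u.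
  by case: (iseg_comp ts us) => h; [apply: (iseg_same h l1 l2)|
    apply/esym/(iseg_same h l2 l1)].
have [h|h] := pselect (t + 1 <= u); by pa MPA.
Qed.

Lemma bit_total k n s : has_len s n -> k < n -> bit1 k s \/ bit0 k s.
Proof.
move=> sn kn; have [t [ts tk]] := iseg_len sn (proj1 kn).
have : t <> s by move=> e; rewrite e in tk; case: kn => _; apply; exact: len_uniq tk sn.
by move/(iseg_next ts) => [h|h]; [right|left]; exists t.
Qed.

Lemma bit1_iseg k s u : bit1 k s -> iseg s u -> bit1 k u.
Proof. by move=> [t [tk ts]] su; exists t; split=> //; exact: iseg_trans ts su. Qed.

Lemma bit0_iseg k s u : bit0 k s -> iseg s u -> bit0 k u.
Proof. by move=> [t [tk ts]] su; exists t; split=> //; exact: iseg_trans ts su. Qed.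

Definition truth_code (P : M -> Prop) n : M :=
  prim_rec 1 (fun i u => pif (P i) (u + u + 1) (u + u)) n.

Lemma fdefinable_code (P : (nat -> M) -> M -> Prop) (f : (nat -> M) -> M) :
  definable (fun e => P (fun i : nat => e i.+1) (e 0%N)) -> fdefinable f ->
  fdefinable (fun e => truth_code (P e) (f e)).
Proof.
move=> dp df; apply: fdefinable_recf => //; first by dfn.
apply: fdefinable_if; [|by dfn|by dfn].
by apply: (definable_ren (fun j : nat => if j is j'.+1 then j'.+2 else 0%N) dp).
Qed.

Section Code.
Variable (P : M -> Prop).
Hypothesis dp : definable1 P.

Let dh : fdefinable2 (fun i u => pif (P i) (u + u + 1) (u + u)). Proof. by dfn. Qed.

Lemma truth_codeS n : truth_code P (n + 1) = pif (P n) (truth_code P n + truth_code P n + 1) (truth_code P n + truth_code P n).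
Proof. exact: (prim_recS MPA). Qed.

Let dc : fdefinable1 (truth_code P). Proof. by apply: fdefinable_code; dfn. Qed.

Lemma truth_code_len n : has_len (truth_code P n) n.
Proof.
move: n; apply: (pa_ind MPA); first by dfn.
  by rewrite /truth_code prim_rec0 // /has_len exp2_0 //; split; pa MPA.
by move=> n /len_dbl[h1 h2]; rewrite truth_codeS /pif; case: asboolP.
Qed.

Lemma truth_code_iseg k n : k <= n -> iseg (truth_code P k) (truth_code P n).
Proof.
move: n; apply: (pa_ind MPA).
- by dfn.
- move=> h; have -> : k = 0 by pa MPA.
  by apply: iseg_refl; exact: len_neq0 (truth_code_len 0).
move=> n IH kn; have [h|h] := pselect (k <= n).
  apply: iseg_trans (IH h) _; rewrite truth_codeS /pif.
  by have [? ?] := iseg_dbl (len_neq0 (truth_code_len n)); case: asboolP.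
have -> : k = n + 1 by pa MPA.
by apply: iseg_refl; exact: len_neq0 (truth_code_len _).
Qed.

Lemma truth_code_bit k n : k < n -> (bit1 k (truth_code P n) <-> P k).
Proof.
move=> /(pa_ltS MPA)/truth_code_iseg; rewrite truth_codeS /pif; case: asboolP => hP h.
  by split=> // _; exists (truth_code P k); split=> //; exact: truth_code_len.
split=> // h1; exfalso; apply: (bit_excl h1).
by exists (truth_code P k); split=> //; exact: truth_code_len.
Qed.

End Code.

End Sequences.

(** * Counting below a bound *)

Definition ncount (M : structure) (P : M -> Prop) (n : M) : M :=
  prim_rec szero (fun i u => pif (P i) (sadd u sone) u) n.

Lemma fdefinable_cnt (M : structure) (MPA : PA M) (P : (nat -> M) -> M -> Prop)
    (f : (nat -> M) -> M) :
  definable (fun e => P (fun i : nat => e i.+1) (e 0%N)) -> fdefinable f ->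
  fdefinable (fun e => ncount (P e) (f e)).
Proof.
move=> dp df; apply: fdefinable_recf => //; first by dfn.
apply: fdefinable_if; [|by dfn|by dfn].
by apply: (definable_ren (fun j : nat => if j is j'.+1 then j'.+2 else 0%N) dp).
Qed.

Ltac dfn_user ::= first
  [ match goal with
    | |- fdefinable (fun e => cpair (@?f e) (@?g e)) => refine (@fdefinable_pr _ f g _ _)
    | A : PA _ |- fdefinable (fun e => exp2 (@?f e)) => refine (@fdefinable_ex _ A f _)
    | A : PA _ |- fdefinable (fun e => ncount (@?P e) (@?f e)) => refine (@fdefinable_cnt _ A P f _ _)
    | A : PA _ |- fdefinable (fun e => truth_code (@?P e) (@?f e)) => refine (@fdefinable_code _ A P f _ _)
    | A : PA _ |- definable (fun e => has_len (@?f e) (@?g e)) => refine (@definable_len _ A f g _ _)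
    | A : PA _ |- definable (fun e => iseg (@?f e) (@?g e)) => refine (@definable_ini _ A f g _ _)
    | A : PA _ |- definable (fun e => bit1 (@?f e) (@?g e)) => refine (@definable_bit1 _ A f g _ _)
    | A : PA _ |- definable (fun e => bit0 (@?f e) (@?g e)) => refine (@definable_bit0 _ A f g _ _)
    end ].

Section Counting.
Variables (M : structure) (MPA : PA M).
Local Open Scope arith_scope.
Notation H := (proj1 MPA).
Implicit Types m n u w x y z : M.
Implicit Types P Q R : M -> Prop.

Lemma ncount0 P : definable1 P -> ncount P 0 = 0.
Proof. by move=> dp; apply: (prim_rec0 MPA); dfn. Qed.

Lemma ncountS P x : definable1 P -> ncount P (x + 1) = pif (P x) (ncount P x + 1) (ncount P x).
Proof. by move=> dp; apply: (prim_recS MPA); dfn. Qed.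

Lemma ncount_cover P Q R x : definable1 P -> definable1 Q -> definable1 R ->
  (forall z, z < x -> P z -> Q z \/ R z) -> ncount P x <= ncount Q x + ncount R x.
Proof.
move=> dp dq dr; move: x; apply: (pa_ind MPA); first by dfn.
  by move=> _; rewrite !ncount0 //; pa MPA.
move=> x IH h; rewrite !ncountS // /pif.
have {}IH : ncount P x <= ncount Q x + ncount R x by apply: IH => z zx; apply: h; pa MPA.
have hx := h x (Defs.pa_S_lt MPA x).
nn MPA (ncount P x); nn MPA (ncount Q x); nn MPA (ncount R x).
case: asboolP => px; case: asboolP => qx; case: asboolP => rx; try by pa MPA.
by case: (hx px).
Qed.

Lemma ncount_False x : ncount (fun=> False) x = 0.
Proof.
move: x; apply: (pa_ind MPA); [by dfn|by rewrite ncount0 //; dfn|move=> x e].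
by rewrite ncountS; [rewrite /pif; case: asboolP|dfn].
Qed.

Lemma ncount_True x : ncount (fun=> True) x = x.
Proof.
move: x; apply: (pa_ind MPA); [by dfn|by rewrite ncount0 //; dfn|move=> x e].
by rewrite ncountS; [rewrite /pif; case: asboolP => // _; rewrite e|dfn].
Qed.

Lemma ncount_le P Q x : definable1 P -> definable1 Q ->
  (forall z, z < x -> P z -> Q z) -> ncount P x <= ncount Q x.
Proof.
move=> dp dq h; have := @ncount_cover P Q (fun=> False) x dp dq ltac:(dfn).
by rewrite ncount_False (pa_addx0 H); apply=> z zx /(h z zx); left.
Qed.

Lemma ncount_single m x : ncount (fun z => z = m) x <= 1 /\ (x <= m -> ncount (fun z => z = m) x = 0).
Proof.
have dm : definable1 (fun z => z = m) by dfn.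
move: x; apply: (pa_ind MPA); first by dfn.
  by rewrite ncount0 //; split; [pa MPA|].
move=> x [h1 h2]; rewrite ncountS // /pif; nn MPA (ncount (fun z => z = m) x).
case: asboolP => [e|n].
  split=> [|h]; last by clear h2; exfalso; pa MPA.
  by rewrite h2; [pa MPA|rewrite e; exact: (pa_lexx H)].
by split=> // h; apply: h2; pa MPA.
Qed.

Lemma ncount_two P x m : definable1 P -> 1 + 1 <= ncount P x -> exists z, [/\ z < x, P z & z <> m].
Proof.
move=> dp h; apply: contrapT => n.
have := @ncount_le P (fun z => z = m) x dp ltac:(dfn).
have [h1 _] := ncount_single m x.
nn MPA (ncount P x); nn MPA (ncount (fun z => z = m) x) => h2.
suff h3 : ncount P x <= ncount (fun z => z = m) x by clear h2; pa MPA.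
by apply: h2 => z zx Pz; apply: contrapT => nz; apply: n; exists z.
Qed.

(** [ncount P z] is the position of a member [z] of [P] in increasing order; sets
    are cut into slices of prescribed size by means of these positions. *)
Lemma ncount_slice P x u w : definable1 P -> u + w <= ncount P x ->
  w <= ncount (fun z => P z /\ (u <= ncount P z /\ ncount P z < u + w)) x.
Proof.
move=> dp; set Q := fun z => _.
have dq : definable1 Q by rewrite /Q; dfn.
suff key : ncount P x <= u + ncount Q x \/ w <= ncount Q x.
  move=> h; case: key => // key; nn MPA (ncount P x); nn MPA (ncount Q x); pa MPA.
move: x; apply: (pa_ind MPA); first by dfn.
  by left; rewrite !ncount0 //; pa MPA.
move=> x IH; rewrite !ncountS // /pif; nn MPA (ncount P x); nn MPA (ncount Q x).
case: asboolP => px; case: asboolP => qx; try by case: IH => h; [left|right]; pa MPA.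
have [h1|h1] := pselect (ncount P x < u); first by left; pa MPA.
case: IH => h; last by right.
right; apply: contrapT => h2; apply: qx; rewrite /Q; split=> //; split; pa MPA.
Qed.

End Counting.

(** * Elementary extensions and definable closure *)

Section Transfer.
Variables (M N : structure) (f : M -> N).
Hypothesis ef : elementary f.

(* Elementarity only speaks of parameters from the base model, whence the
   universal closure over the free variables. *)
Let closure (phi : fo_formula) n : fo_formula := iter n (@fall void) phi.

Let closureP (K : structure) phi n (w : nat -> K) : fo_sat w (closure phi n) <->
  forall u : nat -> K, fo_sat (fun k => if k < n then u k else w (k - n)) phi.
Proof.
elim: n w => [|n IH] w.
  rewrite /=; have -> : (fun k => w (k - 0)) = w by apply/funext => k; rewrite subn0.
  by split=> // h; exact: (h w).
rewrite [closure phi _]/=; split=> [h u|h x].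
  have /IH /(_ u) := h (u n); apply: fo_sat_eq => k.
  rewrite ltnS; case: ltngtP => //= [kn|->].
  - by rewrite -(subnSK kn).
  - by rewrite subnn.
apply/IH => u; have := h (fun k => if k == n then x else u k).
apply: fo_sat_eq => k; rewrite ltnS.
case: ltngtP => //= [kn|->]; last by rewrite subnn.
by rewrite -(subnSK kn).
Qed.

Lemma transfer (phi : fo_formula) :
  (forall v : nat -> M, fo_sat v phi) -> forall w : nat -> N, fo_sat w phi.
Proof.
move=> h w; pose n := ffv phi.
have hM : fo_sat (fun=> szero : M) (closure phi n) by apply/closureP => u; exact: h.
have hN := (ef (closure phi n) (fun=> szero)).1 hM.
move: (proj1 (closureP _ _ _) hN w).
by apply: (proj1 (sat_fv _ _)) => k kn; rewrite kn.
Qed.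

Let x0 := tvar 0.
Let x1 := tvar 1.
Let x2 := tvar 2.
Let imp (a b : fo_formula) : fo_formula := for_ (fnot a) b.
Let lt (s t : term) : fo_formula := fand (fle s t) (fnot (feq s t)).
Let impE (K : structure) (v : nat -> K) a b :
  fo_sat v (imp a b) <-> (fo_sat v a -> fo_sat v b).
Proof. by rewrite [(_ -> _)]implyE. Qed.

Lemma elementary_PA_minus : PA_minus M -> PA_minus N.
Proof.
case; move=> h1 h2 h3 h4 h5 h6 h7 h8 h9 h10 h11 h12 h13 h14 h15 h16 h17 h18.
pose e3 (x y z : N) := scons x (scons y (scons z (fun=> szero))).
split.
- move=> x y z; apply: (@transfer (feq (tadd x0 (tadd x1 x2)) (tadd (tadd x0 x1) x2))
    _ (e3 x y z)) => v; exact: h1.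
- move=> x y; apply: (@transfer (feq (tadd x0 x1) (tadd x1 x0)) _ (e3 x y x)) => v.
  exact: h2.
- move=> x y z; apply: (@transfer (feq (tmul x0 (tmul x1 x2)) (tmul (tmul x0 x1) x2))
    _ (e3 x y z)) => v; exact: h3.
- move=> x y; apply: (@transfer (feq (tmul x0 x1) (tmul x1 x0)) _ (e3 x y x)) => v.
  exact: h4.
- move=> x y z; apply: (@transfer (feq (tmul x0 (tadd x1 x2))
    (tadd (tmul x0 x1) (tmul x0 x2))) _ (e3 x y z)) => v; exact: h5.
- move=> x; apply: (@transfer (feq (tadd x0 tzero) x0) _ (e3 x x x)) => v; exact: h6.
- move=> x; apply: (@transfer (feq (tmul x0 tzero) tzero) _ (e3 x x x)) => v; exact: h7.
- move=> x; apply: (@transfer (feq (tmul x0 tone) x0) _ (e3 x x x)) => v; exact: h8.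
- move=> x; apply: (@transfer (fle x0 x0) _ (e3 x x x)) => v; exact: h9.
- move=> x y; suff /impE h : fo_sat (e3 x y x) (imp (fle x0 x1) (imp (fle x1 x0) (feq x0 x1))).
    by move=> a b; have /impE := h a; apply.
  by apply: transfer => v; apply/impE => a; apply/impE; exact: h10.
- move=> x y z; suff /impE h : fo_sat (e3 x y z) (imp (fle x0 x1) (imp (fle x1 x2) (fle x0 x2))).
    by move=> a b; have /impE := h a; apply.
  by apply: transfer => v; apply/impE => a; apply/impE; exact: h11.
- move=> x y; apply: (@transfer (for_ (fle x0 x1) (fle x1 x0)) _ (e3 x y x)) => v.
  exact: h12.
- move=> x y z; suff /impE h : fo_sat (e3 x y z) (imp (lt x0 x1) (lt (tadd x0 x2) (tadd x1 x2))).
    exact: h.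
  by apply: transfer => v; apply/impE; exact: h13.
- move=> x y z; suff /impE h : fo_sat (e3 x y z)
      (imp (lt tzero x2) (imp (lt x0 x1) (lt (tmul x0 x2) (tmul x1 x2)))).
    by move=> a b; have /impE := h a; apply.
  by apply: transfer => v; apply/impE => a; apply/impE; exact: h14.
- move=> x y; suff /impE h : fo_sat (e3 x y x)
      (imp (lt x0 x1) (fex (feq (tadd x1 x0) x2))).
    exact: h.
  by apply: transfer => v; apply/impE; exact: h15.
- by apply: (@transfer (lt tzero tone) _ (fun=> szero)) => v; exact: h16.
- move=> x; suff /impE h : fo_sat (e3 x x x) (imp (lt tzero x0) (fle tone x0)).
    exact: h.
  by apply: transfer => v; apply/impE; exact: h17.
- move=> x; apply: (@transfer (fle tzero x0) _ (e3 x x x)) => v; exact: h18.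
Qed.

Let skip (k : nat) : nat := if k is k'.+1 then k'.+2 else 0.

Let sat_skip (K : structure) (x y : K) v phi :
  fo_sat (scons x (scons y v)) (fren skip phi) <-> fo_sat (scons x v) phi.
Proof.
rewrite /fo_sat sat_ren; have -> // : scons x (scons y v) \o skip = scons x v.
by apply/funext => -[].
Qed.

Lemma elementary_PA : PA M -> PA N.
Proof.
move=> MPA; split; first exact: elementary_PA_minus (proj1 MPA).
move=> phi v h0 hS.
pose A := fex (fand (feq x0 tzero) phi).
pose C := fex (fand (feq x0 (tadd x1 tone)) (fren skip phi)).
pose B := fall (imp phi C).
suff /impE : fo_sat v (imp (fand A B) (fall phi)).
  apply; split; first by exists szero.
  move=> x; suff : fo_sat (scons x v) (imp phi C) by [].
  by apply/impE => /hS hx; exists (x + 1)%A; split=> //; apply/sat_skip.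
apply: transfer => {h0 hS}v; apply/impE => -[[_ [/= -> h0]] hB] x.
apply: (proj2 MPA phi v) => // {}x hx.
have hx' : fo_sat (scons x v) (imp phi C) := hB x.
by move/impE: hx' => /(_ hx) [y [/= -> /sat_skip]].
Qed.

End Transfer.

(** The universe of an elementary substructure is a set with witnesses for
    all existential statements about its members. *)
Definition witnessed (M : structure) (U : set M) : Prop :=
  forall (phi : fo_formula) (v : nat -> M), (forall k, U (v k)) ->
    (exists x, fo_sat (scons x v) phi) -> exists x, U x /\ fo_sat (scons x v) phi.

Section TarskiVaught.
Variables (M : structure) (U : set M).
Hypotheses (wU : witnessed U) (U0 : U !=set0).

Lemma witnessed_closed : closed_sub U.
Proof.
have [a Ua] := U0.
have key (t : term) v : (forall k, U (v k)) -> U (teval v t).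
  move=> Uv; have [|x [Ux e]] := wU (phi := feq (tvar 0) (tren S t)) Uv.
    by exists (teval v t); rewrite /fo_sat /= teval_ren.
  by move: e; rewrite /fo_sat /= teval_ren => <-.
split.
- by apply: (key tzero (fun=> a)).
- by apply: (key tone (fun=> a)).
- by move=> x y Ux Uy; apply: (key (tadd (tvar 0) (tvar 1)) (scons x (fun=> y))) => -[].
- by move=> x y Ux Uy; apply: (key (tmul (tvar 0) (tvar 1)) (scons x (fun=> y))) => -[].
Qed.

Let K := substructure witnessed_closed.
Let emb : K -> M := val.

Let embU (x : K) : U (emb x).
Proof. exact: set_valP. Qed.

Let lift (x : M) : U x -> exists y : K, emb y = x.
Proof. by move=> Ux; exists (exist _ x (mem_set Ux)). Qed.

Let teval_emb (v : nat -> K) t : emb (teval v t) = teval (emb \o v) t.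
Proof. by elim: t => //= s IHs t IHt; rewrite -IHs -IHt. Qed.

Let emb_inj : injective emb.
Proof. exact: val_inj. Qed.

Let emb_scons x v : emb \o scons x v = scons (emb x) (emb \o v).
Proof. by apply/funext => -[]. Qed.

Lemma tarski_vaught : @elementary K M val.
Proof.
move=> phi; rewrite -/emb.
have wit f (v : nat -> K) :
  (exists x, fo_sat (scons x (emb \o v)) f) ->
  exists x : K, fo_sat (scons (emb x) (emb \o v)) f.
  move=> h; have [//|x [/lift[y <-] hx]] := wU _ h; last by exists y.
  by move=> k; exact: embU.
elim: phi => [s t|s t|t []|f IH|f IHf g IHg|f IHf g IHg|t f IH|t f IH|f IH|f IH] v;
  rewrite /fo_sat /=.
- rewrite -!teval_emb; split=> [e|]; [by rewrite e|exact: emb_inj].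
- by rewrite -!teval_emb.
- by rewrite [sat _ _ _](propext (IH v)).
- by rewrite [sat _ v f](propext (IHf v)) [sat _ v g](propext (IHg v)).
- by rewrite [sat _ v f](propext (IHf v)) [sat _ v g](propext (IHg v)).
- split=> [[x [xt /IH]]|[x [xt hx]]].
    by rewrite emb_scons -teval_emb => hx; exists (emb x).
  have [|y [yt hy]] := wit (fand (fle (tvar 0) (tren S t)) f) v.
    by exists x; split=> //=; rewrite teval_ren.
  exists y; split; last by apply/IH; rewrite emb_scons.
  by move: yt => /=; rewrite teval_ren -teval_emb.
- split=> [h x xt|h x xt].
    apply: contrapT => nx.
    have [|y [yt ny]] := wit (fand (fle (tvar 0) (tren S t)) (fnot f)) v.
      by exists x; split=> //=; rewrite teval_ren.
    apply: ny; rewrite -emb_scons; apply/IH; apply: h.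
    by move: yt => /=; rewrite teval_ren -teval_emb.
  by apply/IH; rewrite emb_scons; apply: h; rewrite -teval_emb.
- split=> [[x /IH]|h]; first by rewrite emb_scons; exists (emb x).
  by have [y hy] := wit _ _ h; exists y; apply/IH; rewrite emb_scons.
- split=> [h x|h x]; last by apply/IH; rewrite emb_scons; exact: h.
  apply: contrapT => nx; have [|y ny] := wit (fnot f) v; first by exists x.
  by apply: ny; rewrite -emb_scons; apply/IH.
Qed.

Lemma generates_witnessed (X : set M) : generates X -> X `<=` U -> U = setT.
Proof.
move=> gX XU; apply/seteqP; split=> // x _; apply: contrapT => nUx.
apply: gX; exists K, emb; split; last by move=> y /XU /lift[z]; exists z.
split; first exact: tarski_vaught.
move=> e; apply: nUx; have [y _ <-] : range emb x by rewrite e.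
exact: embU.
Qed.

End TarskiVaught.

Lemma range_witnessed (K N : structure) (e : K -> N) :
  elementary e -> witnessed (range e).
Proof.
move=> ee phi v Uv hx.
have [u eu] : exists u : nat -> K, e \o u = v.
  exists (fun k => projT1 (cid2 (Uv k))); apply/funext => k /=.
  by case: (cid2 (Uv k)).
rewrite -eu in hx *; have /ee [x hk] : fo_sat (e \o u) (fex phi) := hx.
exists (e x); split; first by exists x.
by have /ee := hk; apply: fo_sat_eq => -[].
Qed.

(** Least witnesses are definable from the same parameters, which is what makes
    sets closed under definability elementary. *)
Definition fleast (phi : fo_formula) : fo_formula :=
  fand phi (fall (for_ (fnot (fren (fun k => if k is k'.+1 then k'.+2 else 0) phi))
                       (fle (tvar 1) (tvar 0)))).

Lemma fleastP (M : structure) (phi : fo_formula) (v : nat -> M) x :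
  fo_sat (scons x v) (fleast phi) <->
  fo_sat (scons x v) phi /\ forall y, fo_sat (scons y v) phi -> (x <= y)%A.
Proof.
have sk y : sat (fun p : void => match p return set M with end)
    (scons y (scons x v)) (fren (fun k => if k is k'.+1 then k'.+2 else 0) phi)
    <-> fo_sat (scons y v) phi.
  rewrite sat_ren; set w := (_ \o _); have -> // : w = scons y v.
  by apply/funext => -[].
rewrite /fo_sat /=; split=> -[h1 h2]; split=> // y.
  by case: (h2 y) => // + hy; case; apply/sk.
by have [/h2|] := pselect (fo_sat (scons y v) phi); [right|rewrite -sk; left].
Qed.

Lemma fleast_ex (M : structure) (MPA : PA M) (phi : fo_formula) (v : nat -> M) :
  (exists x, fo_sat (scons x v) phi) -> exists x, fo_sat (scons x v) (fleast phi).
Proof.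
move=> /(@pa_least _ MPA (fun x => fo_sat (scons x v) phi)) [|x hx].
  by apply/DefP; exists phi, v.
by exists x; apply/fleastP.
Qed.

Lemma fleast_uniq (M : structure) (MPA : PA M) (phi : fo_formula) (v : nat -> M) x y :
  fo_sat (scons x v) (fleast phi) -> fo_sat (scons y v) (fleast phi) -> x = y.
Proof.
move=> /fleastP[hx lx] /fleastP[hy ly].
exact: (pa_le_anti (proj1 MPA) (lx _ hy) (ly _ hx)).
Qed.

Local Open Scope card_scope.

(** * Countably generated models *)

Lemma countable_enum (T : Type) (a : T) (X : set T) :
  X #<= [set: nat] -> exists m : nat -> T, X `<=` range m.
Proof.
move=> /countable_injP[g gi].
exists (fun n => if pselect (exists x, X x /\ g x = n) is left h
                 then projT1 (cid h) else a) => x Xx.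
exists (g x) => //; case: pselect => [h|[]]; last by exists x.
by case: cid => y /= [Xy e]; apply: gi => //; exact/mem_set.
Qed.

Section Family.
Variables (M : structure) (MPA : PA M) (I : set M) (m : nat -> M).
Hypotheses (I0 : I !=set0) (Ipr : forall x y, I x -> I y -> I (cpair x y)).

(* One parameter from I is enough because I is closed under pairing. *)
Let K : set M := [set a | exists (phi : fo_formula) i,
  I i /\ forall x, fo_sat (scons x (scons i m)) phi <-> x = a].

Let tpr (s t : term) := tadd (tmul (tadd s t) (tadd s t)) s.

(* Eliminating one after the other the parameters from K. *)
Let mixed n (v : nat -> M) (k : nat) : M := if k < n then v k else m (k - n).

Let K_step n (phi : fo_formula) (v : nat -> M) i : (forall k, K (v k)) -> I i ->
  exists phi' i', I i' /\ forall x,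
    fo_sat (scons x (scons i (mixed n v))) phi <->
    fo_sat (scons x (scons i' m)) phi'.
Proof.
move=> Kv; elim: n phi i => [|n IH] phi i Ii.
  exists phi, i; split=> // x.
  by have -> : mixed 0 v = m; [apply/funext => k; rewrite /mixed subn0|].
have [psi [l [Il psiE]]] := Kv n.
(* variables: v_n, l, i, x, the pair of i and l, then the remaining ones *)
pose r1 k := match k with 0 => 0 | 1 => 1 | k'.+2 => (n + k').+4.+1 end.
pose r2 k := match k with
  | 0 => 3 | 1 => 2
  | k'.+2 => if k' < n then k'.+4.+1 else if k' == n then 0 else k'.+4 end.
pose chi := fex (fex (fex (fand
  (feq (tvar 4) (tpr (tvar 2) (tvar 1))) (fand (fren r1 psi) (fren r2 phi))))).
have [phi' [i' [Ii' e]]] := IH chi (cpair i l) (Ipr Ii Il).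
exists phi', i'; split=> // x; rewrite -e {e}.
set w := scons x (scons (cpair i l) (mixed n v)).
have E1 y l' i1 : sat (fun p : void => match p return set M with end)
    (scons y (scons l' (scons i1 w))) (fren r1 psi) <->
    fo_sat (scons y (scons l' m)) psi.
  rewrite sat_ren; set u := (_ \o _); have -> // : u = scons y (scons l' m).
  apply/funext => -[|[|k]] //=; rewrite /u /r1 /=.
  by rewrite /mixed ltnNge leq_addr /= addKn.
have E2 y l' i1 : y = v n -> (sat (fun p : void => match p return set M with end)
    (scons y (scons l' (scons i1 w))) (fren r2 phi) <->
    fo_sat (scons x (scons i1 (mixed n.+1 v))) phi).
  move=> ey; rewrite sat_ren; set u := (_ \o _).
  have -> // : u = scons x (scons i1 (mixed n.+1 v)).
  apply/funext => -[|[|k]] //=; rewrite /u /r2 /=; case: ltnP => kn.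
    by rewrite /= /mixed kn ltnS ltnW.
  case: eqP => [->|nk].
    by rewrite /= /mixed ltnSn ey.
  have {}kn : n < k by rewrite ltn_neqAle kn eq_sym; apply/andP; split=> //; exact/eqP.
  case: k kn {nk} => // k; rewrite ltnS => kn /=.
  have kn' : (k < n) = false by rewrite ltnNge kn.
  by rewrite /mixed ltnS kn' subSS.
rewrite /fo_sat /=; split.
  move=> h; exists i, l, (v n); split=> //.
  by split; [apply/E1/psiE|apply/E2].
move=> [i1 [l' [y [ep [/E1 hy]]]]].
have [e1 e2] := cpair_inj MPA (ep : cpair i l = cpair i1 l'); subst i1 l'.
by move/psiE: hy => ey; move/(E2 _ _ _ ey).
Qed.

Let K_unif (phi : fo_formula) (v : nat -> M) : (forall k, K (v k)) ->
  exists phi' i, I i /\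
    forall x, fo_sat (scons x v) phi <-> fo_sat (scons x (scons i m)) phi'.
Proof.
move=> Kv; have [i Ii] := I0.
pose r k := if k is k'.+1 then k'.+2 else 0.
have [phi' [i' [Ii' e]]] := K_step (ffv phi) (fren r phi) Kv Ii.
exists phi', i'; split=> // x; rewrite -e /fo_sat sat_ren.
apply: sat_fv => -[|k] //= kn; by rewrite /mixed (ltnW kn).
Qed.

Let K_witnessed : witnessed K.
Proof.
move=> phi v Kv hx; have [phi' [i [Ii e]]] := K_unif phi Kv.
have hx' : exists x, fo_sat (scons x (scons i m)) phi'.
  by have [x /e] := hx; exists x.
have [a ha] := fleast_ex MPA hx'.
exists a; split; last by apply/e; case/fleastP: ha.
by exists (fleast phi'), i; split=> // x; split=> [hx2|-> //];
  exact: (fleast_uniq MPA hx2 ha).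
Qed.

(** There are countably many formulas, finitely many generators occur in each
    definition, and the parameters from [I] are merged into one by pairing: this
    is how countable generation is used throughout. *)
Lemma generated_families : generates (range m `|` I) ->
  exists Phi : nat -> M -> M -> Prop, (forall n, definable2 (Phi n)) /\
    forall D, definable1 D -> exists n i, I i /\ forall x, D x <-> Phi n x i.
Proof.
move=> gI; have KI x : (range m `|` I) x -> K x.
  move=> [[k _ <-]|Ix].
    have [i Ii] := I0; exists (feq (tvar 0) (tvar k.+2)), i; split=> // x.
  by exists (feq (tvar 0) (tvar 1)), x.
have K0 : K !=set0 by have [i Ii] := I0; exists i; apply: KI; right.
have KT := generates_witnessed K_witnessed K0 gI KI.
have [F hF] := formula_enum.
exists (fun n x i => fo_sat (scons x (scons i m)) (F n)); split.
  move=> n; apply: (@definable_sat M void _ _ (F n) (fun k e =>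
    match k with 0 => e 0 | 1 => e 1 | k'.+2 => m k' end)) => [[]|[|[|k]]]; dfn.
move=> D /DefP[phi [v ->]].
have [|phi' [i [Ii e]]] := @K_unif phi v; first by rewrite KT.
have [n en] := hF phi'; exists n, i; split=> // x.
by rewrite en -e.
Qed.

End Family.

Lemma generates_sub (M : structure) (X Y : set M) :
  X `<=` Y -> generates X -> generates Y.
Proof.
move=> XY gX [K [e [pe Ye]]]; apply: gX; exists K, e; split=> //.
exact: (subset_trans XY Ye).
Qed.

Lemma generated_enum (M : structure) (I : set M) : generated_over nat I ->
  exists m : nat -> M, generates (range m `|` I).
Proof.
move=> [X [cX gX]]; have [m Xm] := countable_enum szero cX; exists m.
by apply: generates_sub gX => x [/Xm|]; [left|right].
Qed.

(** A set closed under definability in the extension has a trace on the base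
    model that is closed under definability, hence contains the base model. *)
Lemma generated_trans (M N : structure) (MPA : PA M) (f : M -> N) (I : set M) :
  elementary f -> I !=set0 -> generated_over nat I -> generated_over nat (range f) ->
  exists m : nat -> N, generates (range m `|` f @` I).
Proof.
move=> ef I0 /generated_enum[m gm] /generated_enum[m' gm'].
have NPA := elementary_PA ef MPA.
exists (fun k => if odd k then m' k./2 else f (m k./2)).
move=> [K [e [[ee ne] sub]]]; apply: ne.
pose U : set M := [set a | range e (f a)].
have wU : witnessed U.
  move=> phi v Uv /(fleast_ex MPA)[a ha].
  exists a; split; last by case/fleastP: ha.
  have fa : fo_sat (scons (f a) (f \o v)) (fleast phi).
    by have := (ef _ _).1 ha; apply: fo_sat_eq => -[].
  have [|y [[z _ <-] hy]] := @range_witnessed _ _ _ ee (fleast phi) (f \o v) Uv.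
    by exists (f a).
  by exists z => //; exact: (fleast_uniq NPA hy fa).
have mU : range m `|` I `<=` U.
  move=> x [[k _ <-]|Ix]; apply: sub; last by right; exists x.
  by left; exists k.*2 => //; rewrite odd_double doubleK.
have U0 : U !=set0 by have [i Ii] := I0; exists i; apply: mU; right.
have UT := generates_witnessed wU U0 gm mU.
have we := range_witnessed ee.
apply: (generates_witnessed we _ gm').
  by have [i Ui] := U0; exists (f i).
move=> x [[k _ <-]|[a _ <-]].
  by apply: sub; left; exists k.*2.+1 => //=; rewrite odd_double /= uphalf_double.
by have : U a by rewrite UT.
Qed.

(** * Exponentially closed cuts *)

(** Cuts are presented by embeddings, so that the same lemmas serve for a cut of a
    model and for its image in an extension. *)
Record cut_emb (S N : structure) (j : S -> N) : Prop := {
  ce0 : j szero = szero;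
  ce1 : j sone = sone;
  ceD : forall x y, j (x + y)%A = (j x + j y)%A;
  ceM : forall x y, j (x * y)%A = (j x * j y)%A;
  ceI : injective j;
  ce_le : forall x y : S, (x <= y)%A <-> (j x <= j y)%A;
  ce_init : forall x y, (y <= j x)%A -> exists z, j z = y;
  ce_top : exists c, forall x, (j x < c)%A;
  ce_exp : forall x, exists y, j y = exp2 (j x) }.

Definition coded (S N : structure) (j : S -> N) : set (set S) :=
  [set A | exists D : N -> Prop, definable1 D /\ A = [set x | D (j x)]].

Section Cut.
Variables (S N : structure) (NPA : PA N) (j : S -> N).
Hypothesis jC : cut_emb j.
Local Open Scope arith_scope.
Notation HN := (proj1 NPA).

Lemma ce_lt x y : (x < y) <-> (j x < j y).
Proof.
rewrite /slt (ce_le jC); split=> -[h n]; split=> // e; apply: n.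
  exact: (ceI jC).
by rewrite e.
Qed.

Lemma ce_scons x v : j \o scons x v = scons (j x) (j \o v).
Proof. by apply/funext => -[]. Qed.

Lemma ce_teval v t : j (teval v t) = teval (j \o v) t.
Proof.
elim: t => //= [||s IHs t IHt|s IHs t IHt].
- exact: (ce0 jC).
- exact: (ce1 jC).
- by rewrite (ceD jC) IHs IHt.
- by rewrite (ceM jC) IHs IHt.
Qed.

Lemma ce_cpair x y : j (cpair x y) = cpair (j x) (j y).
Proof. by rewrite /cpair !(ceD jC, ceM jC). Qed.

Lemma ce_PA_minus : PA_minus S.
Proof.
have e := (ceD jC, ceM jC, ce0 jC, ce1 jC).
have inj x y : j x = j y -> x = y by exact: (ceI jC).
split; intros; try apply: inj; rewrite ?e.
- exact: (pa_addA HN).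
- exact: (pa_addC HN).
- exact: (pa_mulA HN).
- exact: (pa_mulC HN).
- exact: (pa_mulDr HN).
- exact: (pa_addx0 HN).
- exact: (pa_mulx0 HN).
- exact: (pa_mulx1 HN).
- by apply/(ce_le jC); exact: (pa_lexx HN).
- by apply: (pa_le_anti HN); apply/(ce_le jC).
- by apply/(ce_le jC); apply: (pa_le_trans HN (y := j y)); apply/(ce_le jC).
- by rewrite !(ce_le jC); exact: (pa_le_total HN).
- by apply/ce_lt; rewrite !e; apply: (pa_ltD HN); apply/ce_lt.
- apply/ce_lt; rewrite !e; apply: (pa_ltM HN); last exact/ce_lt.
  by rewrite -(ce0 jC); apply/ce_lt.
- have [z ez] := pa_lt_sub HN (proj1 (ce_lt _ _) H).
  have [z' ez'] : exists z', j z' = z.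
    by apply: (ce_init jC (x := y)); rewrite -ez; nn NPA (j x); pa NPA.
  by exists z'; apply: inj; rewrite e ez'.
- by apply/ce_lt; rewrite !e; exact: (pa_lt01 HN).
- by apply/(ce_le jC); rewrite e; apply: (pa_discrete HN); rewrite -(ce0 jC); apply/ce_lt.
- by apply/(ce_le jC); rewrite e; exact: (pa_le0x HN).
Qed.

(** Bounded quantifiers cannot leave an initial segment. *)
Lemma sat_bounded (P : Type) (pi : P -> set S) (rho : P -> set N) :
  (forall p x, pi p x <-> rho p (j x)) ->
  forall phi v, bounded phi -> (sat pi v phi <-> sat rho (j \o v) phi).
Proof.
move=> pi_rho; elim=> [s t|s t|t p|f IH|f IHf g IHg|f IHf g IHg|t f IH|t f IH|f IH|f IH] v //=.
- by move=> _; rewrite -!ce_teval; split=> [->|/(ceI jC)].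
- by move=> _; rewrite -!ce_teval; exact: (ce_le jC).
- by move=> _; rewrite -!ce_teval; exact: pi_rho.
- by move=> /(IH v) ->.
- by move=> [/(IHf v) -> /(IHg v) ->].
- by move=> [/(IHf v) -> /(IHg v) ->].
- move=> bf; split=> [[x [/(ce_le jC)]]|[y [yt fy]]].
    by rewrite ce_teval => xt /(IH _ bf); rewrite ce_scons => fx; exists (j x).
  have [|x ejx] := ce_init jC (x := teval v t) (y := y); first by rewrite ce_teval.
  exists x; split; first by apply/(ce_le jC); rewrite ce_teval ejx.
  by apply/(IH _ bf); rewrite ce_scons ejx.
- move=> bf; split=> [h y yt|h x /(ce_le jC)].
    have [|x ejx] := ce_init jC (x := teval v t) (y := y); first by rewrite ce_teval.
    have /h /(IH _ bf) : x <= teval v t by apply/(ce_le jC); rewrite ce_teval ejx.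
    by rewrite ce_scons ejx.
  by rewrite ce_teval => /h hx; apply/(IH _ bf); rewrite ce_scons.
Qed.

Lemma ce_beta c d i u : beta c d i u <-> beta (j c) (j d) (j i) (j u).
Proof.
have e := (ceD jC, ceM jC, ce0 jC, ce1 jC).
rewrite /beta -(ce1 jC) -!e -ce_lt; split=> -[h [q eq]]; split=> //.
  by exists (j q); rewrite -!e eq.
have [q' eq'] : exists q', j q' = q.
  apply: (ce_init jC (x := c)); rewrite eq.
  have h' := pa_leM NPA (pa_lexx HN q) (_ : 1 <= j (1 + (i + 1) * d)).
  have {}h' := h' ltac:(rewrite !e; nn NPA (j i); nn NPA (j d); npa NPA).
  by nn NPA (j u); nn NPA (j (1 + (i + 1) * d)); pa NPA.
by exists q'; apply: (ceI jC); rewrite eq !e -eq'.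
Qed.

(** The definition of 2^a quantifies over codes of sequences; upwards the codes are
    kept, downwards the bound on codes shows that some lie in the cut. *)
Lemma ce_pow2 a b : pow2 a b <-> j b = exp2 (j a).
Proof.
have e := (ceD jC, ceM jC, ce0 jC, ce1 jC).
split=> [[c [d [/ce_beta b0 bS /ce_beta ba]]]|eb].
  apply/(pow2E NPA); exists (j c), (j d); split=> //; first by move: b0; rewrite !e.
  move=> i ia; have [i' ei] := ce_init jC (proj1 ia); rewrite -ei in ia *.
  have [u [/ce_beta bu /ce_beta bu']] := bS _ (proj2 (ce_lt _ _) ia).
  by exists (j u); split=> //; move: bu'; rewrite !e.
have bexp z : exists y, j y = exp2 (exp2 (j z)).
  by have [y ey] := ce_exp jC z; have [y' ey'] := ce_exp jC y; exists y'; rewrite ey' ey.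
have [c [d [b0 bS ba cz dz]]] := small_pow2 NPA (j a).
have [z ez] := bexp (a + a + (1 + 1 + 1 + 1 + 1)); rewrite !e in ez.
rewrite -ez in cz dz.
have [c' ec] := ce_init jC cz; have [d' ed] := ce_init jC dz.
rewrite -ec -ed -(ce0 jC) -(ce1 jC) -eb in b0 bS ba.
exists c', d'; split; [exact/ce_beta| |exact/ce_beta].
move=> i /ce_lt/bS[u [bu bu']].
have [u' eu] : exists u', j u' = u.
  apply: (ce_init jC (x := c')); case: bu => _ [q ->].
  by nn NPA (q * (1 + (j i + 1) * j d')); pa NPA.
rewrite -eu -!e in bu bu'.
by exists u'; split; apply/ce_beta.
Qed.

Lemma ce_iseg t s : initial_seg t s <-> iseg (j t) (j s).
Proof.
have e := (ceD jC, ceM jC, ce0 jC, ce1 jC).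
have nz : t <> 0 <-> j t <> 0.
  by split=> h h'; apply: h; [apply: (ceI jC); rewrite e|rewrite h' e].
rewrite /initial_seg /is_seq /iseg nz; clear nz; split=> -[t0 [k]].
  move=> [p [r [/ce_pow2 ep /ce_lt rp es]]]; split=> //.
  by exists (j k), (j r); rewrite -ep -!e es.
move=> [r [rk es]]; split=> //.
have h := pa_leM NPA (_ : 1 <= j t) (pa_lexx HN (exp2 k)).
have {}h := h ltac:(apply: contrapT => t1; apply: t0; nn NPA (j t); pa NPA).
have [p ep] : exists p, j p = exp2 k.
  by apply: (ce_init jC (x := s)); rewrite es; nn NPA (exp2 k); pa NPA.
have [k' ek] : exists k', j k' = k.
  by apply: (ce_init jC (x := p)); rewrite ep; exact: (proj1 (exp2_gt NPA k)).
have [r' er] : exists r', j r' = r.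
  by apply: (ce_init jC (x := p)); rewrite ep; exact: (proj1 rk).
exists k', p, r'; split; first by apply/ce_pow2; rewrite ep ek.
  by apply/ce_lt; rewrite er ep.
by apply: (ceI jC); rewrite !e er ep.
Qed.

(** Otherwise the cut would be definable, against induction. *)
Lemma overspill (P : N -> Prop) : definable1 P -> (forall x, P (j x)) ->
  exists c, (forall x, j x < c) /\ forall y, y <= c -> P y.
Proof.
move=> dp Pj; apply: contrapT => n.
have [c hc] := ce_top jC.
have key : forall y, exists x, y <= j x.
  apply: contrapT => /existsNP[y ny].
  have hy x : j x < y by apply/(pa_leNgt NPA) => h; apply: ny; exists x.
  have [z [zP zmin]] : exists z, ~ P z /\ forall z', ~ P z' -> z <= z'.
    apply: (pa_least NPA (P := fun z => ~ P z)); first by dfn.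
    by apply: contrapT => nz; apply: n; exists y; split=> // z _; apply: contrapT => nP;
      apply: nz; exists z.
  have zj x : j x < z.
    apply/(pa_leNgt NPA) => /(ce_init jC)[x' ejx]; apply: zP; rewrite -ejx; exact: Pj.
  have [z' ez] : exists z', z' + 1 = z.
    have [|t et] := @Defs.pa_le_sub _ NPA 1 z.
      by have := zj 0; rewrite (ce0 jC) => h; pa NPA.
    by exists t; rewrite (pa_addC HN).
  apply: n; exists z'; split=> [x|y' y'z].
    have := zj (x + 1); rewrite (ceD jC) (ce1 jC) => h; by pa NPA.
  by apply: contrapT => /zmin h; pa NPA.
have [x hx] := key c; have := hc x => h; by pa NPA.
Qed.

Section Delta1.
Variables (P : Type) (pi : P -> set S) (rho : P -> set N).
Hypotheses (pi_rho : forall p x, pi p x <-> rho p (j x)) (dr : forall p, definable1 (rho p)).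

(* Bounding the leading quantifiers of a Sigma_1 formula gives a relation that is
   definable in N and increases with the bound. *)
Fixpoint satb (b : N) (v : nat -> N) (phi : formula P) : Prop :=
  match phi with
  | fex f => exists x, x <= b /\ satb b (scons x v) f
  | _ => sat rho v phi
  end.

Let satb_mono b b' v phi : is_Sigma 1 phi -> b <= b' -> satb b v phi -> satb b' v phi.
Proof.
elim: phi v => //= f IH v sf bb [x [xb fx]]; exists x.
split; first exact: (pa_le_trans HN xb bb).
by apply: IH => //; inversion sf as [|n f' p1|n f' s1] => //; inversion p1.
Qed.

Let satbP phi v : is_Sigma 1 phi -> (sat pi v phi <-> exists b, satb (j b) (j \o v) phi).
Proof.
have base f v' : bounded f ->
    (sat pi v' f <-> exists b : S, satb (j b) (j \o v') f).
  move=> bf; have e b : satb (j b) (j \o v') f <-> sat rho (j \o v') f.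
    by case: f bf.
  rewrite (sat_bounded pi_rho v' bf); split=> [h|[b /e]] //.
  by exists 0; apply/e.
have bnd f : is_Pi 0 f -> bounded f by move=> h; inversion h.
elim: phi v => [s t|s t|t p|f IH|f IHf g IHg|f IHf g IHg|t f IH|t f IH|f IH|f IH] v sp;
  try by (apply: base; apply: bnd; inversion sp).
have sf : is_Sigma 1 f by inversion sp as [|n f' p1|n f' s1] => //; inversion p1.
rewrite /=; split=> [[x /(IH _ sf)[b]]|[b [y [yb]]]].
  rewrite ce_scons => hb.
  have [c [xc bc]] : exists c, j x <= j c /\ j b <= j c.
    case: (pa_le_total HN (j x) (j b)) => h; [exists b|exists x]; split=> //;
      exact: (pa_lexx HN).
  by exists c, (j x); split=> //; apply: satb_mono bc hb.
have [x ejx] := ce_init jC yb; rewrite -ejx -ce_scons => h.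
by exists x; apply/(IH _ sf); exists b.
Qed.

Let definable_satb phi (s : nat -> (nat -> N) -> N) f : is_Sigma 1 phi -> fdefinable f ->
  (forall k, fdefinable (s k)) -> definable (fun e => satb (f e) (s^~ e) phi).
Proof.
elim: phi s f => [s t|s t|t p|f IH|f IHf g IHg|f IHf g IHg|t f IH|t f IH|f IH|f IH] u b sp db ds;
  try exact: definable_sat.
have sf : is_Sigma 1 f by inversion sp as [|n f' p1|n f' s1] => //; inversion p1.
apply: (@definable_ex _ (fun x e => x <= b e /\ satb (b e) (scons x (u^~ e)) f)).
apply: definable_and.
  by apply: definable_le; [exact: fdefinable_var|exact: (fdefinable_ren succn db)].
apply: definable_iff (IH (fun k e => if k is k'.+1 then u k' (fun i => e i.+1) else e 0%N)
  (fun e => b (fun i => e i.+1)) sf _ _) => [e||[|k]].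
- have -> // : scons (e 0%N) (u^~ (fun i => e i.+1)) =
    (fun k => if k is k'.+1 then u k' (fun i => e i.+1) else e 0%N).
  by apply/funext => -[].
- exact: (fdefinable_ren succn db).
- exact: fdefinable_var.
- exact: (fdefinable_ren succn (ds k)).
Qed.

(** The Sigma_1 formula equivalent to the negation of a Pi_1 formula. *)
Fixpoint dual (phi : formula P) : formula P :=
  match phi with
  | fall f => fex (dual f)
  | _ => fnot phi
  end.

Let dual_Sigma phi : is_Pi 1 phi -> is_Sigma 1 (dual phi).
Proof.
have bnd f : bounded f -> is_Sigma 1 (fnot f).
  by move=> bf; apply: Sigma_Pi; apply: Pi_bounded.
have sb f : is_Sigma 0 f -> bounded f by move=> h; inversion h.
elim: phi => [s t|s t|t p|f IH|f IHf g IHg|f IHf g IHg|t f IH|t f IH|f IH|f IH] sp;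
  try by (apply: bnd; apply: sb; inversion sp).
have sf : is_Pi 1 f by inversion sp as [|n f' p1|n f' s1] => //; inversion p1.
by apply: Sigma_ex; exact: IH.
Qed.

Let dualP phi v : sat pi v (dual phi) <-> ~ sat pi v phi.
Proof.
elim: phi v => //= f IH v; split=> [[x /IH nx] h|]; first exact: nx.
by move=> /existsNP[x nx]; exists x; apply/IH.
Qed.

(** Exactly one of the two unbounded searches, for a witness of membership and for
    a witness of non-membership, succeeds inside the cut; comparing the least
    witnesses in the large model therefore decides membership there. *)
Lemma Delta1_coded (phi psi : formula P) (v : nat -> S) :
  is_Sigma 1 phi -> is_Pi 1 psi ->
  (forall x, sat pi (scons x v) phi <-> sat pi (scons x v) psi) ->
  coded j [set x | sat pi (scons x v) phi].
Proof.
move=> sphi spsi e.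
pose R x b := satb b (scons x (j \o v)) phi.
pose R' x b := satb b (scons x (j \o v)) (dual psi).
have dR chi : is_Sigma 1 chi -> definable2 (fun x b => satb b (scons x (j \o v)) chi).
  move=> sc; apply: definable_iff (@definable_satb chi
    (fun k e => if k is k'.+1 then j (v k') else e 0%N) (fun e => e 1%N) sc _ _).
  - move=> e'; have -> // : scons (e' 0%N) (j \o v) =
      (fun k => if k is k'.+1 then j (v k') else e' 0%N).
    by apply/funext => -[].
  - exact: fdefinable_var.
  - by case=> [|k]; dfn.
have dR1 : definable2 R by exact: dR.
have dR2 : definable2 R' by apply: dR; exact: dual_Sigma.
have RP x : sat pi (scons x v) phi <-> exists b, R (j x) (j b).
  by rewrite satbP //; split=> -[b hb]; exists b; move: hb; rewrite ce_scons.
have R'P x : ~ sat pi (scons x v) phi <-> exists b, R' (j x) (j b).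
  rewrite e -dualP satbP; last exact: dual_Sigma.
  by split=> -[b hb]; exists b; move: hb; rewrite ce_scons.
exists (fun x => exists b, R x b /\ forall b', b' <= b -> ~ R' x b'); split; first by dfn.
apply/seteqP; split=> x /= hx.
  have /RP[b hb] := hx; exists (j b); split=> // b' /(ce_init jC)[b'' <-] hb'.
  have : ~ sat pi (scons x v) phi by apply/R'P; exists b''.
  exact.
apply: contrapT => nx; have /R'P[b0 hb0] := nx.
case: hx => b [hb nb]; apply: nx; apply/RP.
have [h|h] := pselect (j b0 <= b); first by case: (nb _ h).
have [|b1 eb] := ce_init jC (x := b0) (y := b); first by pa NPA.
by exists b1; rewrite eb.
Qed.

End Delta1.

Lemma coded_D : exists D : coded j -> N -> Prop, forall A : coded j,
  definable1 (D A) /\ forall x, val A x <-> D A (j x).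
Proof.
have h (A : coded j) : exists D : N -> Prop, definable1 D /\ forall x, val A x <-> D (j x).
  by have [D [dD e]] := set_valP A; exists D; split=> // x; rewrite e.
by exists (fun A => projT1 (cid (h A))) => A; case: cid.
Qed.

Lemma coded_RCA : RCA0s (coded j).
Proof.
have [D DP] := coded_D.
have drho A : definable1 (D A) by case: (DP A).
have hrho A x : val A x <-> D A (j x) by case: (DP A).
split.
- split; first exact: ce_PA_minus.
  move=> phi v s0 h0 hS x.
  have bphi : bounded phi by inversion s0.
  have ab y : so_sat (scons y v) phi <-> sat D (scons (j y) (j \o v)) phi.
    by rewrite -ce_scons; exact: sat_bounded.
  suff key : forall y, y <= j x -> sat D (scons y (j \o v)) phi.
    by apply/ab; apply: key; exact: (pa_lexx HN).
  apply: (pa_ind NPA).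
  + have dphi : definable1 (fun y => sat D (scons y (j \o v)) phi).
      apply: definable_iff (@definable_sat _ _ _ drho phi
        (fun k e => if k is k'.+1 then j (v k') else e 0%N) _) => [e|[|k]]; try by dfn.
    by dfn; exact: dphi.
  + by move=> _; rewrite -(ce0 jC); apply/ab.
  move=> y IH yx; have [|z ez] := ce_init jC (x := x) (y := y); first by pa NPA.
  have hz : so_sat (scons z v) phi by apply/ab; rewrite ez; apply: IH; pa NPA.
  by have /ab := hS _ hz; rewrite (ceD jC) (ce1 jC) ez.
- move=> a; have [b eb] := ce_exp jC a.
  by exists b; apply/ce_pow2.
move=> A [phi [psi [v [sphi spsi -> e2]]]].
apply: (@Delta1_coded _ _ D) sphi spsi _ => // x.
by have : ([set x | so_sat (scons x v) phi] x <-> [set x | so_sat (scons x v) psi] x)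
  by rewrite e2.
Qed.

(** Overspill yields a sequence beyond the cut all of whose initial segments obey
    the definition of the tree; those in the cut form the path. *)
Lemma coded_WKL : WKL (coded j).
Proof.
move=> T [D [dD eT]] [Tseq Tini] Tunb.
have TD x : T x <-> D (j x) by rewrite eT.
clear eT.
pose Psi b := exists s, b <= s /\ (s <> 0 /\ forall t, iseg t s -> D t).
have dPsi : definable1 Psi by rewrite /Psi; dfn.
have [|c [hc hP]] := overspill dPsi.
  move=> b; have [s Ts bs] := Tunb b; exists (j s); split; first exact/(ce_le jC).
  split=> [s0|t ts].
    by apply: (Tseq _ Ts); apply: (ceI jC); rewrite s0 (ce0 jC).
  have [t' et] := ce_init jC (iseg_le NPA ts); rewrite -et in ts *.
  by apply/TD; apply: (Tini _ _ Ts); apply/ce_iseg.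
have [s [cs [s0 hs]]] := hP c (pa_lexx HN c).
exists [set t | iseg (j t) s]; split.
- by exists (fun t => iseg t s); split=> //; dfn.
- split; first split.
  + by move=> t /= [t0 _] e; apply: t0; rewrite e (ce0 jC).
  + by move=> t u /= ts /ce_iseg ut; exact: iseg_trans ut ts.
  + by move=> t /= ts; apply/TD; exact: hs.
  by move=> t u /= ts us; rewrite !ce_iseg; exact: iseg_comp ts us.
move=> a /=.
have [||t [[ts at'] tmin]] := pa_least NPA (P := fun t => iseg t s /\ j a <= t).
- by dfn.
- by exists s; split; [exact: iseg_refl|have h := hc a; pa NPA].
have [q [r [r2 et]]] := @pa_div _ NPA t (1 + 1) ltac:(pa NPA).
have tb : t <= j (a + a + 1).
  apply: contrapT => h; rewrite !(ceD jC) (ce1 jC) in h.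
  have q0 : q <> 0 by move=> q0; rewrite q0 in et; nn NPA (j a); pa NPA.
  have qt : iseg q t.
    have [d0 d1] := iseg_dbl NPA q0; have [r0|r0] := pselect (r = 0).
      by have -> : t = q + q by rewrite et r0; pa NPA.
    have -> // : t = q + q + 1.
    have : 1 <= r by apply: contrapT => h'; apply: r0; pa NPA.
    by move=> h'; pa NPA.
  have aq : j a <= q by pa NPA.
  have := tmin q (conj (iseg_trans NPA qt ts) aq) => h'; by nn NPA (j a); pa NPA.
have [t' et'] := ce_init jC tb.
exists t'; first by rewrite /= et'.
by apply/(ce_le jC); rewrite et'.
Qed.

(** Through the pairing, one subset of the cut codes a whole family of sets
    indexed by the cut. *)
Lemma coded_generated (Phi : nat -> N -> N -> Prop) : (forall n, definable2 (Phi n)) ->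
  (forall D, definable1 D -> exists n i, forall x, D x <-> Phi n x (j i)) ->
  so_generated nat (coded j).
Proof.
move=> dPhi hPhi.
pose A n : set S := [set z | exists x i, z = cpair x i /\ Phi n (j x) (j i)].
exists (range A); split.
- move=> _ [n _ <-]; exists (fun z => exists x i, z = cpair x i /\ Phi n x i).
  split; first by have dn := dPhi n; dfn.
  apply/seteqP; split=> z /=; first by move=> [x [i [-> h]]]; exists (j x), (j i); rewrite ce_cpair.
  move=> [x [i [ez h]]].
  have [x' ejx] := ce_init jC (x := z) (y := x) ltac:(rewrite ez; exact: (cpair_ge1 NPA)).
  have [i' ei] := ce_init jC (x := z) (y := i) ltac:(rewrite ez; exact: (cpair_ge2 NPA)).
  by exists x', i'; split; [apply: (ceI jC); rewrite ce_cpair ejx ei|rewrite ejx ei].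
- exact: card_image_le.
move=> _ [D [dD ->]]; have [n [i hn]] := hPhi D dD.
have An : (range A) (A n) by exists n.
pose phi : so_formula (range A) :=
  fmem (tadd (tmul (tadd (tvar 0) (tvar 1)) (tadd (tvar 0) (tvar 1))) (tvar 0))
       (exist _ (A n) (mem_set An)).
exists phi, phi, (fun=> i).
have E : [set x | D (j x)] = [set x | so_sat (scons x (fun=> i)) phi].
  apply/seteqP; split=> x /=; rewrite hn; first by exists x, i.
  move=> [x' [i' [e h]]].
  have e' : cpair (j x) (j i) = cpair (j x') (j i') by rewrite -!ce_cpair; congr j.
  by have [-> ->] := cpair_inj NPA e'.
by split=> //; [apply: Sigma_Pi; exact: Pi_bounded|apply: Pi_Sigma; exact: Sigma_bounded].
Qed.

End Cut.

(** * Closure properties of a model of WKL0* over a cut *)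

Section Forcing.
Variables (S M : structure) (MPA : PA M) (j : S -> M).
Hypothesis jC : cut_emb j.
Variable X : set (set S).
Hypotheses (codX : coded j `<=` X) (XW : WKL0s X).
Local Open Scope arith_scope.
Notation HM := (proj1 MPA).

Let XR : RCA0s X := proj1 XW.

Let sym (A : set S) (XA : X A) : X := exist _ A (mem_set XA).

Let pairt (s t : term) := tadd (tmul (tadd s t) (tadd s t)) s.

Lemma X_bounded (phi : so_formula X) v : bounded phi ->
  X [set x | so_sat (scons x v) phi].
Proof.
move=> bphi; case: XR => _ _; apply; exists phi, phi, v; split=> //.
  by apply: Sigma_Pi; exact: Pi_bounded.
by apply: Pi_Sigma; exact: Sigma_bounded.
Qed.

Lemma X_rel (R : M -> M -> Prop) : definable2 R ->
  exists W, X W /\ forall x y, W (cpair x y) <-> R (j x) (j y).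
Proof.
move=> dR; exists [set z | exists x y, j z = cpair x y /\ R x y]; split.
  by apply: codX; exists (fun z => exists x y, z = cpair x y /\ R x y); split=> //; dfn.
move=> x y; rewrite /= (ce_cpair jC); split=> [[x' [y' [e h]]]|h].
  by have [-> ->] := cpair_inj MPA e.
by exists (j x), (j y).
Qed.

Let S_le_pr1 (x y : S) : x <= cpair x y.
Proof. by apply/(ce_le jC); rewrite (ce_cpair jC); exact: (cpair_ge1 MPA). Qed.

Let S_le_pr2 (x y : S) : y <= cpair x y.
Proof. by apply/(ce_le jC); rewrite (ce_cpair jC); exact: (cpair_ge2 MPA). Qed.

Let S_max (x y : S) : exists z, x <= z /\ y <= z.
Proof. by exists (cpair x y). Qed.

Lemma X_prod A B : X A -> X B ->
  X [set z | exists x y, [/\ z = cpair x y, A x & B y]].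
Proof.
move=> XA XB; pose phi : so_formula X := fbex (tvar 0) (fbex (tvar 1)
  (fand (feq (tvar 2) (pairt (tvar 1) (tvar 0)))
        (fand (fmem (tvar 1) (sym XA)) (fmem (tvar 0) (sym XB))))).
have := @X_bounded phi (fun=> 0) (conj I (conj I I)); congr X.
apply/seteqP; split=> z /=.
  by move=> [x [xz [y [yz [ez [Ax By]]]]]]; exists x, y.
move=> [x [y [-> Ax By]]]; exists x; split; first exact: S_le_pr1.
by exists y; split; first exact: S_le_pr2.
Qed.

Lemma X_guard B W : X B -> X W ->
  X [set s | s <> 0 /\ forall t, t <= s -> B t -> W (cpair t s)].
Proof.
move=> XB XC; pose phi : so_formula X := fand (fnot (feq (tvar 0) tzero))
  (fball (tvar 0) (for_ (fnot (fmem (tvar 0) (sym XB)))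
     (fmem (pairt (tvar 0) (tvar 1)) (sym XC)))).
have := @X_bounded phi (fun=> 0) (conj I (conj I I)); congr X.
apply/seteqP; split=> s /= [s0 h]; split=> // t ts.
  by case: (h t ts).
by have [/(h t ts)|] := pselect (B t); [right|left].
Qed.

(** * Paths *)

(** A path through a tree of binary sequences, independently of the tree. *)
Definition chain (B : set S) : Prop :=
  [/\ forall s, B s -> s <> 0, unbounded B
    & forall s t, B s -> B t -> iseg (j s) (j t) \/ iseg (j t) (j s)].

Lemma WKL_chain T : X T -> (forall s, T s -> s <> 0) ->
  (forall s t, T s -> iseg (j t) (j s) -> T t) -> unbounded T ->
  exists B, [/\ X B, chain B & B `<=` T].
Proof.
move=> XT T0 Tini Tunb; have [|B [XB [[Bseq _] BT Bc] Bu]] := proj2 XW T XT _ Tunb.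
  by split=> // s t Ts /(ce_iseg MPA jC); exact: Tini.
exists B; split=> //; split=> // s t Bs Bt.
by case: (Bc _ _ Bs Bt) => /(ce_iseg MPA jC); [left|right].
Qed.

Lemma chain_le B s t : chain B -> B s -> B t -> s <= t -> iseg (j s) (j t).
Proof.
move=> [_ _ Bc] Bs Bt /(ce_le jC) st; case: (Bc _ _ Bs Bt) => // ts.
have -> : j s = j t by apply: (pa_le_anti HM st); exact: (iseg_le MPA ts).
by apply: (iseg_refl MPA); case: ts.
Qed.

Lemma chain_above B s u : chain B -> B s -> exists2 t, B t & u <= t /\ iseg (j s) (j t).
Proof.
move=> cB Bs; have [z [uz sz]] := S_max u s; have [_ Bu _] := cB.
have [t Bt zt] := Bu z; exists t => //.
have le3 x : x <= z -> x <= t.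
  by move=> /(ce_le jC) xz; apply/(ce_le jC); apply: (pa_le_trans HM xz); apply/(ce_le jC).
by split; [exact: le3|apply: (chain_le cB) => //; exact: le3].
Qed.

Lemma chain_long B k : chain B -> exists s n, [/\ B s, has_len (j s) n & j k < n].
Proof.
move=> [B0 Bu _]; have [v ev] := ce_exp jC (k + 1).
have [s Bs vs] := Bu v; have [n hn] : exists n, has_len (j s) n.
  by apply: (len_total MPA) => e; apply: (B0 _ Bs); apply: (ceI jC); rewrite e (ce0 jC).
exists s, n; split=> //; apply/(pa_leNgt MPA) => nk.
have h := exp2_mono MPA nk; case: hn => _ hs; move/(ce_le jC): vs.
by rewrite ev (ceD jC) (ce1 jC) (exp2S MPA) => vs; pa MPA.
Qed.

Lemma chain_bit1 B s t n k : chain B -> B s -> B t -> has_len (j s) n -> k < n ->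
  bit1 k (j t) -> bit1 k (j s).
Proof.
move=> [_ _ Bc] Bs Bt sn kn h; case: (bit_total MPA sn kn) => // h0.
case: (Bc _ _ Bs Bt) => hc; last exact: (bit1_iseg MPA h hc).
by case: (bit_excl MPA h (bit0_iseg MPA h0 hc)).
Qed.

(** The limit of a chain is Delta_1 in the chain: some member has the bit 1, or
    no member has the bit 0. *)
Lemma X_bits B : X B -> chain B -> X [set k | exists2 s, B s & bit1 (j k) (j s)].
Proof.
move=> XB cB.
have d1 : definable2 (@bit1 M) by dfn.
have d0 : definable2 (@bit0 M) by dfn.
have [W1 [XW1 W1E]] := X_rel d1; have [W0 [XW0 W0E]] := X_rel d0.
pose phi : so_formula X := fex (fand (fmem (tvar 0) (sym XB))
  (fmem (pairt (tvar 1) (tvar 0)) (sym XW1))).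
pose psi : so_formula X := fall (fnot (fand (fmem (tvar 0) (sym XB))
  (fmem (pairt (tvar 1) (tvar 0)) (sym XW0)))).
case: XR => _ _; apply; exists phi, psi, (fun=> 0); split.
- by apply: Sigma_ex; apply: Sigma_Pi; exact: Pi_bounded.
- by apply: Pi_all; apply: Pi_Sigma; exact: Sigma_bounded.
- apply/seteqP; split=> k /=.
    by move=> [s Bs h]; exists s; split=> //; apply/W1E.
  by move=> [s [Bs /W1E h]]; exists s.
apply/seteqP; split=> k /=.
  move=> [s Bs h] t [Bt /W0E h0].
  have [u Bu [tu su]] := chain_above t cB Bs.
  case: (cB) => _ _ Bc; case: (Bc _ _ Bs Bt) => hc.
    exact: (bit_excl MPA (bit1_iseg MPA h hc) h0).
  exact: (bit_excl MPA h (bit0_iseg MPA h0 hc)).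
move=> h; have [s [n [Bs sn kn]]] := chain_long k cB.
exists s => //; case: (bit_total MPA sn kn) => // h0.
by case: (h s); split=> //; apply/W0E.
Qed.

(** Bounded induction provides an approximation of each length to the
    characteristic function of [A], and weak Koenig's lemma a chain of them; the
    chain makes the initial parts of [A] available as numbers. *)
Lemma chain_of_set A : X A -> exists B, [/\ X B, chain B &
  forall s k, B s -> (bit1 (j k) (j s) -> A k) /\ (bit0 (j k) (j s) -> ~ A k)].
Proof.
move=> XA.
have d1 : definable2 (@bit1 M) by dfn.
have d0 : definable2 (@bit0 M) by dfn.
have dl : definable2 (@has_len M) by dfn.
have [W1 [XW1 W1E]] := X_rel d1; have [W0 [XW0 W0E]] := X_rel d0.
have [L [XL LE]] := X_rel dl.
pose T : set S := [set s | s <> 0 /\ forall k, (bit1 (j k) (j s) -> A k) /\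
                                                (bit0 (j k) (j s) -> ~ A k)].
have bit_le k s : (exists t, has_len t (j k) /\ t <= j s) -> k <= s.
  by move=> [t [/(len_le MPA) h h']]; apply/(ce_le jC); exact: (pa_le_trans HM h).
have bit1_le k s : bit1 (j k) (j s) -> k <= s.
  by move=> [t [tk /(iseg_le MPA) h]]; apply: bit_le; exists t; split=> //; nn MPA (j s); pa MPA.
have bit0_le k s : bit0 (j k) (j s) -> k <= s.
  by move=> [t [tk /(iseg_le MPA) h]]; apply: bit_le; exists t; split=> //; nn MPA (j s); pa MPA.
have XT : X T.
  pose phi : so_formula X := fand (fnot (feq (tvar 0) tzero)) (fball (tvar 0)
    (fand (for_ (fnot (fmem (pairt (tvar 0) (tvar 1)) (sym XW1))) (fmem (tvar 0) (sym XA)))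
          (for_ (fnot (fmem (pairt (tvar 0) (tvar 1)) (sym XW0)))
                (fnot (fmem (tvar 0) (sym XA)))))).
  have := @X_bounded phi (fun=> 0) (conj I (conj (conj I I) (conj I I))); congr X.
  apply/seteqP; split=> s /= [s0 h]; split=> // k.
    split=> hk.
      by have [h1 _] := h k (bit1_le _ _ hk); case: h1 => // h1; case: h1; apply/W1E.
    by have [_ h1] := h k (bit0_le _ _ hk); case: h1 => // h1; case: h1; apply/W0E.
  move=> ks; have [h1 h2] := h k; split.
    by have [/h1|n] := pselect (bit1 (j k) (j s)); [right|left => /W1E].
  by have [/h2|n] := pselect (bit0 (j k) (j s)); [right|left => /W0E].
have jT s : s <> 0 <-> j s <> 0.
  by rewrite -(ce0 jC); split=> h e; apply: h; [exact: (ceI jC)|rewrite e].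
have Tini s t : T s -> iseg (j t) (j s) -> T t.
  move=> [s0 h] ts; split; first by apply/jT; case: ts.
  move=> k; have [h1 h2] := h k; split=> hk.
    by apply: h1; exact: (bit1_iseg MPA hk ts).
  by apply: h2; exact: (bit0_iseg MPA hk ts).
have Tlen n : exists s, T s /\ has_len (j s) (j n).
  have [u eu] := ce_exp jC (n + 1).
  have key : forall k, ~ k <= n \/ exists s, s <= u /\ (L (cpair s k) /\ T s).
    pose phi : so_formula X := for_ (fnot (fle (tvar 0) (tvar 1)))
      (fbex (tvar 2) (fand (fmem (pairt (tvar 0) (tvar 1)) (sym XL))
                           (fmem (tvar 0) (sym XT)))).
    pose v := scons n (fun=> u).
    case: XR => -[_ ind] _ _.
    apply: (ind phi v); first by apply: Sigma_bounded; split.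
      right; exists 1; split.
        apply/(ce_le jC); rewrite eu (ce1 jC); have h := exp2_gt0 MPA (j (n + 1)).
        by nn MPA (exp2 (j (n + 1))); pa MPA.
      split.
        by apply/LE; rewrite (ce0 jC) (ce1 jC) /has_len (exp2_0 MPA); split; pa MPA.
      split=> [e|k].
        by have := pa_lt01 HM; rewrite -(ce0 jC) -(ce1 jC) -e => -[_]; apply.
      split=> -[t [tk /(iseg_le MPA)]]; rewrite (ce1 jC) => h; exfalso.
        have t1 : 1 <= t by apply: contrapT => n1; apply: (len_neq0 MPA tk); pa MPA.
        by pa MPA.
        have t1 : 1 <= t by apply: contrapT => n1; apply: (len_neq0 MPA tk); pa MPA.
        by pa MPA.
    move=> k [nk|[s [_ [/LE sk0 Ts0]]]].
      left=> h; apply: nk; apply/(ce_le jC); move/(ce_le jC): h.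
      by rewrite (ceD jC) (ce1 jC) => h; nn MPA (j k); pa MPA.
    have [kn|kn] := pselect (k + 1 <= n); last by left.
    have sk : has_len (j s) (j k) := sk0; have Ts : T s := Ts0; clear sk0 Ts0.
    right; pose s' := if pselect (A k) is left _ then s + s + 1 else s + s.
    have js' : (A k /\ j s' = j s + j s + 1) \/ (~ A k /\ j s' = j s + j s).
      by rewrite /s'; case: pselect => h; [left|right]; rewrite !(ceD jC, ce1 jC).
    have [l0 l1] := len_dbl MPA sk.
    have s'k : has_len (j s') (j (k + 1)).
      by rewrite (ceD jC) (ce1 jC); case: js' => -[_ ->].
    have s0 : j s <> 0 by exact: (len_neq0 MPA sk).
    suff Ts' : T s'.
      exists s'; split; last by split; first exact/LE.
      apply/(ce_le jC); rewrite eu; case: s'k => _ h; have {}kn := proj1 (ce_le jC _ _) kn.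
      have := exp2_mono MPA kn; rewrite (ceD jC n 1) (ce1 jC) (exp2S MPA) => h'.
      by pa MPA.
    split=> [|i]; first by apply/jT; exact: (len_neq0 MPA s'k).
    have cases t : iseg t (j s') -> [\/ t = j s + j s, t = j s + j s + 1 | iseg t (j s)].
      by move=> h; apply: (iseg_step MPA); case: js' => -[_ e]; rewrite -e; [right|left].
    have [_ Tb] := Ts; have [h1 h2] := Tb i.
    have lastbit t : has_len t (j i) -> t = j s -> i = k.
      by move=> ti et; apply: (ceI jC); apply: (len_uniq MPA ti); rewrite et.
    split=> -[t [ti ts]].
    - case: (cases _ ts) => h.
      + exfalso; have [h'|h'] := pselect (t + 1 <= j s); by pa MPA.
      + have et : t = j s by pa MPA.
        rewrite (lastbit t ti et); case: js' => -[] // nA es; exfalso.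
        rewrite es in ts; have := iseg_le MPA ts; rewrite et => h3; by pa MPA.
      + by apply: h1; exists t.
    - case: (cases _ ts) => h.
      + have et : t = j s by pa MPA.
        rewrite (lastbit t ti et); case: js' => -[] // hA es; exfalso.
        rewrite es et in ts; have := iseg_same MPA ts l0 l1 => h3; by pa MPA.
      + exfalso; have [h'|h'] := pselect (j s + 1 <= t); nn MPA (j s); by pa MPA.
      + by apply: h2; exists t.
  have [h|[s [_ [/LE sn Ts]]]] := key n; last by exists s.
  by case: h; apply/(ce_le jC); exact: (pa_lexx HM).
have Tunb : unbounded T.
  move=> a; have [s [Ts sa]] := Tlen a; exists s => //; apply/(ce_le jC).
  exact: (len_le MPA sa).
have [B [XB cB BT]] := WKL_chain XT (fun s Ts => proj1 Ts) Tini Tunb.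
by exists B; split=> // s k /BT[_ h].
Qed.

End Forcing.

(** * Conditions *)

Section Conditions.
Variables (S M : structure) (MPA : PA M) (j : S -> M).
Hypothesis jC : cut_emb j.
Variable X : set (set S).
Hypotheses (codX : coded j `<=` X) (XW : WKL0s X).
Variable b : M.
Local Open Scope arith_scope.
Notation HM := (proj1 MPA).

(** A condition restricts the type of the generator [x] by requiring [part C x] to
    lie in all the sets [nbhd C t] for [t] in [track C], which shrink as [t] grows
    through the cut.  No value of [part C] is fixed by this inside the model, but
    every [nbhd C t] contains one whose fibre below [b] has at least
    [exp2 (room C)] elements; as [room C] lies above the cut, the space needed by
    later conditions is never used up. *)
Record condition := Cond {
  part : M -> M;
  nbhd : M -> M -> Prop;
  room : M;
  track : set S;
  part_def : fdefinable1 part;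
  nbhd_def : definable2 nbhd;
  room_cut : forall x, j x < room;
  track_X : X track;
  nbhd_dir : forall i, exists t0, track t0 /\
    forall t, track t -> t <= i -> forall y, nbhd (j t0) y -> nbhd (j t) y;
  nbhd_large : forall t, track t -> exists y,
    nbhd (j t) y /\ exp2 room <= ncount (fun z => part z = y) b }.

Definition cell (C : condition) (t : S) : set M :=
  [set x | x < b /\ nbhd C (j t) (part C x)].

Definition refines (C C' : condition) : Prop :=
  forall t, track C t -> exists t', track C' t' /\ cell C' t' `<=` cell C t.

(** On each initial part of the cut, some cell of the condition lies within the
    [x] for which [Phi x] agrees with [A] there. *)
Definition decides (C : condition) (Phi : M -> M -> Prop) (A : set S) : Prop :=
  forall k, exists t, track C t /\
    forall i, i <= k -> forall x, cell C t x -> (Phi x (j i) <-> A i).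

Lemma refines_refl C : refines C C.
Proof. by move=> t Ct; exists t; split. Qed.

Lemma refines_trans C C' C'' : refines C C' -> refines C' C'' -> refines C C''.
Proof.
move=> h h' t /h[t' [Ct' s]]; have [t'' [Ct'' s']] := h' _ Ct'.
by exists t''; split=> // x /s' /s.
Qed.

Lemma refines_decides C C' Phi A : refines C C' -> decides C Phi A -> decides C' Phi A.
Proof.
move=> CC' d k; have [t [Ct h]] := d k; have [t' [Ct' s]] := CC' t Ct.
by exists t'; split=> // i ik x /s; exact: h.
Qed.

Let S_ub (x y : S) : exists z, x <= z /\ y <= z.
Proof.
by exists (cpair x y); split; apply/(ce_le jC); rewrite (ce_cpair jC);
  [exact: (cpair_ge1 MPA)|exact: (cpair_ge2 MPA)].
Qed.

Lemma cell_dir C t1 t2 : track C t1 -> track C t2 ->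
  exists t, track C t /\ cell C t `<=` cell C t1 `&` cell C t2.
Proof.
move=> h1 h2; have [z [z1 z2]] := S_ub t1 t2.
have [t [Ct h]] := nbhd_dir C z; exists t; split=> // x [xb hx].
by split; split=> //; exact: h hx.
Qed.

Lemma track_neq0 C : exists t, track C t.
Proof. by have [t [Ct _]] := nbhd_dir C (0 : S); exists t. Qed.

Lemma cell_two C t m : track C t -> exists x, cell C t x /\ x <> m.
Proof.
move=> /(nbhd_large)[y [hy large]].
have dp : definable1 (fun z => part C z = y) by have := part_def C => dq; dfn.
have [|x [xb ejx xm]] := @ncount_two _ MPA _ b m dp.
  apply: (pa_le_trans HM _ large); have h := room_cut C 0.
  have := exp2_mono MPA (proj1 (pa_ltS MPA _ _) h).
  rewrite (ce0 jC) (exp2S MPA) (exp2_0 MPA) => h'; by pa MPA.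
by exists x; split=> //; split=> //; rewrite ejx.
Qed.

Lemma condition_start c0 : b = exp2 c0 -> (forall x, j x < c0) -> exists C : condition, True.
Proof.
move=> eb c0S; unshelve eexists (@Cond (fun=> 0) (fun _ _ => True) c0 setT
  ltac:(dfn) ltac:(dfn) c0S _ _ _) => //.
- by apply: codX; exists (fun=> True); split; [dfn|apply/seteqP; split].
- by move=> i; exists i.
move=> t _; exists 0; split=> //.
have -> : ncount (fun=> 0 = 0 :> M) b = b.
  by rewrite -[RHS](ncount_True MPA b); congr ncount; apply/funext => z; apply/propext.
by rewrite eb; exact: (pa_lexx HM).
Qed.

(** Refining the partition by a function [s] valued in binary sequences, and
    following a chain of such sequences. *)
Lemma condition_extend C (s : M -> M) c' B' : fdefinable1 s -> (forall x, j x < c') ->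
  X B' -> chain j B' ->
  (forall t u, track C t -> B' u -> exists y s0, nbhd C (j t) y /\
     (iseg (j u) s0 /\ exp2 c' <= ncount (fun z => part C z = y /\ s z = s0) b)) ->
  exists C', refines C C' /\ forall t u, track C t -> B' u ->
    exists t', track C' t' /\ forall x, cell C' t' x -> cell C t x /\ iseg (j u) (s x).
Proof.
move=> ds c'S XB' cB' large.
have dg := part_def C; have dn := nbhd_def C.
pose R' z w := exists t u y s0, z = cpair t u /\ (w = cpair y s0 /\ (nbhd C t y /\ iseg u s0)).
pose B'' : set S := [set z | exists t u, [/\ z = cpair t u, track C t & B' u]].
have R'E t u y s0 : R' (cpair t u) (cpair y s0) <-> nbhd C t y /\ iseg u s0.
  split=> [[t' [u' [y' [s' [e1 [e2 h]]]]]]|h]; last by exists t, u, y, s0.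
  have [-> ->] := cpair_inj MPA e1; by have [-> ->] := cpair_inj MPA e2.
have dg' : fdefinable1 (fun x => cpair (part C x) (s x)) by dfn.
have dR' : definable2 R' by rewrite /R'; dfn.
have XB'' : X B'' by apply: (X_prod MPA jC XW) => //; exact: track_X.
unshelve epose (C' := @Cond _ R' c' B'' dg' dR' c'S XB'' _ _).
- move=> i; have [t0 [Ct0 h0]] := nbhd_dir C i.
  have [_ Bu _] := cB'; have [u0 Bu0 iu0] := Bu i.
  exists (cpair t0 u0); split; first by exists t0, u0.
  move=> _ [t [u [-> Ct Bu']]] /(ce_le jC); rewrite (ce_cpair jC) => tui w.
  rewrite !(ce_cpair jC) => -[t' [u' [y [s0 [e1 [-> [hy hs]]]]]]].
  have [et eu] := cpair_inj MPA e1; rewrite -et -eu in hy hs.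
  apply/R'E; split.
    apply: h0 hy => //; apply/(ce_le jC).
    exact: (pa_le_trans HM (cpair_ge1 MPA _ _) tui).
  apply: (iseg_trans MPA) hs; apply: (chain_le MPA jC cB') => //.
  apply/(ce_le jC); apply: (pa_le_trans HM (cpair_ge2 MPA _ _)).
  exact: (pa_le_trans HM tui (proj1 (ce_le jC _ _) iu0)).
- move=> _ [t [u [-> Ct Bu]]]; have [y [s0 [hy [hs l]]]] := large t u Ct Bu.
  exists (cpair y s0); split; first by rewrite (ce_cpair jC); apply/R'E.
  apply: (pa_le_trans HM l); apply: (ncount_le MPA) => [||z _ [-> ->]] //; by dfn.
have key t u x : cell C' (cpair t u) x -> cell C t x /\ iseg (j u) (s x).
  by rewrite /cell /= (ce_cpair jC) => -[xb /R'E[]].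
exists C'; split=> [t Ct|t u Ct Bu]; last first.
  by exists (cpair t u); split; [exists t, u|move=> x /key].
have [_ Bu _] := cB'; have [u Bu0 _] := Bu 0.
by exists (cpair t u); split; [exists t, u|move=> x /key[]].
Qed.

Let halve c : (forall x, j x < c) -> exists h, (forall x, j x < h) /\ h + h <= c.
Proof.
move=> cS; have [h [r [r2 e]]] := @pa_div _ MPA c (1 + 1) ltac:(pa MPA).
exists h; split=> [x|]; last by pa MPA.
have := cS (x + x + 1); rewrite !(ceD jC) (ce1 jC) => hx; by pa MPA.
Qed.

(* The fibre splits at each bit of s; following the larger half keeps the size
   above 2^(h + h - k) at the sequence of length k. *)
Let split_large (g s : M -> M) y h : fdefinable1 g -> fdefinable1 s -> (forall z, has_len (s z) h) ->
  exp2 (h + h) <= ncount (fun z => g z = y) b ->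
  exists s0, has_len s0 h /\ exp2 h <= ncount (fun z => g z = y /\ s z = s0) b.
Proof.
move=> dg ds sl large.
have key : forall k, k <= h -> exists u, has_len u k /\
    exp2 (h + h) <= ncount (fun z => g z = y /\ iseg u (s z)) b * exp2 k.
  apply: (pa_ind MPA); first by dfn.
    move=> _; exists 1; split; first by rewrite /has_len (exp2_0 MPA); split; pa MPA.
    rewrite (exp2_0 MPA) (pa_mulx1 HM); apply: (pa_le_trans HM large).
    apply: (ncount_le MPA) => [||z _ gz]; [by dfn..|split=> //].
    have [t [ts t0]] := iseg_len MPA (sl z) (pa_le0x HM h).
    suff <- : t = 1 by [].
    by case: t0; rewrite (exp2_0 MPA) => h1 h2; pa MPA.
  move=> k IH kh; have [u [uk hu]] : exists u, has_len u k /\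
      exp2 (h + h) <= ncount (fun z => g z = y /\ iseg u (s z)) b * exp2 k.
    by apply: IH; pa MPA.
  have [l0 l1] := len_dbl MPA uk.
  have : ncount (fun z => g z = y /\ iseg u (s z)) b <=
      ncount (fun z => g z = y /\ iseg (u + u) (s z)) b +
      ncount (fun z => g z = y /\ iseg (u + u + 1) (s z)) b.
    apply: (ncount_cover MPA) => [|||z _ [gz us]]; [by dfn..|].
    have [h1|h1] : iseg (u + u) (s z) \/ iseg (u + u + 1) (s z); [|by left|by right].
    apply: (iseg_next MPA us) => e; rewrite e in uk.
    have := len_uniq MPA uk (sl z) => ek; by pa MPA.
  set a := ncount _ b in hu *; set p := ncount _ b; set q := ncount _ b => apq.
  have half (r : M) : a <= r + r -> exp2 (h + h) <= r * exp2 (k + 1).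
    move=> ar; apply: (pa_le_trans HM hu).
    have h1 := pa_leM MPA ar (pa_lexx HM (exp2 k)); rewrite (exp2S MPA).
    by nn MPA r; pa MPA.
  case: (pa_le_total HM p q) => pq.
    exists (u + u + 1); split=> //; apply: half; pa MPA.
  by exists (u + u); split=> //; apply: half; pa MPA.
have [u [uh hu]] := key h (pa_lexx HM h); exists u; split=> //.
have hu' : exp2 (h + h) <= ncount (fun z => g z = y /\ s z = u) b * exp2 h.
  apply: (pa_le_trans HM hu); apply: (pa_leM MPA) (pa_lexx HM _).
  apply: (ncount_le MPA) => [||z _ [gz us]]; [by dfn..|split=> //].
  exact/esym/(iseg_same MPA us uh (sl z)).
rewrite (exp2D MPA) in hu'; apply: contrapT => /(pa_leNgt MPA)/(pa_ltS MPA) n.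
have h1 := pa_leM MPA n (pa_lexx HM (exp2 h)); have h2 := exp2_gt0 MPA h.
by pa MPA.
Qed.

(** The sequences of truth values of [Phi x i], for small [i], that occur near every
    [t] on large enough fibres form a tree in the family, which is unbounded by the
    pigeonhole principle; weak Koenig's lemma provides a path, and all [i] in the
    cut are decided at once. *)
Lemma condition_decide C (Phi : M -> M -> Prop) : definable2 Phi ->
  exists C' A, [/\ X A, refines C C' & decides C' Phi A].
Proof.
move=> dPhi; have [h [hS hc]] := halve (room_cut C).
have dg := part_def C; have dn := nbhd_def C.
pose s x := truth_code (Phi x) h.
have ds : fdefinable1 s by rewrite /s; dfn.
have dPx x : definable1 (Phi x) by dfn.
have sl x : has_len (s x) h by exact: truth_code_len.
pose W0 t u := exists y s0, nbhd C t y /\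
  (iseg u s0 /\ exp2 h <= ncount (fun z => part C z = y /\ s z = s0) b).
have dW0 : definable2 W0 by rewrite /W0; dfn.
have [W [XW' WE]] := X_rel MPA jC codX dW0.
have W0_iseg t u u' : iseg u u' -> W0 t u' -> W0 t u.
  move=> uu' [y [s0 [hy [us l]]]]; exists y, s0; split=> //; split=> //.
  exact: (iseg_trans MPA uu' us).
pose T := [set u | u <> 0 /\ forall t, t <= u -> track C t -> W (cpair t u)].
have XT : X T by apply: (X_guard XW) => //; exact: track_X.
have [B' [XB' cB' B'T]] : exists B', [/\ X B', chain j B' & B' `<=` T].
  apply: (WKL_chain MPA jC XW XT) => [u [u0 _]|u v [u0 hu] vu|a]; first exact: u0.
    split=> [e|t tv Ct]; first by case: vu; rewrite e (ce0 jC).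
    apply/WE; apply: (W0_iseg _ _ _ vu); apply/WE; apply: hu => //.
    apply/(ce_le jC); apply: (pa_le_trans HM _ (iseg_le MPA vu)).
    exact/(ce_le jC).
  have [w ew] := ce_exp jC (a + 1).
  have [t0 [Ct0 ht0]] := nbhd_dir C w.
  have [y [hy large]] := nbhd_large Ct0.
  have large' : exp2 (h + h) <= ncount (fun z => part C z = y) b.
    exact: (pa_le_trans HM (exp2_mono MPA hc) large).
  have [s0 [s0l l]] := split_large dg ds sl large'.
  have [v [vs va]] := iseg_len MPA s0l (proj1 (hS a)).
  have vw : v <= j w.
    by case: va => _; rewrite ew (ceD jC) (ce1 jC) (exp2S MPA) => -[].
  have [u eu] := ce_init jC vw; rewrite -eu in vs va vw.
  exists u; last by apply/(ce_le jC); exact: (len_le MPA va).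
  split=> [e|t tu Ct]; first by case: vs; rewrite e (ce0 jC).
  apply/WE; exists y, s0; split=> //; apply: ht0 hy => //.
  by apply/(ce_le jC); apply: (pa_le_trans HM _ vw); apply/(ce_le jC).
have [t u Ct Bu|C' [CC' hC']] := @condition_extend C s h B' ds hS XB' cB'.
  have [v Bv [tv uv]] := chain_above MPA jC t cB' Bu.
  have [_ /(_ t tv Ct)/WE] := B'T v Bv; exact: W0_iseg.
exists C', [set k | exists2 u, B' u & bit1 (j k) (j u)]; split=> //.
  exact: (X_bits MPA jC codX XW XB' cB').
move=> k; have [u [n [Bu un kn]]] := chain_long MPA jC k cB'.
have [t Ct] := track_neq0 C; have [t' [Ct' ht']] := hC' t u Ct Bu.
exists t'; split=> // i /(ce_le jC) ik x /ht'[_ ux].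
have lt_in : j i < n by pa MPA.
have ih : j i < h by exact: hS.
rewrite -(truth_code_bit MPA (dPx x) ih) -/(s x); split=> [hx|[v Bv hv]].
  exists u => //; case: (bit_total MPA un lt_in) => // h0.
  by case: (bit_excl MPA hx (bit0_iseg MPA h0 ux)).
apply: (bit1_iseg MPA _ ux).
exact: (chain_bit1 MPA cB' Bu Bv un lt_in hv).
Qed.

(** The position of [x] within its fibre is steered along the chain for [A], which
    divides the size of the fibres by a power of 2 that leaves enough room; [A] is
    then read off from this position in the extension. *)
Lemma condition_code C A : X A ->
  exists C' Psi, [/\ definable2 Psi, refines C C' & decides C' Psi A].
Proof.
move=> XA; have [h [hS hc]] := halve (room_cut C).
have dg := part_def C; have dn := nbhd_def C.
have [B' [XB' cB' B'A]] := chain_of_set MPA jC codX XW XA.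
pose pos x := ncount (fun z => part C z = part C x) x.
have dpos : fdefinable1 pos by rewrite /pos; dfn.
have div_ex x : exists q r, r < exp2 h /\ exp2 (h + h) + pos x = q * exp2 h + r.
  exact: (pa_div MPA _ (exp2_gt0 MPA h)).
pose s x := the_elt (fun q => exists r, r < exp2 h /\ exp2 (h + h) + pos x = q * exp2 h + r).
have sP x : exists r, r < exp2 h /\ exp2 (h + h) + pos x = s x * exp2 h + r.
  by rewrite /s; apply: (the_eltP (div_ex x)).
have ds : fdefinable1 s.
  apply: (@fdefinable_graph _ _ (fun q e => exists r, r < exp2 h /\
    exp2 (h + h) + pos (e 0%N) = q * exp2 h + r)) => [|e|e q [r [rh e1]]]; first by dfn.
    exact: sP.
  have [r' [r'h e2]] := sP (e 0%N).
  by rewrite e1 in e2; have [] := div_uniq MPA rh r'h e2.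
have [t u Ct Bu|C' [CC' hC']] := @condition_extend C s h B' ds hS XB' cB'.
  have [y [hy large]] := nbhd_large Ct; exists y.
  have [n un] : exists n, has_len (j u) n by apply: (len_total MPA); case: cB' => + _ _ => /(_ _ Bu) u0 e; apply: u0; apply: (ceI jC); rewrite e (ce0 jC).
  have [m em] : exists m, n + m = h.
    apply: (Defs.pa_le_sub MPA); apply: (pa_le_trans HM (len_le MPA un)).
    by case: (hS u).
  have s0l : has_len (j u * exp2 m) h.
    case: un => l1 l2; rewrite /has_len -em (exp2D MPA).
    have h1 := pa_leM MPA l1 (pa_lexx HM (exp2 m)).
    have h2 := pa_leM MPA (proj1 (pa_ltS MPA _ _) l2) (pa_lexx HM (exp2 m)).
    by have h3 := exp2_gt0 MPA m; split; pa MPA.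
  have [s0 es0] : exists s0, s0 = j u * exp2 m by exists (j u * exp2 m).
  rewrite -es0 in s0l; exists s0; split=> //; split.
    split; first by move=> e; move: un => /(len_neq0 MPA).
    by exists m, 0; rewrite es0; split; [exact: exp2_gt0|pa MPA].
  case: (s0l) => l1 l2.
  have h1 := pa_leM MPA l1 (pa_lexx HM (exp2 h)); rewrite -(exp2D MPA) in h1.
  have h2 := pa_leM MPA (proj1 (pa_ltS MPA _ _) l2) (pa_lexx HM (exp2 h)).
  have [u0 eu0] := Defs.pa_le_sub MPA h1.
  have dp : definable1 (fun z => part C z = y) by dfn.
  have ul : u0 + exp2 h <= ncount (fun z => part C z = y) b.
    apply: (pa_le_trans HM _ (pa_le_trans HM (exp2_mono MPA hc) large)).
    by have e2 := exp2D MPA h h; pa MPA.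
  apply: (pa_le_trans HM (ncount_slice MPA dp ul)).
  apply: (ncount_le MPA) => [||z _ [gz [lo hi]]]; [by dfn..|split=> //].
  have [r [rh er]] := sP z.
  have ez : pos z = ncount (fun z' => part C z' = y) z by rewrite /pos gz.
  have [r' er'] := Defs.pa_le_sub MPA lo.
  rewrite -ez in er' hi.
  have r'h : r' < exp2 h by pa MPA.
  have e3 : s z * exp2 h + r = s0 * exp2 h + r'.
    by rewrite -er -eu0 -er'; pa MPA.
  by have [] := div_uniq MPA rh r'h e3.
exists C', (fun x k => bit1 k (s x)); split=> //; first by dfn.
move=> k; have [u [n [Bu un kn]]] := chain_long MPA jC k cB'.
have [t Ct] := track_neq0 C; have [t' [Ct' ht']] := hC' t u Ct Bu.
exists t'; split=> // i /(ce_le jC) ik x /ht'[_ ux].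
have lt_in : j i < n by pa MPA.
have [A1 A0] := B'A u i Bu; split=> [hx|hA].
  case: (bit_total MPA un lt_in) => // h0.
  by case: (bit_excl MPA hx (bit0_iseg MPA h0 ux)).
apply: (bit1_iseg MPA _ ux); case: (bit_total MPA un lt_in) => // h0.
by case: (A0 h0).
Qed.

End Conditions.

(** * Ultrapowers by definable functions *)

Section Ultrapower.
Variables (M : structure) (MPA : PA M) (p : (M -> Prop) -> Prop).
Hypotheses (pS : forall D E : M -> Prop, p D -> (forall x, D x -> E x) -> p E)
  (pI : forall D E : M -> Prop, p D -> p E -> p (fun x => D x /\ E x))
  (p0 : ~ p (fun=> False))
  (pU : forall D, definable1 D -> p D \/ p (fun x => ~ D x)).
Notation HM := (proj1 MPA).

Let pT : p (fun=> True).
Proof. by have [//|h] := @pU (fun=> True) (definable_const M True); apply: (pS h). Qed.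

Let pN D : definable1 D -> (p (fun x => ~ D x) <-> ~ p D).
Proof.
move=> dD; split=> [h h'|h]; last by case: (pU dD).
by apply: p0; apply: (pS (pI h h')) => x [].
Qed.

Let eqv (g h : M -> M) := p (fun x => g x = h x).

Let eqv_refl g : eqv g g. Proof. exact: (pS pT). Qed.

Let eqv_sym g h : eqv g h -> eqv h g. Proof. by move=> e; apply: (pS e). Qed.

Let eqv_trans g h k : eqv g h -> eqv h k -> eqv g k.
Proof. by move=> e e'; apply: (pS (pI e e')) => x [-> ->]. Qed.

Let cls (g : M -> M) : set (M -> M) := [set h | fdefinable1 h /\ eqv g h].

(** The quotient of the definable functions, an element being its class. *)
Definition ultra_sort : Type := {C : set (M -> M) | exists g, fdefinable1 g /\ C = cls g}.

Definition mk (g : M -> M) (dg : fdefinable1 g) : ultra_sort :=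
  exist _ (cls g) (ex_intro _ g (conj dg erefl)).

Definition rep (a : ultra_sort) : M -> M := projT1 (cid (proj2_sig a)).

Lemma rep_def a : fdefinable1 (rep a).
Proof. by rewrite /rep; case: cid => g []. Qed.

Let repE a : proj1_sig a = cls (rep a).
Proof. by rewrite /rep; case: cid => g []. Qed.

Lemma rep_mk g (dg : fdefinable1 g) : p (fun x => rep (mk dg) x = g x).
Proof.
have : cls (rep (mk dg)) (rep (mk dg)) by split; [exact: rep_def|exact: eqv_refl].
by rewrite -{1}(repE (mk dg)) => -[_]; exact: eqv_sym.
Qed.

Lemma ultra_eq (a b : ultra_sort) : a = b <-> p (fun x => rep a x = rep b x).
Proof.
split=> [->|e]; first exact: eqv_refl.
have : proj1_sig a = proj1_sig b.
  rewrite !repE; apply/seteqP; split=> h [dh eh]; split=> //.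
    exact: eqv_trans (eqv_sym e) eh.
  exact: eqv_trans e eh.
by case: a b {e} => C hC [D hD] /= e; exact: eq_exist.
Qed.

Let d_add a b : fdefinable1 (fun x => rep a x + rep b x)%A.
Proof. by have da := rep_def a; have db := rep_def b; dfn. Qed.

Let d_mul a b : fdefinable1 (fun x => rep a x * rep b x)%A.
Proof. by have da := rep_def a; have db := rep_def b; dfn. Qed.

Let d_cst (m : M) : fdefinable1 (fun=> m). Proof. by dfn. Qed.

Definition ultrapower : structure :=
  @Structure ultra_sort (mk (d_cst szero)) (mk (d_cst sone))
    (fun a b => mk (d_add a b)) (fun a b => mk (d_mul a b))
    (fun a b => p (fun x => (rep a x <= rep b x)%A)).

Let ev (v : nat -> ultrapower) (x : M) (k : nat) : M := rep (v k) x.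

Let ev_scons (a : ultrapower) (v : nat -> ultrapower) x : ev (scons a v) x = scons (rep a x) (ev v x).
Proof. by apply/funext => -[]. Qed.

Let los_teval (v : nat -> ultrapower) t : p (fun x => rep (teval v t) x = teval (ev v x) t).
Proof.
elim: t => [n|||s IHs t IHt|s IHs t IHt] /=.
- exact: eqv_refl.
- exact: rep_mk.
- exact: rep_mk.
- apply: (pS (pI (rep_mk (d_add (teval v s) (teval v t))) (pI IHs IHt))).
  by move=> x [-> [-> ->]].
- apply: (pS (pI (rep_mk (d_mul (teval v s) (teval v t))) (pI IHs IHt))).
  by move=> x [-> [-> ->]].
Qed.

Let dsat (v : nat -> ultrapower) (phi : fo_formula) :
  definable1 (fun x => fo_sat (ev v x) phi).
Proof.
apply: (@definable_sat _ void _ _ phi (fun k e => rep (v k) (e 0))) => [[]|k].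
exact: rep_def.
Qed.

(* Definable choice of witnesses, by least elements. *)
Let choice (Q : M -> M -> Prop) : definable2 Q -> p (fun x => exists y, Q x y) ->
  exists a : ultrapower, p (fun x => Q x (rep a x)).
Proof.
move=> dQ h.
pose L x y := Q x y /\ forall z, Q x z -> (y <= z)%A.
pose G x y := L x y \/ ((~ exists z, Q x z) /\ y = szero).
have exG x : exists y, G x y.
  have [hx|hx] := pselect (exists z, Q x z); last by exists szero; right.
  by have [|y hy] := pa_least MPA _ hx; [dfn|exists y; left].
pose g x := the_elt (G x).
have gP x : G x (g x) by exact: the_eltP.
have dg : fdefinable1 g.
  apply: (@fdefinable_graph _ _ (fun y e => G (e 0) y)) => [|e //|e y].
    by rewrite /G /L; dfn.
  have := gP (e 0); move: (g _) => y'.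
  move=> [[h1 h2]|[n ->]] [[h3 h4]|[n' ->]] //.
  - exact: (pa_le_anti HM (h4 _ h1) (h2 _ h3)).
  - by case: n'; exists y'.
  - by case: n; exists y.
exists (mk dg : ultrapower); apply: (pS (pI h (rep_mk dg))) => x [hx ->].
by case: (gP x) => [[]|[]].
Qed.

Let L (phi : fo_formula) : Prop := forall v : nat -> ultrapower,
  fo_sat v phi <-> p (fun x => fo_sat (ev v x) phi).

Let L_iff phi psi :
  (forall (K : structure) (v : nat -> K), fo_sat v phi <-> fo_sat v psi) ->
  L psi -> L phi.
Proof.
by move=> e l v; rewrite e l; split=> h; apply: (pS h) => x; rewrite e.
Qed.

Let L_not f : L f -> L (fnot f).
Proof.
move=> l v; have e := pN (dsat v f); split=> [h|h].
  by apply/e => /l.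
by move=> /l; exact/e.
Qed.

Let L_and f g : L f -> L g -> L (fand f g).
Proof.
move=> lf lg v; split=> [[/lf hf /lg hg]|h]; first exact: (pI hf hg).
by split; [apply/lf|apply/lg]; apply: (pS h) => x [].
Qed.

Let L_ex f : L f -> L (fex f).
Proof.
move=> l v; split=> [[a /l h]|h]; first by apply: (pS h) => x; rewrite ev_scons; exists (rep a x).
have [|a ha] := @choice (fun x y => fo_sat (scons y (ev v x)) f) _ h.
  apply: (@definable_sat _ void _ _ f
    (fun k e => if k is k'.+1 then rep (v k') (e 0) else e 1)) => [[]|[|k]].
    exact: fdefinable_var.
  exact: rep_def.
by exists a; apply/l; apply: (pS ha) => x; rewrite ev_scons.
Qed.

Let L_le s t : L (fle s t).
Proof.
move=> v; rewrite /fo_sat /=; have h := pI (los_teval v s) (los_teval v t).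
by split=> h'; apply: (pS (pI h h')) => x [[-> ->]].
Qed.

Let L_all f : L f -> L (fall f).
Proof.
move=> l; apply: (@L_iff _ (fnot (fex (fnot f)))); last by apply/L_not/L_ex/L_not.
move=> K v; rewrite /fo_sat /=; split=> [h [x]|h x]; first exact.
by apply: contrapT => n; apply: h; exists x.
Qed.

Theorem los phi : L phi.
Proof.
elim: phi => [s t|s t|t []|f IH|f IHf g IHg|f IHf g IHg|t f IH|t f IH|f IH|f IH].
- move=> v; have h := pI (los_teval v s) (los_teval v t).
  split=> [/ultra_eq h'|h'].
    by apply: (pS (pI h h')) => x [[e1 e2]]; rewrite /fo_sat /= e1 e2.
  by apply/ultra_eq; apply: (pS (pI h h')) => x [[-> ->]].
- exact: L_le.
- exact: L_not.
- exact: L_and.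
- apply: (@L_iff _ (fnot (fand (fnot f) (fnot g)))); last by apply/L_not/L_and; exact: L_not.
  by move=> K v; rewrite /fo_sat /= not_andP !notK.
- apply: (@L_iff _ (fex (fand (fle (tvar 0) (tren succn t)) f))).
    by move=> K v; rewrite /fo_sat /=; split=> -[x [h1 h2]]; exists x; split=> //; move: h1; rewrite teval_ren.
  by apply/L_ex/L_and.
- apply: (@L_iff _ (fall (fnot (fand (fle (tvar 0) (tren succn t)) (fnot f))))).
    move=> K v; rewrite /fo_sat /=; split=> h x.
      by rewrite teval_ren => -[/h].
    move=> xt; apply: contrapT => n; apply: (h x); split=> //.
    by rewrite teval_ren.
  by apply/L_all/L_not/L_and => //; exact: L_not.
- exact: L_ex.
exact: L_all.
Qed.

(** Only finitely many variables occur in a formula, so the representatives agree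
    simultaneously on a set of the filter. *)
Lemma los_rep (phi : fo_formula) (v : nat -> ultrapower) (g : nat -> M -> M) :
  (forall k, p (fun x => rep (v k) x = g k x)) ->
  (fo_sat v phi <-> p (fun x => fo_sat (g^~ x) phi)).
Proof.
move=> h; have hn n : p (fun x => forall k, k < n -> rep (v k) x = g k x).
  elim: n => [|n IH]; first by apply: (pS pT).
  apply: (pS (pI IH (h n))) => x [e1 e2] k; rewrite ltnS leq_eqVlt => /orP[/eqP ->|] //.
  exact: e1.
rewrite (los phi v); have e := hn (ffv phi).
by split=> h'; apply: (pS (pI e h')) => x [e1];
  [apply: (proj1 (sat_fv _ _))|apply: (proj1 (sat_fv _ _))] => k kn; rewrite /ev e1.
Qed.

Definition ultra_cst (m : M) : ultrapower := mk (d_cst m).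

Let d_id : fdefinable1 (fun x : M => x). Proof. by dfn. Qed.

Definition ultra_gen : ultrapower := mk d_id.

Lemma ultra_elementary : elementary ultra_cst.
Proof.
move=> phi v; rewrite (@los_rep phi (ultra_cst \o v) (fun k _ => v k)); last first.
  by move=> k; exact: rep_mk.
split=> h; first exact: (pS pT).
by apply: contrapT => n; apply: p0; apply: (pS h).
Qed.

Lemma ultra_PA : PA ultrapower.
Proof. exact: elementary_PA ultra_elementary MPA. Qed.

(** In a formula defining [Q], the generator replaces the first argument and the
    parameters become constants; Los's theorem evaluates the result. *)
Lemma ultra_lift (Q : M -> M -> Prop) : definable2 Q ->
  exists (phi : fo_formula) (w : nat -> ultrapower),
    (forall k, w k = ultra_gen \/ exists m, w k = ultra_cst m) /\
    forall a : ultrapower, fo_sat (scons a w) phi <-> p (fun x => Q x (rep a x)).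
Proof.
move=> [phi [s h]].
pose r k := if s k is inl 1 then 0 else k.+1.
pose w k : ultrapower := match s k with
  | inl 0 => ultra_gen | inl _ => ultra_cst szero | inr m => ultra_cst m end.
exists (fren r phi), w; split=> [k|a].
  by rewrite /w; case: (s k) => [[|n]|m]; [left|right; exists szero|right; exists m].
rewrite (@los_rep _ _ (fun k x => if k is k'.+1 then
  match s k' with inl 0 => x | inl _ => szero | inr m => m end else rep a x)).
  have e x : fo_sat (fun k : nat => if k is k'.+1 then
      match s k' with inl 0 => x | inl _ => szero | inr m => m end else rep a x)
      (fren r phi) <-> Q x (rep a x).
    rewrite /fo_sat sat_ren.
    have := h (fun k => match k with 0 => x | 1 => rep a x | _ => szero end).
    rewrite /= => ->; split; apply: fo_sat_eq => k; rewrite /r /=;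
      by case E: (s k) => [[|[|n]]|m] //=; rewrite E.
  by split=> h'; apply: (pS h') => x /e.
case=> [|k] /=; first exact: eqv_refl.
by rewrite /w; case: (s k) => [[|n]|m]; exact: rep_mk.
Qed.

Lemma ultra_generates : generates ([set ultra_gen] `|` range ultra_cst).
Proof.
move=> [K [e [[ee ne] sub]]]; apply: ne; apply/seteqP; split=> // a _.
have dQ : definable2 (fun x y => y = rep a x) by have da := rep_def a; dfn.
have [phi [w [hw hphi]]] := ultra_lift dQ.
have [||y [ey hy]] := @range_witnessed _ _ _ ee phi w.
- move=> k; apply: sub; case: (hw k) => [->|[m ->]]; first by left.
  by right; exists m.
- by exists a; apply/hphi; exact: eqv_refl.
suff -> : a = y by [].
by apply/ultra_eq; move/hphi: hy; exact: eqv_sym.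
Qed.

Lemma ultra_cofinal b : p (fun x => (x <= b)%A) ->
  forall a : ultrapower, exists m, (a <= ultra_cst m)%A.
Proof.
move=> pb a; have [m hm] := pa_bounded MPA b (rep_def a); exists m.
by apply: (pS (pI pb (rep_mk (d_cst m)))) => x [/hm h ->].
Qed.

Lemma ultra_proper : (forall m, ~ p (fun x => x = m)) -> range ultra_cst <> setT.
Proof.
move=> np e; have [m _ em] : range ultra_cst ultra_gen by rewrite e.
apply: (np m); have /ultra_eq h := em.
by apply: (pS (pI h (pI (rep_mk (d_cst m)) (rep_mk d_id)))) => x [e1 [e2 e3]];
  rewrite -e3 -e1 e2.
Qed.

End Ultrapower.

(** * Cuts and elementary extensions *)

Section PowerFormula.

Let shift := tren succn.
Let mform (d i : term) := tadd tone (tmul (tadd i tone) d).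
Let bform (c d i u : term) : fo_formula :=
  fand (fand (fle u (mform d i)) (fnot (feq u (mform d i))))
       (fex (feq (shift c) (tadd (tmul (tvar 0) (shift (mform d i))) (shift u)))).

(* variables: a, b; then d, c, a, b; then i, d, c, a, b; then u, i, d, c, a, b *)
Let pform : fo_formula :=
  fex (fex (fand (bform (tvar 1) (tvar 0) tzero tone) (fand
    (fall (for_ (fnot (fand (fle (tvar 0) (tvar 3)) (fnot (feq (tvar 0) (tvar 3)))))
      (fex (fand (bform (tvar 3) (tvar 2) (tvar 1) (tvar 0))
         (bform (tvar 3) (tvar 2) (tadd (tvar 1) tone) (tadd (tvar 0) (tvar 0)))))))
    (bform (tvar 1) (tvar 0) (tvar 2) (tvar 3))))).

Lemma elementary_pow2 (M N : structure) (f : M -> N) (a b : M) :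
  elementary f -> (pow2 a b <-> pow2 (f a) (f b)).
Proof.
have E (K : structure) (x y : K) t : pow2 x y <-> fo_sat (scons x (scons y t)) pform.
  split=> [[c [d [h0 hS ha]]]|[c [d [h0 [hS ha]]]]].
    exists c, d; split=> //; split=> // i.
    have [ix|nx] := pselect (i < x)%A; last by left.
    by right; exact: hS.
  by exists c, d; split=> // i ix; case: (hS i) => // n; case: n.
move=> ef; rewrite (E _ _ _ (fun=> szero)) (E _ _ _ (fun=> f szero)) (ef _ _).
by split; apply: fo_sat_eq => -[|[|k]].
Qed.

End PowerFormula.

Lemma cut_emb_comp (S M N : structure) (MPA : PA M) (j : S -> M) (f : M -> N) :
  elementary f -> cut_emb j ->
  (forall x y, (y <= f (j x))%A -> exists z, f (j z) = y) -> cut_emb (f \o j).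
Proof.
move=> ef jC init; have NPA := elementary_PA ef MPA.
have e3 (x y z : M) (phi : fo_formula) :
    fo_sat (scons x (scons y (scons z (fun=> szero)))) phi <->
    fo_sat (scons (f x) (scons (f y) (scons (f z) (fun=> f szero)))) phi.
  by rewrite (ef _ _); split; apply: fo_sat_eq => -[|[|[|k]]].
split.
- rewrite /= (ce0 jC).
  exact: ((e3 szero szero szero (feq (tvar 0) tzero)).1 erefl).
- rewrite /= (ce1 jC).
  exact: ((e3 sone sone sone (feq (tvar 0) tone)).1 erefl).
- move=> x y; rewrite /= (ceD jC).
  exact: ((e3 (j x) (j y) (j x + j y)%A (feq (tvar 2) (tadd (tvar 0) (tvar 1)))).1 erefl).
- move=> x y; rewrite /= (ceM jC).
  exact: ((e3 (j x) (j y) (j x * j y)%A (feq (tvar 2) (tmul (tvar 0) (tvar 1)))).1 erefl).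
- move=> x y /= e; apply: (ceI jC).
  exact: ((e3 (j x) (j y) (j y) (feq (tvar 0) (tvar 1))).2 e).
- move=> x y; rewrite (ce_le jC).
  exact: (e3 (j x) (j y) (j y) (fle (tvar 0) (tvar 1))).
- move=> x y; exact: init.
- have [c hc] := ce_top jC; exists (f c) => x.
  exact: ((e3 (j x) c c (fand (fle (tvar 0) (tvar 1)) (fnot (feq (tvar 0) (tvar 1))))).1 (hc x)).
move=> x; have [y ey] := ce_exp jC x; exists y => /=.
by apply/(pow2E NPA)/(elementary_pow2 _ _ ef)/(pow2E MPA).
Qed.

(** * The generic extension *)

Section Generic.
Variables (S M : structure) (MPA : PA M) (j : S -> M).
Hypothesis jC : cut_emb j.
Variable X : set (set S).
Hypotheses (codX : coded j `<=` X) (XW : WKL0s X).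
Variables (Phi : nat -> M -> M -> Prop) (A : nat -> set S).
Hypotheses (dPhi : forall n, definable2 (Phi n)) (XA : forall n, X (A n))
  (PhiE : forall D, definable1 D -> exists n i, forall x, D x <-> Phi n x (j i)).
Notation HM := (proj1 MPA).

(* Binary relations whose second argument lies in the cut are treated by the
   same families, the pairing taking that argument along. *)
Let Rel n (x k : M) : Prop := exists k' i, k = cpair k' i /\ Phi n (cpair x k') i.

Let dRel n : definable2 (Rel n).
Proof. by have dn := dPhi n; rewrite /Rel; dfn. Qed.

Let RelE Q : definable2 Q -> exists n i, forall x k, Q x k <-> Rel n x (cpair k (j i)).
Proof.
move=> dQ; have [|n [i e]] := PhiE (D := fun z => exists x k, z = cpair x k /\ Q x k).
  by dfn.
exists n, i => x k; split=> [h|[k' [i' [ek]]]].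
  by exists k, (j i); split=> //; apply/e; exists x, k.
have [-> <-] := cpair_inj MPA ek => /e[x' [k'' [e2 h]]].
by have [-> ->] := cpair_inj MPA e2.
Qed.

Variables (c0 : M).
Hypothesis c0S : forall x, (j x < c0)%A.
Let b := exp2 c0.
Notation condition := (@condition S M j X b).

Let step n (C : condition) : exists C' : condition, [/\ refines C C',
  exists B, X B /\ decides C' (Rel n) B &
  exists Psi, definable2 Psi /\ decides C' Psi (A n)].
Proof.
have [C1 [B [XB r1 d1]]] := condition_decide MPA jC codX XW C (dRel n).
have [C2 [Psi [dPsi r2 d2]]] := condition_code MPA jC codX XW C1 (XA n).
exists C2; split; first exact: refines_trans r1 r2.
  by exists B; split=> //; exact: refines_decides r2 d1.
by exists Psi.
Qed.

Let C0 : condition := projT1 (cid (condition_start MPA codX (erefl b) c0S)).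

Let seqC (n : nat) : condition :=
  iteri n (fun k C => projT1 (cid (step k C))) C0.

Let seqC_step n : [/\ refines (seqC n) (seqC n.+1),
  exists B, X B /\ decides (seqC n.+1) (Rel n) B &
  exists Psi, definable2 Psi /\ decides (seqC n.+1) Psi (A n)].
Proof. by rewrite /=; case: cid. Qed.

Let seqC_le m n : (m <= n)%N -> refines (seqC m) (seqC n).
Proof.
move=> /subnK <-; elim: (n - m)%N => [|k IH]; first exact: refines_refl.
by rewrite addSn; apply: refines_trans IH _; case: (seqC_step (k + m)).
Qed.

(** The type generated by the cells of the conditions. *)
Let p (D : M -> Prop) : Prop :=
  exists n t, track (seqC n) t /\ forall x, cell (seqC n) t x -> D x.

Let pS (D E : M -> Prop) : p D -> (forall x, D x -> E x) -> p E.
Proof. by move=> [n [t [Ct h]]] DE; exists n, t; split=> // x /h /DE. Qed.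

Let pI (D E : M -> Prop) : p D -> p E -> p (fun x => D x /\ E x).
Proof.
move=> [n [t [Ct h]]] [m [u [Cu k]]].
have [t' [Ct' ht']] := seqC_le (leq_maxl n m) Ct.
have [u' [Cu' hu']] := seqC_le (leq_maxr n m) Cu.
have [v [Cv hv]] := cell_dir MPA jC Ct' Cu'.
by exists (maxn n m), v; split=> // x /hv[/ht' /h ? /hu' /k].
Qed.

Let p_two D m : p D -> exists x, D x /\ x <> m.
Proof.
move=> [n [t [Ct h]]]; have [x [cx xm]] := cell_two MPA jC m Ct.
by exists x; split=> //; exact: h.
Qed.

Let p0 : ~ p (fun=> False).
Proof. by move=> /(p_two szero)[x []]. Qed.

(* Q belongs to one of the families with a parameter i0, which the pairing moves
   into the argument in the cut; the set decided for the family is pulled back. *)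
Let p_decides Q : definable2 Q -> exists B, X B /\
  forall k, p (fun x => forall i, (i <= k)%A -> (Q x (j i) <-> B i)).
Proof.
move=> /RelE[n [i0 e]]; have [_ [B [XB d]] _] := seqC_step n.
exists [set i | B (cpair i i0)]; split.
  pose phi : so_formula X := fmem (tadd (tmul (tadd (tvar 0) (tvar 1))
    (tadd (tvar 0) (tvar 1))) (tvar 0)) (exist _ B (mem_set XB)).
  exact: (X_bounded XW (phi := phi) (fun=> i0) I).
move=> k; have [t [Ct h]] := d (cpair k i0); exists n.+1, t; split=> // x hx i ik.
rewrite e -(ce_cpair jC); apply: h hx; apply/(ce_le jC); rewrite !(ce_cpair jC).
by apply: (cpair_mono MPA); [apply/(ce_le jC)|exact: (pa_lexx HM)].
Qed.

Let pU D : definable1 D -> p D \/ p (fun x => ~ D x).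
Proof.
move=> dD; have [|B [XB h]] := @p_decides (fun x _ => D x); first by dfn.
have h0 := h szero.
have le0 : ((szero : S) <= szero)%A by apply/(ce_le jC); exact: (pa_lexx HM).
by have [B0|B0] := pselect (B szero); [left|right]; apply: (pS h0) => x /(_ _ le0) ->.
Qed.

Let p_b : p (fun x => (x <= b)%A).
Proof.
have [t Ct] := track_neq0 C0; exists 0%N, t; split=> // x [xb _].
exact: (proj1 xb).
Qed.

Let N := ultrapower p.
Let f : M -> N := ultra_cst p.
Let NPA : PA N := ultra_PA MPA pS pI p0 pU.
Let ef : elementary f := ultra_elementary MPA pS pI p0 pU.

Let rep_f m : p (fun x => rep (f m) x = m).
Proof. exact: rep_mk. Qed.

(* If a stays below i on the type, the relation a(x) <= k is settled uniformly for
   k <= i; so the value of a is constant on a cell and lies in the cut. *)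
Let no_new (i : S) (a : N) : (a <= f (j i))%A -> exists z, f (j z) = a.
Proof.
move=> ai; have da := rep_def a.
have {}ai : p (fun x => (rep a x <= j i)%A) by apply: (pS (pI ai (rep_f (j i)))) => x [+ <-].
have [|B [XB h]] := @p_decides (fun x k => (rep a x <= k)%A); first by dfn.
have hi := pI (h i) ai; have [x0 [[hx0 x0i] _]] := p_two szero hi.
have [z ez] := ce_init jC x0i.
have le_zi : (z <= i)%A by apply/(ce_le jC); rewrite ez.
have Bz : B z by apply/(hx0 z le_zi); rewrite ez; exact: (pa_lexx HM).
exists z; apply/(ultra_eq pS pI pU).
apply: (pS (pI hi (rep_f (j z)))) => x [[hx xi] ->].
have xz : (rep a x <= j z)%A by apply/(hx z le_zi).
have [y ey] := ce_init jC xz.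
have yi : (y <= i)%A by apply/(ce_le jC); rewrite ey.
apply: (pa_le_anti HM _ xz); rewrite ez -ey; apply/(hx0 y yi)/(hx y yi).
by rewrite ey; exact: (pa_lexx HM).
Qed.

(** Deciding all relations uniformly on the cut keeps the cut initial and every
    coded set in [X]; coding [A n] at stage [n] gives the converse for the [A n]. *)
Theorem generic_extension : exists (K : structure) (g : M -> K),
  [/\ cofinal_ext g, generated_ext unit g, cut_emb (g \o j),
      coded (g \o j) `<=` X & forall n, coded (g \o j) (A n)].
Proof.
exists N, f; split.
- split; last exact: (ultra_cofinal MPA pS pI pU p_b).
  split=> //; apply: (ultra_proper pS pI pU) => m /(p_two m)[x [e]]; exact.
- exists (range (fun _ : unit => ultra_gen p)); split; first exact: card_image_le.
  apply: generates_sub (ultra_generates MPA pS pI p0 pU) => a [->|]; last by right.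
  by left; exists tt.
- exact: (cut_emb_comp MPA ef jC no_new).
- move=> _ [D [/DefP[phi [v ->]] ->]].
  pose Q x y := fo_sat (scons y (fun k => rep (v k) x)) phi.
  have dQ : definable2 Q.
    apply: (@definable_sat _ void _ _ phi (fun k e =>
      if k is k'.+1 then rep (v k') (e 0%N) else e 1%N)) => [[]|[|k]].
      exact: fdefinable_var.
    exact: rep_def.
  have [B [XB h]] := p_decides dQ.
  have le_refl (i : S) : (i <= i)%A by apply/(ce_le jC); exact: (pa_lexx HM).
  suff -> : [set i | fo_sat (scons (f (j i)) v) phi] = B by [].
  apply/seteqP; split=> i; rewrite /=
    (@los_rep _ MPA p pS pI p0 pU phi (scons (f (j i)) v)
       (fun k x => scons (j i) (fun k => rep (v k) x) k)); try by
    case=> [|k] /=; [exact: rep_f|apply: (pS p_b)].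
    move=> h'; apply: contrapT => nB; apply: p0.
    by apply: (pS (pI h' (h i))) => x [hx /(_ i (le_refl i))[]] /(_ hx).
  by move=> Bi; apply: (pS (h i)) => x /(_ i (le_refl i))[_]; apply.
move=> n; have [_ _ [Psi [dPsi dec]]] := seqC_step n.
have [phi [w [_ hphi]]] := ultra_lift MPA pS pI p0 pU dPsi.
exists (fun a => fo_sat (scons a w) phi); split.
  by apply/DefP; exists phi, w.
have le_refl (i : S) : (i <= i)%A by apply/(ce_le jC); exact: (pa_lexx HM).
have decp i : p (fun x => Psi x (j i) <-> A n i).
  by have [t [Ct h]] := dec i; exists n.+1, t; split=> // x; exact: h.
apply/seteqP; split=> i /= hi.
  apply/hphi; apply: (pS (pI (decp i) (rep_f (j i)))) => x [e ->].
  exact/e.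
apply: contrapT => nA; apply: p0; move/hphi: hi => hi.
by apply: (pS (pI hi (pI (decp i) (rep_f (j i))))) => x [+ [e er]]; rewrite er => /e.
Qed.

End Generic.

(** * The equivalence *)

Lemma Delta1_Def_mono (S : structure) (Y Z : set (set S)) :
  Y `<=` Z -> Delta1_Def Y `<=` Delta1_Def Z.
Proof.
move=> YZ B [phi [psi [v [sphi ppsi e1 e2]]]].
pose h (A : Y) : Z := exist _ (val A) (mem_set (YZ _ (set_valP A))).
have hE (A : Y) : val A = val (h A) by [].
exists (fmap h phi), (fmap h psi), v; split.
- exact: (proj1 (Sigma_Pi_fmap h 1)).
- exact: (proj2 (Sigma_Pi_fmap h 1)).
- by rewrite e1; apply/seteqP; split=> x /(sat_fmap hE).
- by rewrite e2; apply/seteqP; split=> x /(sat_fmap hE).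
Qed.

Section Equivalence.
Variables (M : structure) (MPA : PA M) (I : set M) (cI : cut I) (eI : exp_closed I).
Variable X : set (set M).
Hypothesis XI : forall A, X A -> A `<=` I.

Let S := cut_structure MPA cI eI.
Let j : S -> M := @set_val M I.
Let Xs : set (set S) := cut_family MPA cI eI X.

Let jI (x : S) : I (j x). Proof. exact: set_valP. Qed.

Let jsurj x : I x -> exists y : S, j y = x.
Proof. by move=> Ix; exists (exist _ x (mem_set Ix)). Qed.

Let I_down x y : I y -> (x <= y)%A -> I x.
Proof.
case: cI => _ _ dn Iy xy; apply: dn Iy _.
exact: (pa_le_trans (proj1 MPA) xy (Defs.pa_leD MPA y sone)).
Qed.

Let jC : cut_emb j.
Proof.
split=> //.
- by move=> x y yx; apply: jsurj; exact: I_down (jI x) yx.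
- have [c nc] : exists c, ~ I c.
    apply: contrapT => n; case: cI => _ + _; apply; apply/seteqP; split=> // x _.
    by apply: contrapT => nx; apply: n; exists x.
  exists c => x; apply/(pa_leNgt MPA) => cx; apply: nc; exact: I_down (jI x) cx.
move=> x; have [y /(pow2E MPA) -> Iy] := eI (jI x); exact: jsurj.
Qed.

Let Ipr x y : I x -> I y -> I (cpair x y).
Proof.
by move=> /jsurj[x' <-] /jsurj[y' <-]; rewrite -(ce_cpair jC); exact: jI.
Qed.

Let I0 : I !=set0. Proof. by case: cI. Qed.

Lemma Cod_coded (K : structure) (g : M -> K) : cut_emb (g \o j) ->
  (Cod (g @` I) = [set g @` A | A in X] <-> coded (g \o j) = Xs).
Proof.
move=> JC.
have gI x y : I x -> I y -> g x = g y -> x = y.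
  by move=> /jsurj[x' <-] /jsurj[y' <-] e; congr j; exact: (ceI JC).
have gA A x : X A -> I x -> (g @` A) (g x) -> A x.
  by move=> XA Ix [a Aa e]; rewrite -(gI a x (XI XA Aa) Ix e).
split=> e; apply/seteqP; split.
- move=> _ [D [/DefP dD ->]].
  have : Cod (g @` I) ((g @` I) `&` D) by exists D.
  rewrite e => -[A XA eA]; exists A => //; apply/seteqP; split=> x /=.
    move=> Ax; have : (g @` A) (g (j x)) by exists (j x).
    by rewrite eA => -[].
  move=> Dx; apply: (gA A (j x) XA (jI x)); rewrite eA; split=> //.
  by exists (j x) => //; exact: jI.
- move=> _ [A XA <-].
  have : [set g @` A | A in X] (g @` A) by exists A.
  rewrite -e => -[D /DefP dD eA]; exists D; split=> //.
  apply/seteqP; split=> x /=.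
    move=> Ax; have : (g @` A) (g (j x)) by exists (j x).
    by rewrite -eA => -[].
  move=> Dx; apply: (gA A (j x) XA (jI x)); rewrite -eA; split=> //.
  by exists (j x) => //; exact: jI.
- move=> _ [D /DefP dD <-].
  have : coded (g \o j) [set x | D ((g \o j) x)] by exists D.
  rewrite e => -[A XA eA]; exists A => //.
  have eA' x : A (j x) <-> D (g (j x)) by rewrite -[A (j x)]/((j @^-1` A) x) eA.
  apply/seteqP; split=> y /=.
    move=> [a Aa <-]; have Ia := XI XA Aa; split; first by exists a.
    by have [x ejx] := jsurj Ia; rewrite -ejx in Aa *; apply/eA'.
  move=> [[a Ia <-]]; have [x <-] := jsurj Ia => /eA' h; by exists (j x).
move=> _ [A XA <-].
have : Xs (j @^-1` A) by exists A.
rewrite -e => -[D [dD eA]]; exists D; first exact/DefP.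
have eA' x : A (j x) <-> D (g (j x)) by rewrite -[A (j x)]/((j @^-1` A) x) eA.
apply/seteqP; split=> y /=.
  move=> [[a Ia <-]]; have [x <-] := jsurj Ia => /eA' h; by exists (j x).
move=> [a Aa <-]; have Ia := XI XA Aa; split; first by exists a.
by have [x ejx] := jsurj Ia; rewrite -ejx in Aa *; apply/eA'.
Qed.

(** The sets coded in an extension satisfy the theory because the extension is a
    model of arithmetic; they are countably generated because the extension, with
    the base model, is generated by the cut and countably many elements. *)
Lemma extension_theory (N : structure) (f : M -> N) : generated_over nat I ->
  cofinal_ext f -> generated_ext nat f -> Cod_ext_eq f I X ->
  WKL0s Xs /\ so_generated nat Xs.
Proof.
move=> gI [[ef _] _] gf [cfI eCod].
have NPA := elementary_PA ef MPA.
have JC : cut_emb (f \o j).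
  apply: (cut_emb_comp MPA ef jC) => x y yx.
  have [_ _ dn] := cfI; have [||z Iz <-] := dn y (f (j x)).
  - by exists (j x) => //; exact: jI.
  - exact: (pa_le_trans (proj1 NPA) yx (Defs.pa_leD NPA _ sone)).
  by have [z' <-] := jsurj Iz; exists z'.
have <- : coded (f \o j) = Xs by apply/(Cod_coded JC).
split; first by split; [exact: (coded_RCA NPA JC)|exact: (coded_WKL NPA JC)].
have [m gm] := generated_trans MPA ef I0 gI gf.
have fI0 : (f @` I) !=set0 by have [i Ii] := I0; exists (f i), i.
have fIpr x y : (f @` I) x -> (f @` I) y -> (f @` I) (cpair x y).
  move=> [a /jsurj[a' <-] <-] [b /jsurj[b' <-] <-].
  exists (j (cpair a' b')); first exact: jI.
  exact: (ce_cpair JC).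
have [Phi [dPhi PhiE]] := generated_families NPA fI0 fIpr gm.
apply: (coded_generated NPA JC dPhi) => D /PhiE[n [_ [[i /jsurj[i' <-] <-] e]]].
by exists n, i'.
Qed.

(** It is enough to code a countable generating family, the coded sets being closed
    under Delta_1 comprehension. *)
Lemma extension_exists : generated_over nat I -> Cod I `<=` X ->
  WKL0s Xs -> so_generated nat Xs -> exists (N : structure) (f : M -> N),
    [/\ cofinal_ext f, generated_ext unit f & Cod_ext_eq f I X].
Proof.
move=> gI codX XW [X0 [X0X cX0 gX]].
have codXs : coded j `<=` Xs.
  move=> _ [D [dD ->]]; exists (I `&` D); first by apply: codX; exists D => //; exact/DefP.
  by apply/seteqP; split=> x /=; [case|split=> //; exact: jI].
have XT : Xs setT.
  by apply: codXs; exists (fun=> True); split; [dfn|apply/seteqP; split].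
have [m0 hm0] := countable_enum setT cX0.
pose A n := if pselect (Xs (m0 n)) is left _ then m0 n else setT.
have XA n : Xs (A n) by rewrite /A; case: pselect.
have [m gm] := generated_enum gI.
have [Phi [dPhi PhiE]] := generated_families MPA I0 Ipr gm.
have PhiE' D : definable1 D -> exists n i, forall x, D x <-> Phi n x (j i).
  by move=> /PhiE[n [_ [/jsurj[i <-] e]]]; exists n, i.
have [c0 c0S] := ce_top jC.
have [N [f [cof gen JC codJ AJ]]] := generic_extension MPA jC codXs XW dPhi XA PhiE' c0S.
exists N, f; split=> //.
have NPA : PA N by case: cof => -[ef _] _; exact: elementary_PA ef MPA.
split.
  split.
  - by have [i Ii] := I0; exists (f i), i.
  - move=> e; have [c hc] := ce_top JC.
    have [a /jsurj[x <-] ejx] : (f @` I) c by rewrite e.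
    by case: (hc x) => _; apply.
  move=> y _ [a /jsurj[x <-] <-].
  rewrite -[f (j x)]/((f \o j) x) -(ce1 JC) -(ceD JC) => /(ce_init JC)[z <-].
  by exists (j z) => //; exact: jI.
apply/(Cod_coded JC); apply/seteqP; split=> // B XB.
have [_ _ dca] := coded_RCA NPA JC; apply: dca.
apply: Delta1_Def_mono (gX _ XB) => C X0C.
have [n _ en] := hm0 _ X0C; have := AJ n; rewrite /A en.
by case: pselect => // nX; case: nX; exact: X0X.
Qed.

End Equivalence.

Unset Implicit Arguments.

Theorem theorem2p1 (M : structure) (MPA : PA M) (I : set M)
    (cI : cut I) (eI : exp_closed I) (gI : generated_over nat I)
    (X : set (set M))
    (codX : Cod I `<=` X) (XI : forall A, X A -> A `<=` I) :
  [<-> WKL0s (cut_family MPA cI eI X) /\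
       so_generated nat (cut_family MPA cI eI X);
       exists (N : structure) (f : M -> N),
         [/\ cofinal_ext f, generated_ext nat f & Cod_ext_eq f I X];
       exists (N : structure) (f : M -> N),
         [/\ cofinal_ext f, generated_ext unit f & Cod_ext_eq f I X]].
Proof.
have h13 := @extension_exists M MPA I cI eI X XI gI codX.
have h21 N f : [/\ cofinal_ext f, generated_ext nat f & Cod_ext_eq f I X] -> _ :=
  fun '(And3 a b c) => @extension_theory M MPA I cI eI X XI N f gI a b c.
have h32 (N : structure) (f : M -> N) : generated_ext unit f -> generated_ext nat f.
  move=> [Y [cY gY]]; exists Y; split=> //.
  by apply: card_le_trans cY _; exact: countableP.
tfae.
- move=> [/h13 h /h [N [f [a b c]]]]; exists N, f; split=> //; exact: h32.
- by move=> [N [f /h21[/h13 h /h]]].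
by move=> [N [f [a /h32 b c]]]; apply: (h21 N f).
Qed.
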